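(* Fix data $u_0\in H$, $f\in L^2(0,T;V^* )$, $\psi\in L^2(-\tau,0;V)$, and for $\sigma\in\mathcal M^0([0,\tau])$ let $u_\sigma\in\mathcal W(0,T)$ be the weak solution of the delay problem with kernel $\sigma$ and these data. (i) Let $\mu,\nu\in\mathcal M^0([0,\tau])$ and let $\beta\ge0$ satisfy $\alpha_0-\Lambda_1\kappa_\mu(\beta)>0$. Then $$\|u_\mu-u_\nu\|_{L^2_\beta(0,T;V)}\le\frac{\Lambda_1\|\mu-\nu\|_{\mathcal M([0,\tau])}}{\alpha_0-\Lambda_1\kappa_\mu(\beta)}\,\|\tilde u_\nu\|_{L^2(-\tau,T;V)}.$$ (ii) Let $\mu_n,\mu\in\mathcal M^0([0,\tau])$ satisfy $\|\mu_n-\mu\|_{\mathcal M([0,\tau])}\to0$ as $n\to\infty$. Then $u_{\mu_n}\to u_\mu$ in $\mathcal W(0,T)\cap\mathcal C([0,T];H)$.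
   Context: Fix real numbers $T>0$ and $\tau>0$. $V,H$ are real separable Hilbert spaces with $V\hookrightarrow H$ continuously and densely; $H$ is identified with its dual, giving the Gelfand triple $V\hookrightarrow H\cong H^*\hookrightarrow V^*$, and $\langle\cdot,\cdot\rangle$ is the duality pairing between $V^*$ and $V$. $a_0,a_1:V\times V\to\mathbb R$ are bilinear forms and $\Lambda_0,\Lambda_1,\alpha_0>0$ are constants with $|a_i(w,v)|\le\Lambda_i\|w\|_V\|v\|_V$ for all $w,v\in V$, $i\in\{0,1\}$, and $a_0(v,v)\ge\alpha_0\|v\|_V^2$ for all $v\in V$. The operators $A_i\in\mathcal L(V,V^* )$ are given by $\langle A_iw,v\rangle=a_i(w,v)$. $\mathcal M([0,\tau])$ is the Banach space of finite signed Borel measures on $[0,\tau]$ with norm $\|\sigma\|_{\mathcal M([0,\tau])}=|\sigma|([0,\tau])$, where $|\sigma|$ is the total variation measure; $\mathcal M^0([0,\tau])=\{\sigma\in\mathcal M([0,\tau]):|\sigma|(\{0\})=0\}$. For $\beta\ge0$, $\kappa_\mu(\beta):=\int_{[0,\tau]}e^{-\beta s}\,d|\mu|(s)$. For a Hilbert space $X$, $\|g\|_{L^2_\beta(0,T;X)}:=\bigl(\int_0^Te^{-2\beta t}\|g(t)\|_X^2\,dt\bigr)^{1/2}$. For $\sigma\in\mathcal M([0,\tau])$ and $g\in L^2(-\tau,T;V)$, $\mathcal K_\sigma g\in L^2(0,T;V^* )$ is defined by $(\mathcal K_\sigma g)(t)=\int_{[0,\tau]}A_1g(t-s)\,d\sigma(s)$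 for a.e. $t\in(0,T)$ (Bochner integral, using any Borel strongly measurable representative of $g$; the resulting element of $L^2(0,T;V^* )$ does not depend on the representative). $\mathcal W(0,T)=\{u\in L^2(0,T;V):\partial_tu\in L^2(0,T;V^* )\}$ with norm $\|u\|_{\mathcal W(0,T)}=\bigl(\|u\|_{L^2(0,T;V)}^2+\|\partial_tu\|_{L^2(0,T;V^* )}^2\bigr)^{1/2}$; it embeds into $\mathcal C([0,T];H)$, and pointwise values refer to the $H$-continuous representative. For $u:(0,T)\to V$ the joined trajectory is $\tilde u(t)=\psi(t)$ for $-\tau<t<0$ and $\tilde u(t)=u(t)$ for $0<t<T$. For $\mu\in\mathcal M^0([0,\tau])$, the weak solution $u_\mu$ of the delay problem with kernel $\mu$ and data $(u_0,f,\psi)$ is the (unique) $u\in\mathcal W(0,T)$ with $u(0)=u_0$ in $H$ and $\partial_tu(t)+A_0u(t)+(\mathcal K_\mu\tilde u)(t)=f(t)$ in $V^*$ for a.e. $t\in(0,T)$. *)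

(* Defs.v *)
From HB Require Import structures.
From mathcomp Require Import all_boot all_order all_algebra.
From mathcomp Require Import all_classical all_reals all_analysis.
From mathcomp Require Import ring.

Set Implicit Arguments.
Unset Strict Implicit.
Unset Printing Implicit Defensive.

Import Order.TTheory GRing.Theory Num.Theory.
Import numFieldNormedType.Exports.

Local Open Scope classical_set_scope.
Local Open Scope ring_scope.

HB.mixin Record CompleteNormedModule_isHilbert (R : realType) (V : Type)
    & CompleteNormedModule R V := {
  inner : V -> V -> R ;
  innerC : forall x y, inner x y = inner y x ;
  innerDl : forall x y z, inner (x + y) z = inner x z + inner y z ;
  innerZl : forall (k : R) x y, inner (k *: x) y = k * inner x y ;
  inner_norm : forall x, inner x x = `|x| ^+ 2
}.

#[short(type="hilbertType")]
HB.structure Definition Hilbert (R : realType) :=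
  {V of CompleteNormedModule_isHilbert R V & CompleteNormedModule R V}.

Section hilbert_theory.
Context {R : realType} {V : hilbertType R}.

Lemma cauchy_schwarz (x y : V) : `|inner x y| <= `|x| * `|y|.
Proof.
have [->|y0] := eqVneq y 0.
  have -> : inner x 0 = 0.
    by rewrite innerC -(scale0r (0 : V)) innerZl mul0r.
  by rewrite !normr0 mulr0.
pose k := inner x y / `|y| ^+ 2.
have y2 : 0 < `|y| ^+ 2 by rewrite exprn_gt0 ?normr_gt0.
have : 0 <= inner (x + (- k) *: y) (x + (- k) *: y).
  by rewrite inner_norm sqr_ge0.
rewrite innerDl innerZl (innerC x) (innerC y) !innerDl !innerZl !inner_norm.
rewrite (innerC y x).
have -> : `|x| ^+ 2 + - k * inner x y + - k * (inner x y + - k * `|y| ^+ 2) =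
    `|x| ^+ 2 - inner x y ^+ 2 / `|y| ^+ 2.
  by rewrite /k; field; rewrite normr_eq0.
rewrite subr_ge0 ler_pdivrMr// -exprMn => h.
rewrite -(@ler_pXn2r _ 2) ?nnegrE ?mulr_ge0//.
by rewrite real_normK ?num_real.
Qed.

End hilbert_theory.

Definition separable (X : topologicalType) :=
  exists2 S : set X, countable S & dense S.

Section dual.
Context {R : realType} (V : normedModType R).

Definition bounded_linear_form : {pred V -> R} :=
  fun f => `[< scalar f /\ continuous f >].

Lemma bounded_linear_form_submod : submod_closed bounded_linear_form.
Proof.
split.
  apply/asboolP; split; first by move=> k x y /=; rewrite mulr0 addr0.
  by move=> x; exact: cvg_cst.
move=> a f g /asboolP[lf cf] /asboolP[lg cg]; apply/asboolP; split.
  move=> k x y; rewrite !fctE lf lg.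
  by rewrite /GRing.scale/= !mulrDr addrACA !(mulrCA k a).
move=> x; apply: cvgD; last exact: cg.
by apply: cvgZr; exact: cf.
Qed.

HB.instance Definition _ :=
  GRing.isSubmodClosed.Build R (V -> R) bounded_linear_form
    bounded_linear_form_submod.

Record dual := Dual { dual_fun :> V -> R ; _ : dual_fun \in bounded_linear_form }.

HB.instance Definition _ := [isSub for dual_fun].
HB.instance Definition _ := [Choice of dual by <:].
HB.instance Definition _ := [SubChoice_isSubLmodule of dual by <:].

Definition dual_norm (l : dual) : R :=
  sup [set `|l v| | v in [set v : V | `|v| <= 1]].

Lemma dual_scalar (l : dual) : scalar l.
Proof. by case: l => l /= /asboolP[]. Qed.

Lemma dual_continuous (l : dual) : continuous l.
Proof. by case: l => l /= /asboolP[]. Qed.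

Let lin (l : dual) : {linear V -> R} :=
  HB.pack (dual_fun l) (GRing.isLinear.Build _ _ _ _ _ (dual_scalar l)).

Lemma dual_bounded (l : dual) :
  has_sup [set `|l v| | v in [set v : V | `|v| <= 1]].
Proof.
split; first by exists `|l 0|; exists 0 => //=; rewrite normr0.
have /linear_boundedP := proj2 (linear_bounded_continuous (lin l)) (@dual_continuous l).
move=> /pinfty_ex_gt0[M M0 Ml]; exists M => _ [v /= v1 <-].
by rewrite (le_trans (Ml v))// ler_piMr// ltW.
Qed.

Lemma dual_le_norm (l : dual) v : `|l v| <= dual_norm l * `|v|.
Proof.
have [->|v0] := eqVneq v 0.
  by have -> : l 0 = 0 := linear0 (lin l); rewrite !normr0 mulr0.
rewrite -ler_pdivrMr ?normr_gt0//.
apply: sup_upper_bound; first exact: dual_bounded.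
exists (`|v|^-1 *: v) => /=.
  by rewrite normrZ normfV normr_id mulVf ?normr_eq0.
have -> : l (`|v|^-1 *: v) = `|v|^-1 * l v := linearZ_LR (lin l) _ _.
by rewrite normrM normfV normr_id mulrC.
Qed.

Lemma dual_norm_le (l : dual) M :
  (forall v, `|v| <= 1 -> `|l v| <= M) -> dual_norm l <= M.
Proof.
move=> lM; apply: ge_sup; first by case: (dual_bounded l).
by move=> _ [v /= v1 <-]; exact: lM.
Qed.

Lemma dual_ext (l m : dual) : l =1 m -> l = m.
Proof. by move=> lm; apply/val_inj/funext. Qed.

Lemma dual_normD (l m : dual) : dual_norm (l + m) <= dual_norm l + dual_norm m.
Proof.
apply: dual_norm_le => v v1; rewrite (le_trans (ler_normD _ _))// lerD//.
  by apply: sup_upper_bound; [exact: dual_bounded|exists v].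
by apply: sup_upper_bound; [exact: dual_bounded|exists v].
Qed.

Let dual_normZ_le (k : R) (l : dual) : dual_norm (k *: l) <= `|k| * dual_norm l.
Proof.
apply: dual_norm_le => v v1; rewrite [leLHS]normrM ler_wpM2l//.
by apply: sup_upper_bound; [exact: dual_bounded|exists v].
Qed.

Lemma dual_normZ (k : R) (l : dual) : dual_norm (k *: l) = `|k| * dual_norm l.
Proof.
apply/eqP; rewrite eq_le dual_normZ_le /=.
have [->|k0] := eqVneq k 0.
  rewrite normr0 mul0r; have [_ h] := dual_bounded (0 *: l).
  apply: (le_trans (normr_ge0 ((0 *: l : dual) 0))).
  by apply: ub_le_sup => //; exists 0 => //=; rewrite normr0.
rewrite -{1}[l]scale1r -(mulVf k0) -scalerA.
by rewrite (le_trans (ler_wpM2l _ (dual_normZ_le _ _)))// normfV mulrA mulfV ?normr_eq0// mul1r.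
Qed.

Lemma dual_norm_eq0 (l : dual) : dual_norm l = 0 -> l = 0.
Proof.
move=> l0; apply: dual_ext => v; apply/eqP.
by rewrite -normr_le0 (le_trans (dual_le_norm l v))// l0 mul0r.
Qed.

HB.instance Definition _ :=
  Lmodule_isNormed.Build R dual dual_normD dual_normZ dual_norm_eq0.

(* A form that is not linear and continuous is sent to 0. *)
Definition to_dual (f : V -> R) : dual := insubd 0 f.

Lemma to_dualE (f : V -> R) :
  scalar f -> continuous f -> to_dual f = f :> (V -> R).
Proof.
move=> lf cf; rewrite /to_dual val_insubd.
by have -> : f \in bounded_linear_form by apply/asboolP.
Qed.

End dual.

Section to_dual_theory.
Context {R : realType}.

Lemma to_dual_boundedE (V : normedModType R) (f : V -> R) (M : R) :
  scalar f -> (forall v, `|f v| <= M * `|v|) -> to_dual f = f :> (V -> R).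
Proof.
move=> lf fM; apply: to_dualE => //.
pose g : {linear V -> R} := HB.pack f (GRing.isLinear.Build _ _ _ _ _ lf).
apply: (@bounded_linear_continuous _ _ _ g); apply/linear_boundedP.
by near=> r => x; rewrite (le_trans (fM x))// ler_wpM2r.
Unshelve. all: by end_near. Qed.

End to_dual_theory.

Section signed_measures.
Context {d : measure_display} {X : measurableType d} {R : realType}.
Implicit Types sigma : {charge set X -> \bar R}.

Definition hahn_pos sigma : set X := sval (cid (Hahn_decomposition sigma)).

Definition hahn_neg sigma : set X :=
  sval (cid (svalP (cid (Hahn_decomposition sigma)))).

Lemma hahn_posneg sigma :
  hahn_decomposition sigma (hahn_pos sigma) (hahn_neg sigma).
Proof. exact: (svalP (cid (svalP (cid (Hahn_decomposition sigma))))). Qed.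

Definition pos_part sigma : {measure set X -> \bar R} :=
  jordan_pos (hahn_posneg sigma).

Definition neg_part sigma : {measure set X -> \bar R} :=
  jordan_neg (hahn_posneg sigma).

Definition tvar sigma : {measure set X -> \bar R} :=
  charge_variation (hahn_posneg sigma).

Definition csub (mu nu : {charge set X -> \bar R}) :
  {charge set X -> \bar R} := cadd mu (copp nu).

End signed_measures.

(* Finite signed Borel measures on [0, tau] are identified with those on the
   real line that do not charge the complement of [0, tau]. *)
Section delay_measures.
Context {R : realType}.
Implicit Types (sigma : {charge set (measurableTypeR R) -> \bar R}) (tau : R).

Definition Mtau tau sigma : Prop :=
  tvar sigma (~` `[0, tau]%classic) = 0%E.

Definition M0tau tau sigma : Prop :=
  Mtau tau sigma /\ tvar sigma [set 0] = 0%E.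

Definition normM tau sigma : R := fine (tvar sigma `[0, tau]%classic).

Definition kappa tau sigma (beta : R) : R :=
  \int[tvar sigma]_(s in `[0, tau]%classic) expR (- beta * s).

End delay_measures.

Section bochner.
Context {d : measure_display} {X : measurableType d} {R : realType}.
Context {E : normedModType R}.
Implicit Types (mu : {measure set X -> \bar R}) (D : set X) (f : X -> E).

(* [:: (A_1, x_1); ...; (A_n, x_n)] stands for the simple function
   1_(A_1) x_1 + ... + 1_(A_n) x_n. *)
Definition simple := seq (set X * E).

Definition simple_fun (s : simple) (x : X) : E :=
  \sum_(p <- s) (\1_(p.1) x : R) *: p.2.

Definition measurable_simple (s : simple) : Prop :=
  forall p, p \in s -> measurable p.1.

Definition integrable_simple mu D (s : simple) : Prop :=
  forall p, p \in s -> measurable p.1 /\ (mu (p.1 `&` D) < +oo)%E.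

Definition simple_integral mu D (s : simple) : E :=
  \sum_(p <- s) fine (mu (p.1 `&` D)) *: p.2.

Definition strongly_measurable f : Prop :=
  exists2 s : nat -> simple, (forall n, measurable_simple (s n)) &
    forall x, simple_fun (s n) x @[n --> \oo] --> f x.

Definition ae_strongly_measurable mu D f : Prop :=
  exists2 g, strongly_measurable g & f = g %[ae mu in D].

Definition is_bochner_integral mu D f (I : E) : Prop :=
  exists s : nat -> simple,
    [/\ forall n, integrable_simple mu D (s n),
        \forall x \ae mu, D x -> simple_fun (s n) x @[n --> \oo] --> f x,
        (\int[mu]_(x in D) `|f x - simple_fun (s n) x|%:E)%E
          @[n --> \oo] --> 0%E &
        simple_integral mu D (s n) @[n --> \oo] --> I].

Definition bochner mu D f : E := xget 0 [set I | is_bochner_integral mu D f I].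

Definition charge_bochner (sigma : {charge set X -> \bar R}) D f : E :=
  bochner (pos_part sigma) D f - bochner (neg_part sigma) D f.

End bochner.

Section bochner_spaces.
Context {R : realType}.
Local Notation leb := (@lebesgue_measure R).

Section L2.
Context {E : normedModType R}.
Implicit Types (a b beta : R) (g : R -> E).

Definition mem_L2 a b g : Prop :=
  ae_strongly_measurable leb `]a, b[%classic g /\
  (\int[leb]_(t in `]a, b[%classic) (`|g t| ^+ 2)%:E < +oo)%E.

Definition normL2 a b g : R :=
  Num.sqrt (\int[leb]_(t in `]a, b[%classic) (`|g t| ^+ 2)).

Definition normL2w beta a b g : R :=
  Num.sqrt (\int[leb]_(t in `]a, b[%classic)
    (expR (- 2 * beta * t) * `|g t| ^+ 2)).

End L2.

Definition test_function (T : R) (phi : R -> R) : Prop :=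
  (forall n x, derivable (derive1n n phi) x 1) /\
  exists a b, [/\ 0 < a, b < T & forall x, x \notin `[a, b] -> phi x = 0].

Section W.
Context {V H : hilbertType R} (iota : {linear V -> H}) (T : R).
Implicit Types (u : R -> V) (w : R -> dual V) (c : R -> H).

(* the embedding V -> H = H^* -> V^* of the Gelfand triple *)
Definition gelfand (v : V) : dual V :=
  to_dual (fun z => inner (iota v) (iota z)).

Lemma gelfandE v z : continuous iota ->
  gelfand v z = inner (iota v) (iota z).
Proof.
move=> ciota; rewrite /gelfand.
have /linear_boundedP/pinfty_ex_gt0[M M0 Mi] :=
  proj2 (linear_bounded_continuous iota) ciota.
rewrite (@to_dual_boundedE _ _ _ (`|iota v| * M))//.
  by move=> k x y; rewrite linearP innerC innerDl innerZl !(innerC _ (iota v)).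
by move=> x; rewrite (le_trans (cauchy_schwarz _ _))// -mulrA ler_wpM2l.
Qed.

Definition is_weak_derivative u w : Prop :=
  forall phi, test_function T phi ->
    bochner leb `]0, T[%classic (fun t => derive1 phi t *: gelfand (u t)) =
    - bochner leb `]0, T[%classic (fun t => phi t *: w t).

Definition weak_derivative u : R -> dual V :=
  xget (fun=> 0) [set w | mem_L2 0 T w /\ is_weak_derivative u w].

Definition mem_W u : Prop :=
  mem_L2 0 T u /\ exists2 w, mem_L2 0 T w & is_weak_derivative u w.

Definition normW u : R :=
  Num.sqrt (normL2 0 T u ^+ 2 + normL2 0 T (weak_derivative u) ^+ 2).

Definition continuous_rep u c : Prop :=
  {within `[0, T]%classic, continuous c} /\
  \forall t \ae leb, `]0, T[%classic t -> c t = iota (u t).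

Definition normC c : R := sup [set `|c t| | t in `[0, T]%classic].

End W.

Section delay.
Context {V H : hilbertType R} (iota : {linear V -> H}) (a0 a1 : V -> V -> R).
Variables (T tau : R).

Definition form_op (a : V -> V -> R) (w : V) : dual V := to_dual (a w).

Lemma form_opE (a : {biscalar V}) (Lambda : R) w v :
  (forall w v, `|a w v| <= Lambda * `|w| * `|v|) -> form_op a w v = a w v.
Proof.
move=> aL; rewrite /form_op (@to_dual_boundedE _ _ _ (Lambda * `|w|))//.
by move=> k x y; rewrite linearPr.
Qed.

Definition joined (psi u : R -> V) (t : R) : V :=
  if t < 0 then psi t else u t.

(* to be applied to a strongly measurable representative g *)
Definition delay_op (sigma : {charge set (measurableTypeR R) -> \bar R})
    (g : R -> V) (t : R) : dual V :=
  charge_bochner sigma `[0, tau]%classic (fun s => form_op a1 (g (t - s))).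

Definition weak_solution (sigma : {charge set (measurableTypeR R) -> \bar R})
    (u0 : H) (f : R -> dual V) (psi u : R -> V) : Prop :=
  [/\ mem_W iota T u,
      exists2 c, continuous_rep iota T u c & c 0 = u0 &
      exists g : measurableTypeR R -> V,
        [/\ strongly_measurable g,
            joined psi u = g %[ae leb in `](- tau), T[%classic] &
            \forall t \ae leb, `]0, T[%classic t ->
              weak_derivative iota T u t + form_op a0 (u t)
                + delay_op sigma g t = f t]].

End delay.
End bochner_spaces.

(* Main.v *)
(* The difference w of two solutions satisfies w(0) = 0 and
     w' + A0 w + K_mu (past of w) = K_(nu - mu) (past of u_nu).
   Testing with exp(-2 beta t) w, the term in w' is nonnegative and, by Young's inequality
   for convolutions, the weight reduces K_mu to an operator of norm at most
   Lambda1 kappa_mu(beta), which the coercivity of a0 absorbs: this is (i).  For (ii),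
   kappa_mu(beta) -> 0 as beta -> oo because mu does not charge 0, so that one beta serves
   all kernels close to mu; the equation then controls w', and the energy controls |w(t)|_H.
   The sign of the integral of exp(-2 beta t) <w'(t), w(t)> is obtained without the chain rule
   in W(0, T): for h > 0 the integral of <w'(s), w(t)> over t - h < s < t is
   (w(t) - w(t - h), w(t))_H >= (|w(t)|^2 - |w(t - h)|^2) / 2; integrate in t against the
   nonincreasing weight, divide by h, and let h tend to 0. *)
Require Import Defs.
From HB Require Import structures.
From mathcomp Require Import all_boot all_order all_algebra.
From mathcomp Require Import all_classical all_reals all_analysis.
From mathcomp Require Import measurable_realfun.
From mathcomp Require Import ring lra.
Import Order.TTheory GRing.Theory Num.Theory.
Import numFieldNormedType.Exports.
Local Open Scope classical_set_scope.
Local Open Scope ring_scope.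
Set Implicit Arguments.
Unset Strict Implicit.
Unset Printing Implicit Defensive.
Set SsrOldRewriteGoalsOrder.

(** Three devices shape the details. A vector-valued integral is evaluated at a fixed [v] in [V] as
    soon as it appears and so becomes a real integral; a functional is recovered from its values,
    and separability of [V] merges the null sets of the individual vectors. Functions in [L2] are
    known only up to null sets and may fail to be Borel, so all estimates are made on strongly
    measurable representatives. Integrals of products are estimated by Young's inequality with a
    free parameter [e], which is fixed or optimised only at the end.

    The asymmetry of (i) comes from splitting [K_mu g1 - K_nu g2] into [K_mu (g1 - g2)] and
    [K_(mu - nu) g2], where [g1] and [g2] represent the joined trajectories of [u_mu] and [u_nu]:
    only [kappa_mu] multiplies the unknown difference, and [g1 - g2] vanishes before time 0 because
    the history is shared. The uniform bound in [H] uses the same averaged inequality, with the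
    indicator of the past of a fixed time as weight in place of the exponential. *)

Local Notation simples X E := (@simple _ X _ E).

(** * Measurability and Bochner integrals *)

Section ae_integral.
Local Open Scope ereal_scope.
Context d (T : measurableType d) (R : realType) (mu : {measure set T -> \bar R}).
Implicit Types (D N : set T) (f g : T -> \bar R).

Import HBNNSimple.

(** The integral of a nonnegative function, measurable or not, is a supremum over the simple
    functions below it. Setting such a simple function to 0 on [N] keeps its integral and brings it
    below [g]. *)
Lemma ge0_integral_le_negligible N f g : measurable N -> mu N = 0 ->
  (forall x, 0 <= f x) -> (forall x, 0 <= g x) ->
  (forall x, ~ N x -> f x <= g x) -> \int[mu]_x f x <= \int[mu]_x g x.
Proof.
move=> mN N0 f0 g0 fg; rewrite !ge0_integralTE//.
apply: ge_ereal_sup => /= _ [h hf <-].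
have mNC := measurableC mN.
apply: (@le_trans _ _ (sintegral mu (proj_nnsfun h mNC))).
  rewrite -!integralT_nnsfun; apply: ae_ge0_le_integral => //.
  - by move=> x _; rewrite lee_fin.
  - exact/measurable_EFinP.
  - by move=> x _; rewrite lee_fin.
  - exact/measurable_EFinP.
  - exists N; split => // x /= xN; apply: contrapT => Nx; apply: xN => _.
    by rewrite mindicE mem_set ?mulr1.
apply: ereal_sup_ubound; exists (proj_nnsfun h mNC) => //= x.
rewrite mindicE; have [xN|xN] := pselect (N x).
  by rewrite memNset ?mulr0 ?g0//= => /(_ xN).
by rewrite mem_set// mulr1 (le_trans (hf x)) ?fg.
Qed.

Lemma ae_le_ge0_integral D f g :
  (forall x, D x -> 0 <= f x) -> (forall x, D x -> 0 <= g x) ->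
  (\forall x \ae mu, D x -> f x <= g x) ->
  \int[mu]_(x in D) f x <= \int[mu]_(x in D) g x.
Proof.
move=> f0 g0 [N [mN N0 fgN]]; rewrite integral_mkcond [leRHS]integral_mkcond.
apply: (ge0_integral_le_negligible mN N0) => [x|x|x Nx].
- exact: erestrict_ge0.
- exact: erestrict_ge0.
- rewrite /patch; case: ifPn => // /set_mem Dx.
  by apply: contrapT => fgx; apply: Nx; apply: fgN => /= /(_ Dx).
Qed.

(* Unlike [ae_eq_integral], no measurability is assumed: a function that is
   only almost everywhere equal to a Borel one need not be Borel. *)
Lemma ae_eq_integral_nomeas D f g : (\forall x \ae mu, D x -> f x = g x) ->
  \int[mu]_(x in D) f x = \int[mu]_(x in D) g x.
Proof.
move=> fg; rewrite integralE [RHS]integralE; congr (_ - _);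
  apply/eqP; rewrite eq_le; apply/andP; split; apply: ae_le_ge0_integral => //;
  by move: fg; apply: filterS => x + Dx => /(_ Dx) fg; rewrite ?funeposE ?funenegE fg.
Qed.

End ae_integral.

Lemma ae_mono d (T : measurableType d) (R : realType)
    (mu : {measure set T -> \bar R}) (P Q : T -> Prop) :
  (forall x, P x -> Q x) -> (\forall x \ae mu, P x) -> \forall x \ae mu, Q x.
Proof. by move=> PQ; apply: filterS. Qed.

Lemma ae_mono2 d (T : measurableType d) (R : realType)
    (mu : {measure set T -> \bar R}) (P Q S : T -> Prop) :
  (forall x, P x -> Q x -> S x) -> (\forall x \ae mu, P x) ->
  (\forall x \ae mu, Q x) -> \forall x \ae mu, S x.
Proof. by move=> PQS; apply: filterS2. Qed.

Section strong_measurability.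
Context d (X : measurableType d) (R : realType).

Section simple_functions.
Context (E : normedModType R).
Implicit Types (s t : simples X E).

Lemma simple_fun_cons p s x :
  simple_fun (p :: s) x = (\1_(p.1) x : R) *: p.2 + simple_fun s x.
Proof. by rewrite /simple_fun big_cons. Qed.

Lemma simple_fun_cat s t x :
  simple_fun (s ++ t) x = simple_fun s x + simple_fun t x.
Proof. by rewrite /simple_fun big_cat. Qed.

Definition simple_restrict (A : set X) s : simples X E :=
  [seq (p.1 `&` A, p.2) | p <- s].

Lemma simple_fun_restrict A s x :
  simple_fun (simple_restrict A s) x = (\1_A x : R) *: simple_fun s x.
Proof.
rewrite /simple_fun big_map scaler_sumr; apply: eq_bigr => p _.
by rewrite /= indicI scalerA mulrC.
Qed.

Lemma measurable_simple_restrict A s : measurable A -> measurable_simple s ->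
  measurable_simple (simple_restrict A s).
Proof.
move=> mA ms _ /mapP[p ps ->] /=; apply: measurableI => //; exact: ms.
Qed.

Lemma measurable_simple_cons p s : measurable_simple (p :: s) ->
  measurable p.1 /\ measurable_simple s.
Proof.
move=> ms; split; first by apply: ms; rewrite inE eqxx.
by move=> q qs; apply: ms; rewrite inE qs orbT.
Qed.

Lemma measurable_simple_cat s t : measurable_simple s -> measurable_simple t ->
  measurable_simple (s ++ t).
Proof. by move=> ms mt p; rewrite mem_cat => /orP[/ms|/mt]. Qed.

End simple_functions.

(** Whatever [N], the composite takes finitely many values, each on a measurable set. The induction
    varies [N]: removing an entry [(A, e)] leaves two maps of the same form, whose argument is
    translated by [e] on [A] and by 0 off [A]. *)
Lemma measurable_fun_simple2 (E F : normedModType R) (N : E -> F -> R)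
    (s : simples X E) (t : simples X F) :
  measurable_simple s -> measurable_simple t ->
  measurable_fun setT (fun x => N (simple_fun s x) (simple_fun t x)).
Proof.
have ifE (e : E) (G : X -> E -> R) A x : G x ((\1_A x : R) *: e) =
    if x \in A then G x e else G x 0.
  by rewrite indicE; case: ifP; rewrite ?scale1r ?scale0r.
have ifF (e : F) (G : X -> F -> R) A x : G x ((\1_A x : R) *: e) =
    if x \in A then G x e else G x 0.
  by rewrite indicE; case: ifP; rewrite ?scale1r ?scale0r.
have mif A (f g : X -> R) : measurable A -> measurable_fun setT f ->
    measurable_fun setT g ->
    measurable_fun setT (fun x => if x \in A then f x else g x).
  move=> mA mf mg; apply: measurable_fun_ifT => //.
  apply: (measurable_fun_bool true); rewrite setTI.
  by rewrite (_ : _ @^-1` _ = A)//; apply/seteqP; split => x; [move/set_mem|move/mem_set].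
elim: s N => [|p s ihs] N ms mt.
  elim: t N mt => [|p t iht] N mt.
    under eq_fun do rewrite /simple_fun !big_nil; exact: measurable_cst.
  under eq_fun do rewrite simple_fun_cons
    (ifF _ (fun x e => N (simple_fun [::] x) (e + simple_fun t x))).
  have [mp {}mt] := measurable_simple_cons mt.
  apply: mif => //; first exact: (iht (fun e f => N e (p.2 + f))).
  exact: (iht (fun e f => N e (0 + f))).
under eq_fun do rewrite simple_fun_cons
  (ifE _ (fun x e => N (e + simple_fun s x) (simple_fun t x))).
have [mp {}ms] := measurable_simple_cons ms.
apply: mif => //; first exact: (ihs (fun e f => N (p.2 + e) f)).
exact: (ihs (fun e f => N (0 + e) f)).
Qed.

Definition seq_continuous2 (E F : normedModType R) (N : E -> F -> R) :=
  forall (e_ : nat -> E) (f_ : nat -> F) e f,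
    e_ n @[n --> \oo] --> e -> f_ n @[n --> \oo] --> f ->
    N (e_ n) (f_ n) @[n --> \oo] --> N e f.

Lemma measurable_fun_strong2 (E F : normedModType R) (N : E -> F -> R)
    (f : X -> E) (g : X -> F) : seq_continuous2 N ->
  strongly_measurable f -> strongly_measurable g ->
  measurable_fun setT (fun x => N (f x) (g x)).
Proof.
move=> cN [s ms sf] [t mt tg].
apply: (@measurable_fun_cvg _ _ _ _
  (fun n x => N (simple_fun (s n) x) (simple_fun (t n) x))).
  by move=> n; exact: measurable_fun_simple2.
by move=> x _; exact: cN.
Qed.

Lemma measurable_fun_strong_norm (E : normedModType R) (f : X -> E) :
  strongly_measurable f -> measurable_fun setT (fun x => `|f x|).
Proof.
move=> mf; apply: (@measurable_fun_strong2 _ _ (fun (e _ : E) => `|e|) f f) => //.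
by move=> e_ f_ e0 f0 ecv _; exact: cvg_norm.
Qed.

Lemma bilinear_seq_continuous2 (E F : normedModType R) (N : E -> F -> R) M :
  (forall e e' f, N (e - e') f = N e f - N e' f) ->
  (forall e f f', N e (f - f') = N e f - N e f') ->
  (forall e f, `|N e f| <= M * `|e| * `|f|) -> seq_continuous2 N.
Proof.
move=> NBl NBr NM e_ f_ e f ee ff; apply/subr_cvg0/norm_cvg0P.
have h n : `|N (e_ n) (f_ n) - N e f| <=
    M * `|e_ n - e| * `|f_ n| + M * `|e| * `|f_ n - f|.
  rewrite (_ : _ - _ = N (e_ n - e) (f_ n) + N e (f_ n - f)); last first.
    by rewrite NBl NBr addrA subrK.
  by rewrite (le_trans (ler_normD _ _))// lerD.
apply: (squeeze_cvgr (f := fun=> 0) (h := fun n =>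
    M * `|e_ n - e| * `|f_ n| + M * `|e| * `|f_ n - f|)).
- by apply: nearW => n; rewrite normr_ge0 h.
- exact: cvg_cst.
have -> : 0 = M * `|0 : E| * `|f| + M * `|e| * `|0 : F| :> R.
  by rewrite !normr0 !(mulr0, mul0r) addr0.
apply: cvgD; first apply: cvgM.
- by apply: cvgMr; apply: cvg_norm; exact/subr_cvg0.
- exact: cvg_norm.
- by apply: cvgMr; apply: cvg_norm; exact/subr_cvg0.
Qed.

Lemma strongly_measurable_map (E F : normedModType R) (L : {linear E -> F})
    (f : X -> E) : continuous L ->
  strongly_measurable f -> strongly_measurable (L \o f).
Proof.
move=> cL [s ms sf]; exists (fun n => [seq (p.1, L p.2) | p <- s n]).
  by move=> n _ /mapP[p /ms mp ->].
move=> x; rewrite (_ : (fun n => _) = L \o (fun n => simple_fun (s n) x)).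
  by apply: continuous_cvg => //; exact: cL.
apply/funext => n; rewrite /simple_fun big_map/= linear_sum.
by apply: eq_bigr => p _; rewrite linearZ.
Qed.

Lemma strongly_measurableB (E : normedModType R) (f g : X -> E) :
  strongly_measurable f -> strongly_measurable g ->
  strongly_measurable (f - g).
Proof.
move=> [s ms sf] [t mt tg].
exists (fun n => s n ++ [seq (p.1, - p.2) | p <- t n]).
  move=> n; apply: measurable_simple_cat => // _ /mapP[p pt ->].
  exact: (mt n p pt).
move=> x; rewrite (_ : (fun n => _) =
    (fun n => simple_fun (s n) x - simple_fun (t n) x)); first exact: cvgB.
apply/funext => n; rewrite simple_fun_cat; congr (_ + _).
by rewrite /simple_fun big_map -sumrN; apply: eq_bigr => p _; rewrite scalerN.
Qed.

Lemma strongly_measurable_comp d' (Y : measurableType d') (E : normedModType R)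
    (f : X -> E) (phi : Y -> X) : measurable_fun setT phi ->
  strongly_measurable f -> strongly_measurable (f \o phi).
Proof.
move=> mphi [s ms sf].
exists (fun n => [seq (phi @^-1` p.1, p.2) | p <- s n]).
  move=> n _ /mapP[p /ms mp ->] /=; rewrite -[X in measurable X]setTI.
  exact: mphi.
move=> x; rewrite (_ : (fun n => _) = (fun n => simple_fun (s n) (phi x))).
  exact: sf.
by apply/funext => n; rewrite /simple_fun big_map.
Qed.

(** Each simple function is cut down to the set where its norm is at most [|f| + 1]. Every point
    lies in these sets from some rank on, so the limit is unchanged, and the sequence is now
    dominated. *)
Lemma strongly_measurable_approx (E : normedModType R) (f : X -> E) :
  strongly_measurable f -> exists s : nat -> simples X E,
    [/\ forall n, measurable_simple (s n),
        forall x, simple_fun (s n) x @[n --> \oo] --> f x &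
        forall n x, `|simple_fun (s n) x| <= `|f x| + 1].
Proof.
move=> mf; have [s ms sf] := mf.
pose A n := [set x | `|simple_fun (s n) x| <= `|f x| + 1].
have mA n : measurable (A n).
  rewrite -[X in measurable X]setTI; apply: measurable_fun_le => //.
    exact: (measurable_fun_simple2 (fun e _ => `|e|) (ms n) (ms n)).
  by apply: measurable_funD => //; exact: measurable_fun_strong_norm.
exists (fun n => simple_restrict (A n) (s n)); split.
- by move=> n; exact: measurable_simple_restrict.
- move=> x; apply: cvg_trans (sf x); apply: near_eq_cvg.
  have : \forall n \near \oo, `|simple_fun (s n) x| <= `|f x| + 1.
    have /cvg_norm := sf x; move/cvgr_le; apply; lra.
  apply: filterS => n nA; rewrite simple_fun_restrict indicE mem_set ?scale1r//.
- move=> n x; rewrite simple_fun_restrict indicE.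
  case: (boolP (x \in A n)) => [/set_mem|_]; first by rewrite scale1r.
  by rewrite scale0r normr0 addr_ge0.
Qed.

End strong_measurability.

Section real_integrals.
Context d (X : measurableType d) (R : realType) (mu : {measure set X -> \bar R}).
Implicit Types (D : set X) (f g : X -> R).

Lemma integrable_le D f g : measurable D -> measurable_fun D f ->
  (forall x, D x -> `|f x| <= g x) -> mu.-integrable D (EFin \o g) ->
  mu.-integrable D (EFin \o f).
Proof.
move=> mD mf fg ig; apply: (le_integrable mD _ _ ig).
  exact/measurable_EFinP.
by move=> x Dx; rewrite !abse_EFin lee_fin (le_trans (fg x Dx))// ler_norm.
Qed.

Lemma ge0_integrable D f : measurable D -> measurable_fun D f ->
  (forall x, D x -> 0 <= f x) -> (\int[mu]_(x in D) (f x)%:E < +oo)%E ->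
  mu.-integrable D (EFin \o f).
Proof.
move=> mD mf f0 fy; apply/integrableP; split; first exact/measurable_EFinP.
rewrite (eq_integral (fun x => (f x)%:E))// => x /set_mem Dx.
by rewrite /= ger0_norm ?f0.
Qed.

Lemma ge0_integral_realZl D f k : measurable D -> measurable_fun D f -> 0 <= k ->
  (forall x, D x -> 0 <= f x) ->
  (\int[mu]_(x in D) (k * f x)%:E = k%:E * \int[mu]_(x in D) (f x)%:E)%E.
Proof.
move=> mD mf k0 f0; under eq_integral do rewrite EFinM.
by apply: ge0_integralZl => //; exact/measurable_EFinP.
Qed.

Lemma integrable_realZl D f k : measurable D -> mu.-integrable D (EFin \o f) ->
  mu.-integrable D (EFin \o (fun x => k * f x)).
Proof. by move=> mD /(integrableZl mD k). Qed.

Lemma integrable_realZr D f k : measurable D -> mu.-integrable D (EFin \o f) ->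
  mu.-integrable D (EFin \o (fun x => f x * k)).
Proof. by move=> mD /(integrableZr mD k). Qed.

Lemma integrable_realD D f g : measurable D -> mu.-integrable D (EFin \o f) ->
  mu.-integrable D (EFin \o g) -> mu.-integrable D (EFin \o (fun x => f x + g x)).
Proof. by move=> mD If Ig; have := integrableD mD If Ig. Qed.

Lemma integrable_realB D f g : measurable D -> mu.-integrable D (EFin \o f) ->
  mu.-integrable D (EFin \o g) -> mu.-integrable D (EFin \o (fun x => f x - g x)).
Proof. by move=> mD If Ig; have := integrableB mD If Ig. Qed.

Lemma EFin_Rintegral D f : measurable D -> mu.-integrable D (EFin \o f) ->
  (\int[mu]_(x in D) f x)%:E = (\int[mu]_(x in D) (f x)%:E)%E.
Proof. by move=> mD itf; rewrite /Rintegral fineK// integrable_fin_num. Qed.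

Lemma ae_eq_Rintegral D f g : (\forall x \ae mu, D x -> f x = g x) ->
  \int[mu]_(x in D) f x = \int[mu]_(x in D) g x.
Proof.
move=> fg; congr fine; apply: ae_eq_integral_nomeas.
by move: fg; apply: filterS => x + Dx => ->.
Qed.

Lemma Rintegral_sum D (I : eqType) (s : seq I) (F : I -> X -> R) :
  measurable D -> (forall i, i \in s -> mu.-integrable D (EFin \o F i)) ->
  mu.-integrable D (EFin \o (fun x => \sum_(i <- s) F i x)) /\
  \int[mu]_(x in D) (\sum_(i <- s) F i x) = \sum_(i <- s) \int[mu]_(x in D) F i x.
Proof.
move=> mD; elim: s => [|i s ih] Fi.
  split; first by under [EFin \o _]eq_fun do rewrite /= big_nil; exact: integrable0.
  rewrite big_nil -[RHS](mul0r (fine (mu D))) -Rintegral_cst//.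
  by apply: eq_Rintegral => x _; rewrite big_nil.
have /ih[is_ es] : forall j, j \in s -> mu.-integrable D (EFin \o F j).
  by move=> j js; apply: Fi; rewrite inE js orbT.
have ii : mu.-integrable D (EFin \o F i) by apply: Fi; rewrite inE eqxx.
split.
  under [EFin \o _]eq_fun do rewrite /= big_cons EFinD.
  exact: integrableD.
rewrite big_cons -es -RintegralD//.
by apply: eq_Rintegral => x _; rewrite big_cons.
Qed.

End real_integrals.

Lemma integrable_bounded d (X : measurableType d) (R : realType)
    (mu : {measure set X -> \bar R}) (D : set X) (f : X -> R) (M : R) :
  measurable D -> (mu D < +oo)%E -> measurable_fun D f ->
  (forall x, D x -> `|f x| <= M) -> mu.-integrable D (EFin \o f).
Proof.
move=> mD muD mf fM; apply: measurable_bounded_integrable => //.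
exists M; split=> [|K MK x Dx]; first exact: num_real.
exact: le_trans (fM x Dx) (ltW MK).
Qed.

Lemma dualB (R : realType) (V : normedModType R) (l : dual V) (v w : V) :
  l (v - w) = l v - l w.
Proof.
pose L : {linear V -> R} :=
  HB.pack (dual_fun l) (GRing.isLinear.Build _ _ _ _ _ (@dual_scalar _ _ l)).
exact: (linearB L).
Qed.

Lemma dualZ (R : realType) (V : normedModType R) (l : dual V) (k : R) (v : V) :
  l (k *: v) = k * l v.
Proof.
pose L : {linear V -> R} :=
  HB.pack (dual_fun l) (GRing.isLinear.Build _ _ _ _ _ (@dual_scalar _ _ l)).
exact: (linearZ_LR L).
Qed.

Section bochner_dual.
Context d (X : measurableType d) (R : realType) (mu : {measure set X -> \bar R}).
Context (V : normedModType R) (D : set X).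
Hypothesis mD : measurable D.
Hypothesis muD : (mu D < +oo)%E.
Implicit Types (F G : X -> dual V) (s : simples X (dual V)).

Lemma simple_strongly_measurable (E : normedModType R) (s : simples X E) :
  measurable_simple s -> strongly_measurable (simple_fun s).
Proof. by move=> ms; exists (fun=> s) => // x; exact: cvg_cst. Qed.

Lemma dual_eval_seq_continuous2 :
  seq_continuous2 (fun (l : dual V) (v : V) => l v).
Proof.
apply: (bilinear_seq_continuous2 (M := 1)) => [//|l v v'|l v].
  exact: dualB.
by rewrite mul1r; exact: dual_le_norm.
Qed.

Lemma measurable_dual_eval G v : strongly_measurable G ->
  measurable_fun setT (fun x => G x v).
Proof.
move=> mG; apply: (measurable_fun_strong2 dual_eval_seq_continuous2 mG).
exists (fun=> [:: (setT, v)]).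
  by move=> n p; rewrite inE => /eqP ->; exact: measurableT.
move=> x; rewrite /simple_fun big_seq1 indicT scale1r; exact: cvg_cst.
Qed.

Lemma simple_integral_dualE s v : measurable_simple s ->
  mu.-integrable D (fun x => (simple_fun s x v)%:E) /\
  simple_integral mu D s v = \int[mu]_(x in D) (simple_fun s x v).
Proof.
have evalE (I : Type) (r : seq I) (l : I -> dual V) :
    (\sum_(i <- r) l i : dual V) v = \sum_(i <- r) l i v.
  by elim/big_rec2: _ => // i y1 y2 _ <-.
move=> ms; have ip p : p \in s -> mu.-integrable D
    (EFin \o (fun x => (\1_(p.1) x : R) * p.2 v)).
  move=> ps; apply: (integrable_bounded (M := `|p.2 v|)) => //.
    by apply: measurable_funM => //; apply: measurable_indic; exact: ms.
  by move=> x _; rewrite normrM ler_piMl// indicE ger0_norm// lern1 leq_b1.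
have [is_ es] := Rintegral_sum mD ip.
have sE x : simple_fun s x v = \sum_(p <- s) (\1_(p.1) x : R) * p.2 v.
  exact: evalE.
split; first by under eq_fun do rewrite sE.
under eq_Rintegral do rewrite sE.
rewrite es /simple_integral evalE !big_seq; apply: eq_bigr => p ps.
have iind : mu.-integrable D (EFin \o (\1_(p.1) : X -> R)).
  apply: (integrable_bounded (M := 1)) => //.
    by apply: measurable_indic; exact: ms.
  by move=> x _; rewrite indicE ger0_norm// lern1 leq_b1.
rewrite RintegralZr// /Rintegral integral_indic//; exact: ms.
Qed.

Lemma integrable_dual_eval G v : strongly_measurable G ->
  (\int[mu]_(x in D) `|G x|%:E < +oo)%E ->
  mu.-integrable D (EFin \o (fun x => G x v)).
Proof.
move=> mG iG.
have iNG : mu.-integrable D (EFin \o (fun x => `|G x| * `|v|)).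
  apply: integrable_realZr => //; apply: ge0_integrable => //.
  by apply: measurable_funTS; exact: measurable_fun_strong_norm.
apply: (integrable_le mD _ _ iNG).
  by apply: measurable_funTS; exact: measurable_dual_eval.
by move=> x _; exact: dual_le_norm.
Qed.

Lemma simple_integral_dual_dist G s v : strongly_measurable G ->
  (\int[mu]_(x in D) `|G x|%:E < +oo)%E -> measurable_simple s ->
  (`|simple_integral mu D s v - \int[mu]_(x in D) G x v|%:E <=
    (\int[mu]_(x in D) `|G x - simple_fun s x|%:E) * `|v|%:E)%E.
Proof.
move=> mG iG ms; have [i1 ->] := simple_integral_dualE v ms.
have i2 := integrable_dual_eval v mG iG.
have i12 : mu.-integrable D (EFin \o (fun x => simple_fun s x v - G x v)).
  exact: integrable_realB.
rewrite -RintegralB//.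
have mGs : measurable_fun setT (fun x => `|G x - simple_fun s x|).
  apply: measurable_fun_strong_norm; apply: strongly_measurableB => //.
  exact: simple_strongly_measurable.
apply: (@le_trans _ _ (\int[mu]_(x in D) `|simple_fun s x v - G x v|%:E)%E).
  by rewrite EFin_normr_Rintegral// le_abse_integral//; case/integrableP: i12.
rewrite -ge0_integralZr//; last first.
  exact/measurable_EFinP/measurable_funTS.
apply: ge0_le_integral => //.
- apply/measurable_EFinP; apply: measurableT_comp => //.
  by apply/measurable_EFinP; case/integrableP: i12.
- apply/measurable_EFinP/measurable_funTS.
  by apply: measurable_funM.
- move=> x _; rewrite -EFinM lee_fin distrC.
  exact: (dual_le_norm (G x - simple_fun s x) v).
Qed.

Lemma simple_L1_cvg (E : normedModType R) (G : X -> E) :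
  strongly_measurable G -> (\int[mu]_(x in D) `|G x|%:E < +oo)%E ->
  exists s : nat -> simples X E, [/\ forall n, measurable_simple (s n),
    forall x, simple_fun (s n) x @[n --> \oo] --> G x &
    (\int[mu]_(x in D) `|G x - simple_fun (s n) x|%:E)%E @[n --> \oo] --> 0%E].
Proof.
move=> mG iG; have [s [ms sG sle]] := strongly_measurable_approx mG.
exists s; split => //.
have mGn : measurable_fun D (fun x => `|G x|).
  by apply: measurable_funTS; exact: measurable_fun_strong_norm.
have idom : mu.-integrable D (EFin \o (fun x => `|G x| + (`|G x| + 1))).
  have iGn : mu.-integrable D (EFin \o (fun x => `|G x|)).
    exact: ge0_integrable.
  apply: integrable_realD => //; apply: integrable_realD => //.
  by apply: (integrable_bounded (M := 1)) => // x _; rewrite normr1.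
have mGs n : measurable_fun setT (fun x => `|G x - simple_fun (s n) x|).
  apply: measurable_fun_strong_norm; apply: strongly_measurableB => //.
  exact: simple_strongly_measurable.
have mGsD n : measurable_fun D (fun x => `|G x - simple_fun (s n) x|%:E).
  exact/measurable_EFinP/measurable_funTS.
have m0 : measurable_fun D (cst 0%E : X -> \bar R) by exact: measurable_cst.
have Gs0 : \forall x \ae mu, D x ->
    `|G x - simple_fun (s n) x|%:E @[n --> \oo] --> (0 : \bar R).
  apply: aeW => x _; apply: cvg_EFin; first by near=> n.
  rewrite -(normr0 E) -(subrr (G x)); apply: cvg_norm; apply: cvgB => //.
  exact: cvg_cst.
have Gsdom : \forall x \ae mu, forall n, D x ->
    (`| (`|G x - simple_fun (s n) x|%:E) | <=
      (`|G x| + (`|G x| + 1))%R%:E)%E.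
  apply: aeW => x n _; rewrite /= normr_id lee_fin.
  by rewrite (le_trans (ler_normB _ _))// lerD2l.
have [_ _] := dominated_convergence mD mGsD m0 Gs0 idom Gsdom.
by rewrite integral0.
Unshelve. all: by end_near. Qed.

(** The gateway from Bochner integrals to real ones. Since [bochner] is a choice by [xget], two
    facts are needed: some integral exists, and every integral takes the stated value at [v]. *)
Lemma bochner_dualE F v : ae_strongly_measurable mu D F ->
  (\int[mu]_(x in D) `|F x|%:E < +oo)%E ->
  bochner mu D F v = \int[mu]_(x in D) F x v.
Proof.
move=> [G mG FG] iF.
have iG : (\int[mu]_(x in D) `|G x|%:E < +oo)%E.
  rewrite (ae_eq_integral_nomeas (g := fun x => `|F x|%:E))//.
  by move: FG; apply: filterS => x + Dx => ->.
have iFGE (s : simples X (dual V)) :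
    (\int[mu]_(x in D) `|F x - simple_fun s x|%:E =
     \int[mu]_(x in D) `|G x - simple_fun s x|%:E)%E.
  apply: ae_eq_integral_nomeas.
  by move: FG; apply: filterS => x + Dx => ->.
have iFGv w : \int[mu]_(x in D) F x w = \int[mu]_(x in D) G x w.
  apply: ae_eq_Rintegral.
  by move: FG; apply: filterS => x + Dx => ->.
(* The integral is assembled from its values: [w |-> \int G x w] is linear and bounded by the
   integral [C] of [|G|]. *)
have exI : exists I, is_bochner_integral mu D F I.
  have [s [ms sG sG1]] := simple_L1_cvg mG iG.
  pose C := fine (\int[mu]_(x in D) `|G x|%:E).
  have linG : scalar (fun w => \int[mu]_(x in D) G x w).
    move=> k w w'; have lGx x := @dual_scalar _ _ (G x).
    under eq_Rintegral do rewrite lGx.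
    rewrite RintegralD//; last 2 first.
    - apply: integrable_realZl => //; exact: integrable_dual_eval.
    - exact: integrable_dual_eval.
    by rewrite RintegralZl//; exact: integrable_dual_eval.
  have bndG w : `|\int[mu]_(x in D) G x w| <= C * `|w|.
    have nG : mu.-integrable D (EFin \o (fun x => `|G x|)).
      apply: ge0_integrable => //.
      by apply: measurable_funTS; exact: measurable_fun_strong_norm.
    rewrite (le_trans (le_normr_Rintegral mD (integrable_dual_eval w mG iG)))//.
    rewrite -[C]/(\int[mu]_(x in D) `|G x|) -RintegralZr//.
    apply: le_Rintegral => //.
    - by apply: integrable_norm => //; exact: integrable_dual_eval.
    - exact: integrable_realZr.
    - by move=> x _; exact: dual_le_norm.
  exists (to_dual (fun w => \int[mu]_(x in D) G x w)), s; split.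
  - move=> n p ps; split; first exact: (ms n).
    by rewrite (le_lt_trans _ muD)// le_measure// inE//; apply: measurableI => //;
      exact: (ms n).
  - by move: FG; apply: filterS => x FG Dx; rewrite FG.
  - by under eq_fun do rewrite iFGE.
  - apply/subr_cvg0/norm_cvg0P.
    apply: (squeeze_cvgr (f := fun=> 0)
      (h := fun n => fine (\int[mu]_(x in D) `|G x - simple_fun (s n) x|%:E))).
    + have /fine_cvgP[fin _] := sG1; move: fin; apply: filterS => n fin.
      rewrite normr_ge0/=; apply: dual_norm_le => w w1.
      have -> : (simple_integral mu D (s n) - to_dual (fun w0 => \int[mu]_(x in D) G x w0)) w =
        simple_integral mu D (s n) w - \int[mu]_(x in D) G x w.
        have <- // : to_dual (fun w0 => \int[mu]_(x in D) G x w0) w =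
          \int[mu]_(x in D) G x w.
        by rewrite (to_dual_boundedE linG bndG).
      rewrite -lee_fin fineK//.
      rewrite (le_trans (simple_integral_dual_dist w mG iG (ms n)))//.
      rewrite -[leRHS]mule1; apply: lee_wpmul2l; last by rewrite lee_fin.
      by apply: integral_ge0 => x _; rewrite lee_fin.
    + exact: cvg_cst.
    + by have /fine_cvgP[_] := sG1.
have [s [ms _ sF sI]] := xgetPex 0 exI.
rewrite -/(bochner mu D F) in sI.
rewrite iFGv; apply/eqP; rewrite -subr_eq0; apply/eqP.
have ms' n : measurable_simple (s n) by move=> p /(ms n)[].
(* [e n] tends to the difference of the two sides because evaluation at [v] is continuous, and to 0
   by the [L1] estimate. *)
pose e n := simple_integral mu D (s n) v - \int[mu]_(x in D) G x v.
have e1 : e n @[n --> \oo] --> bochner mu D F v - \int[mu]_(x in D) G x v.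
  apply: cvgB; last exact: cvg_cst.
  apply: (dual_eval_seq_continuous2 sI); exact: cvg_cst.
have e2 : e n @[n --> \oo] --> 0.
  apply/norm_cvg0P.
  move: sF; under eq_fun do rewrite iFGE; move=> sF.
  apply: (squeeze_cvgr (f := fun=> 0)
    (h := fun n => fine (\int[mu]_(x in D) `|G x - simple_fun (s n) x|%:E) * `|v|)).
  - have /fine_cvgP[fin _] := sF; move: fin; apply: filterS => n fin.
    rewrite normr_ge0/= -lee_fin EFinM fineK//.
    exact: simple_integral_dual_dist.
  - exact: cvg_cst.
  - rewrite -(mul0r `|v|); apply: cvgMl.
    by have /fine_cvgP[_] := sF.
by rewrite -(cvg_lim (@Rhausdorff R) e1) (cvg_lim (@Rhausdorff R) e2).
Qed.

End bochner_dual.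

(** * Weak derivatives *)

Section smooth_functions.
Context {R : realType}.
Implicit Types (x a b : R) (n : nat) (f g : R -> R).

(** The classical smooth function flat at 0, times powers of [x^-1]: the derivatives of [flat 0] are
    combinations of these. *)
Definition flat n x : R := if 0 < x then x^-1 ^+ n * expR (- x^-1) else 0.

Lemma flat_ge0 n x : 0 <= flat n x.
Proof.
rewrite /flat; case: ifPn => // x0.
by rewrite mulr_ge0 ?expR_ge0// exprn_ge0// invr_ge0 ltW.
Qed.

Lemma flat0_gt0 x : (0 < flat 0 x) = (0 < x).
Proof.
by rewrite /flat; case: ifPn => [x0|_]; rewrite ?ltxx// expr0 mul1r expR_gt0.
Qed.

(** The exponential series at [y = x^-1] gives [y^(n+1) / (n+1)! <= exp y]; one power of [x] more
    than [flat n] consumes is left over. *)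
Lemma flat_le n x : flat n x <= n.+1`!%:R * `|x|.
Proof.
rewrite /flat; case: ifPn => [x0|_]; last by rewrite mulr_ge0.
rewrite gtr0_norm// -ler_pdivrMr// mulrAC -exprSr expRN.
rewrite ler_pdivrMr ?expR_gt0// mulrC -ler_pdivrMr ?ltr0n ?fact_gt0//.
have xV : 0 <= x^-1 by rewrite invr_ge0 ltW.
by have := @expR_ge1Dxn R x^-1 n xV; apply: le_trans; rewrite lerDr.
Qed.

Lemma is_derive_flat n x :
  is_derive x 1 (flat n) (flat n.+2 x - n%:R * flat n.+1 x).
Proof.
have [x0|x0|->] := ltgtP x 0.
- rewrite /flat !ifF ?ltNge ?(ltW x0)// mulr0 subr0.
  apply: (near_eq_is_derive (f := cst 0)).
    near=> y; rewrite ifF//; apply/negbTE; rewrite -leNgt ltW//.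
    near: y; exact: lt_nbhsl.
- rewrite /flat !x0.
  apply: (@near_eq_is_derive _ _ _ (fun y : R => y^-1 ^+ n * expR (- y^-1))).
    near=> y; rewrite ifT//; near: y; exact: lt_nbhsr.
  have xn0 : x != 0 by rewrite gt_eqF.
  have dV : is_derive x 1 (fun y : R => y^-1) (- x ^- 2 *: 1).
    exact: is_deriveV.
  have dE : is_derive x 1 (expR \o (fun y : R => - y^-1))
      (expR (- x^-1) * (- (- x ^- 2 *: 1))).
    by apply: is_derive1_comp.
  have dX : is_derive x 1 ((fun y : R => y^-1) ^+ n)
      ((n%:R * x^-1 ^+ n.-1) *: (- x ^- 2 *: 1)).
    exact: is_deriveX.
  have -> : (fun y : R => y^-1 ^+ n * expR (- y^-1)) =
      (fun y : R => y^-1) ^+ n * (expR \o (fun y : R => - y^-1)).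
    by apply/funext => y; rewrite [in RHS]exprfctE.
  apply: (is_derive_eq (is_deriveM dX dE)); rewrite exprfctE.
  rewrite /GRing.scale/= !mulr1 !exprVn.
  rewrite -!exprVn; move: (x^-1) (expR _) => y e.
  by case: n {dX} => [|n]; rewrite /= ?exprS; ring.
- have flat0 m : flat m 0 = 0 by rewrite /flat ltxx.
  rewrite !flat0 mulr0 subr0.
  (* For [h > 0] the difference quotient is [flat n.+1 h], which [flat_le] bounds by a multiple of
     [|h|]. *)
  have cv : h^-1 *: ((flat n \o shift 0) (h *: 1) - flat n 0) @[h --> 0^'] --> 0.
    apply/norm_cvg0P.
    apply: (squeeze_cvgr (f := fun=> 0) (h := fun h => n.+2`!%:R * `|h|)).
    + near=> h; rewrite normr_ge0/= flat0 subr0 addr0 /GRing.scale/= mulr1.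
      apply: le_trans (flat_le n.+1 h).
      rewrite /flat; case: ifPn => h0; last by rewrite mulr0 normr0.
      by rewrite ger0_norm ?mulrA ?exprS// mulr_ge0 ?expR_ge0// -exprS exprn_ge0//
        invr_ge0 ltW.
    + exact: cvg_cst.
    + have : n.+2`!%:R * `|h : R| @[h --> (0 : R)^'] --> n.+2`!%:R * `|0 : R|.
        by apply: cvgMr; apply: cvg_norm; exact: cvg_within.
      by rewrite normr0 mulr0.
  by apply: DeriveDef; [apply/cvg_ex; exists 0|exact: (cvg_lim (@Rhausdorff R) cv)].
Unshelve. all: by end_near. Qed.

Lemma is_derive_ext f g x df dg : is_derive x 1 f df -> f =1 g -> df = dg ->
  is_derive x 1 g dg.
Proof. by move=> fdf /funext <- <-. Qed.

(* A class closed under derivation, so that no formula for iterated derivatives is needed. *)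
Inductive smooth : (R -> R) -> Prop :=
| smooth_flat n a b : smooth (fun x => flat n (a * x + b))
| smooth_cst a : smooth (fun=> a)
| smoothD f g : smooth f -> smooth g -> smooth (fun x => f x + g x)
| smoothM f g : smooth f -> smooth g -> smooth (fun x => f x * g x)
| smoothV f : smooth f -> (forall x, f x != 0) -> smooth (fun x => (f x)^-1).

Lemma smooth_derive f : smooth f ->
  exists2 f', smooth f' & forall x, is_derive x 1 f (f' x).
Proof.
elim=> {f} [n a b|a|f g _ [f' sf' df] _ [g' sg' dg]|
  f g sf [f' sf' df] sg [g' sg' dg]|f sf [f' sf' df] f0].
- exists (fun x => (flat n.+2 (a * x + b) + - n%:R * flat n.+1 (a * x + b)) * a).
    apply: smoothM; last exact: smooth_cst.
    apply: smoothD; first exact: smooth_flat.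
    by apply: smoothM; [exact: smooth_cst|exact: smooth_flat].
  move=> x; rewrite mulNr.
  have dl : is_derive x 1 (fun y : R => a * y + b) a.
    have := is_deriveD (is_deriveZ a (is_derive_id x (1 : R))) (is_derive_cst b x 1).
    by move/is_derive_ext; apply => //; rewrite addr0 /GRing.scale/= mulr1.
  exact: is_derive1_comp (is_derive_flat n _) dl.
- by exists (fun=> 0); [exact: smooth_cst|move=> x; exact: is_derive_cst].
- exists (fun x => f' x + g' x); first exact: smoothD.
  by move=> x; exact: is_deriveD.
- exists (fun x => f x * g' x + g x * f' x).
    by apply: smoothD; exact: smoothM.
  by move=> x; exact: is_deriveM.
- exists (fun x => (-1 * ((f x)^-1 * (f x)^-1)) * f' x).
    apply: smoothM => //; apply: smoothM; first exact: smooth_cst.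
    by apply: smoothM; exact: smoothV.
  move=> x; have := is_deriveV (f0 x) (df x); move/is_derive_ext; apply => //.
  by rewrite mulN1r -expr2 exprVn.
Qed.

Lemma smooth_derive1n f n : smooth f -> smooth (derive1n n f).
Proof.
move=> sf; elim: n => [//|n /smooth_derive[g sg dg]].
rewrite derive1nS (_ : derive1 _ = g)//.
by apply/funext => x; rewrite derive1E derive_val.
Qed.

Lemma smooth_derivable f n x : smooth f -> derivable (derive1n n f) x 1.
Proof. by move=> /(smooth_derive1n n)/smooth_derive[g _ dg]; exact: ex_derive. Qed.

(* A smooth step climbing from 0 to 1 on [a, a + b]. *)
Definition smooth_step a b x : R :=
  flat 0 (x - a) / (flat 0 (x - a) + flat 0 (a + b - x)).

Section smooth_step.
Context (a b : R).
Hypothesis b0 : 0 < b.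
Let den x := flat 0 (x - a) + flat 0 (a + b - x).

Let den_gt0 x : 0 < den x.
Proof.
have [xa|xa] := ltP a x.
  by rewrite /den ltr_wpDr ?flat_ge0// flat0_gt0 subr_gt0.
by rewrite /den ltr_wpDl ?flat_ge0// flat0_gt0 subr_gt0 (le_lt_trans xa)// ltrDl.
Qed.

Lemma smooth_smooth_step : smooth (smooth_step a b).
Proof.
have e1 : (fun x => flat 0 (x - a)) = (fun x => flat 0 (1 * x + - a)).
  by apply/funext => x; rewrite mul1r.
have e2 : (fun x => flat 0 (a + b - x)) = (fun x => flat 0 (- 1 * x + (a + b))).
  by apply/funext => x; rewrite mulN1r addrC.
have s1 : smooth (fun x => flat 0 (x - a)) by rewrite e1; exact: smooth_flat.
have s2 : smooth (fun x => flat 0 (a + b - x)) by rewrite e2; exact: smooth_flat.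
apply: (smoothM s1); apply: smoothV; first exact: (smoothD s1 s2).
by move=> x; rewrite gt_eqF// den_gt0.
Qed.

Lemma smooth_step_ge0 x : 0 <= smooth_step a b x.
Proof. by rewrite divr_ge0 ?flat_ge0// ltW// den_gt0. Qed.

Lemma smooth_step_le1 x : smooth_step a b x <= 1.
Proof. by rewrite ler_pdivrMr ?den_gt0// mul1r lerDl flat_ge0. Qed.

Lemma smooth_step_eq0 x : x <= a -> smooth_step a b x = 0.
Proof. by move=> xa; rewrite /smooth_step {1}/flat subr_gt0 ltNge xa mul0r. Qed.

Lemma smooth_step_eq1 x : a + b <= x -> smooth_step a b x = 1.
Proof.
move=> abx; have f0 : flat 0 (a + b - x) = 0 by rewrite /flat subr_gt0 ltNge abx.
have := den_gt0 x; rewrite /den f0 addr0 => /gt_eqF/negbT d0.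
by rewrite /smooth_step f0 addr0 divff.
Qed.

(** The step is [u / (u + v)] with [u] nondecreasing and [v] nonincreasing, so the numerator
    [u' v - u v'] of its derivative is nonnegative. The sign is what makes these derivatives an
    approximate identity below. *)
Lemma smooth_step_derive : exists2 s', smooth s' &
  (forall x, is_derive x 1 (smooth_step a b) (s' x)) /\ (forall x, 0 <= s' x).
Proof.
have [s' ss' ds'] := smooth_derive smooth_smooth_step.
exists s' => //; split => // x.
have d1 : is_derive x 1 (fun y => flat 0 (y - a)) (flat 2 (x - a)).
  have dl : is_derive x 1 (fun y : R => y - a) 1.
    have := is_deriveB (is_derive_id x (1 : R)) (is_derive_cst a x 1).
    by move/is_derive_ext; apply => //; rewrite subr0.
  have := is_derive1_comp (g := fun y => y - a) (is_derive_flat 0 (x - a)) dl.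
  by move/is_derive_ext; apply => //; rewrite mul0r subr0 mulr1.
have d2 : is_derive x 1 (fun y => flat 0 (a + b - y)) (- flat 2 (a + b - x)).
  have dl : is_derive x 1 (fun y : R => a + b - y) (-1).
    have := is_deriveB (is_derive_cst (a + b) x 1) (is_derive_id x (1 : R)).
    by move/is_derive_ext; apply => //; rewrite sub0r.
  have := is_derive1_comp (g := fun y => a + b - y)
    (is_derive_flat 0 (a + b - x)) dl.
  by move/is_derive_ext; apply => //; rewrite mul0r subr0 mulrN1.
have dn0 : den x != 0 by rewrite gt_eqF// den_gt0.
have d3 := is_deriveM d1 (is_deriveV (f := den) dn0 (is_deriveD d1 d2)).
have -> : s' x = (flat 2 (x - a) * flat 0 (a + b - x) +
    flat 0 (x - a) * flat 2 (a + b - x)) / (den x) ^+ 2.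
  have <- := @derive_val _ _ _ _ _ _ _ (ds' x).
  rewrite (@derive_val _ _ _ _ _ _ _ d3) /GRing.scale/= /den.
  move: dn0; rewrite /den; move: (flat 0 _) (flat 0 _) => u v dn0.
  by field.
by rewrite divr_ge0 ?exprn_ge0 ?(ltW (den_gt0 x))// addr_ge0// mulr_ge0// flat_ge0.
Qed.

End smooth_step.
End smooth_functions.

Lemma Rintegral_dominated_cvg d (X : measurableType d) (R : realType)
    (mu : {measure set X -> \bar R}) (D : set X) (f_ : nat -> X -> R)
    (f g : X -> R) : measurable D ->
  (forall n, measurable_fun D (f_ n)) -> measurable_fun D f ->
  (\forall x \ae mu, D x -> f_ n x @[n --> \oo] --> f x) ->
  mu.-integrable D (EFin \o g) ->
  (forall n x, D x -> `|f_ n x| <= g x) ->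
  \int[mu]_(x in D) f_ n x @[n --> \oo] --> \int[mu]_(x in D) f x.
Proof.
move=> mD mf_ mf f_f ig f_g.
have mf_E n : measurable_fun D (fun x => (f_ n x)%:E).
  exact/measurable_EFinP.
have mfE : measurable_fun D (fun x => (f x)%:E) by exact/measurable_EFinP.
have f_fE : \forall x \ae mu, D x -> (f_ n x)%:E @[n --> \oo] --> (f x)%:E.
  move: f_f; apply: filterS => x h Dx; apply: cvg_EFin; last exact: h.
  by near=> n.
have f_gE : \forall x \ae mu, forall n, D x -> (`|(f_ n x)%:E| <= (g x)%:E)%E.
  by apply: aeW => x n Dx; rewrite lee_fin f_g.
have [_ _ h] := dominated_convergence mD mf_E mfE f_fE ig f_gE.
apply: fine_cvg; rewrite fineK; first exact: h.
apply: integrable_fin_num => //; apply/integrableP; split => //.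
have [+ _ _] := dominated_convergence mD mf_E mfE f_fE ig f_gE.
by case/integrableP.
Unshelve. all: by end_near. Qed.

(** * The fundamental theorem of calculus for weak derivatives *)

Section fundamental_lemma.
Context {R : realType}.
Local Notation leb := (@lebesgue_measure R).
Implicit Types (a b c T : R) (p q h : R -> R).

(** If [h t] were nonzero, [h] would be nonzero on the interval []l, r[] next to [t], which has
    positive length even when [t] is an endpoint. *)
Lemma within_continuous_ae_eq0 T h : 0 < T -> {within `[0, T], continuous h} ->
  (\forall t \ae leb, `]0, T[%classic t -> h t = 0) ->
  forall t, t \in `[0, T] -> h t = 0.
Proof.
move=> T0 /subspace_continuousP ch [N [mN N0 hN]] t t0T.
apply/eqP; apply: contrapT => /negP ht0.
have tT : `[0, T]%classic t by [].
have := ch t tT => /cvgr_neq0 => /(_ ht0).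
rewrite /prop_near1 /within/= => -[e /= e0 he].
move: t0T; rewrite in_itv/= => /andP[t0 tleT].
pose l := Num.max 0 (t - e); pose r := Num.min T (t + e).
have lr : l < r.
  by rewrite /l /r gt_max !lt_min; apply/andP; split; apply/andP; split; lra.
have : (leb `]l, r[%classic <= leb N)%E.
  apply: le_measure; rewrite ?inE//; apply: (subset_trans _ hN) => s /=.
  rewrite in_itv/= /l /r gt_max lt_min => /andP[/andP[s0 ts] /andP[sT st]] hs.
  have : h s = 0 by apply: hs; rewrite in_itv/= s0 sT.
  apply/eqP; apply: he; last by rewrite in_itv/= !ltW.
  by rewrite /= ltr_distlC; apply/andP; split; lra.
by rewrite N0 lebesgue_measure_itv/= lte_fin lr -EFinB lee_fin leNgt subr_gt0 lr.
Qed.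

Lemma within_continuous_integrable a b h : {within `[a, b], continuous h} ->
  leb.-integrable `]a, b[ (EFin \o h).
Proof.
move=> ch; have hI : leb.-integrable `[a, b] (EFin \o h).
  exact: continuous_compact_integrable (@segment_compact _ _ _) ch.
by apply: (integrableS _ _ _ hI) => //; exact: subset_itv_oo_cc.
Qed.

Lemma smooth_continuous f : @smooth R f -> continuous f.
Proof.
move=> /smooth_derive[g _ dg] x; apply: differentiable_continuous.
by apply/derivable1_diffP; exact: ex_derive.
Qed.

(** The derivative of the step is a nonnegative bump of integral 1 carried by [[a, a + b]]: as [b]
    decreases to 0 it concentrates at [a]. *)
Lemma smooth_step_delta T a p : 0 < a -> a < T ->
  {within `[0, T], continuous p} -> forall e, 0 < e -> \forall b \near 0^'+,
  `|\int[leb]_(t in `]0, T[) (derive1 (smooth_step a b) t * p t) - p a| <= e.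
Proof.
move=> a0 aT cp e e0.
have T0 : 0 < T by exact: lt_trans aT.
have cpa : {for a, continuous p}.
  apply: (within_continuous_continuous _ cp) => //.
  by rewrite in_itv/= a0.
have /cvgr_dist_le/(_ e e0) := cpa.
rewrite /prop_near1/= => -[eta /= eta0 Hp].
near=> b.
have b0 : 0 < b by [].
have abT : a + b < T by rewrite -ltrBrDl; near: b; apply: nbhs_right_lt; lra.
have beta : b < eta by near: b; exact: nbhs_right_lt.
have [s' ss' [ds' s'0]] := smooth_step_derive a b0.
have -> : derive1 (smooth_step a b) = s'.
  by apply/funext => x; rewrite derive1E; exact: derive_val.
have cs' := smooth_continuous ss'.
have ms' : measurable_fun `]0, T[ s'.
  by apply: measurable_funTS; exact: continuous_measurable_fun.
have s'out t : t < a \/ a + b < t -> s' t = 0.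
  move=> h; have <- := @derive_val _ _ _ _ _ _ _ (ds' t).
  have [c hc] : exists c, \near t, c = smooth_step a b t.
    case: h => h.
      exists 0; near=> u; rewrite smooth_step_eq0//.
      by apply: ltW; near: u; exact: lt_nbhsl.
    exists 1; near=> u; rewrite smooth_step_eq1//.
    by apply: ltW; near: u; exact: lt_nbhsr.
  by rewrite -(near_eq_derive _ hc) derive_cst.
have s'1 : \int[leb]_(t in `]0, T[) s' t = 1.
  rewrite /Rintegral -(integral_itv_bndoo true false); last exact/measurable_EFinP.
  rewrite (@continuous_FTC2 _ s' (smooth_step a b) 0 T)//.
  - rewrite smooth_step_eq1// ?ltW// smooth_step_eq0 ?ltW//.
    by rewrite sube0.
  - exact: continuous_subspaceT.
  - have cst : continuous (smooth_step a b).
      exact/smooth_continuous/smooth_smooth_step.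
    split; first by move=> x _; exact: ex_derive.
      exact/cvg_at_right_filter/cst.
    exact/cvg_at_left_filter/cst.
  - by move=> x _; rewrite derive1E; exact: derive_val.
have is' : leb.-integrable `]0, T[ (EFin \o s').
  apply: within_continuous_integrable.
  exact: continuous_subspaceT.
have is'p : leb.-integrable `]0, T[ (EFin \o (fun t => s' t * p t)).
  apply: within_continuous_integrable.
  move=> x; apply: cvgM; last exact: cp.
  exact: continuous_subspaceT.
have is'pa : leb.-integrable `]0, T[ (EFin \o (fun t => s' t * p a)).
  exact: integrable_realZr.
have -> : p a = \int[leb]_(t in `]0, T[) (s' t * p a).
  by rewrite RintegralZr// s'1 mul1r.
rewrite -RintegralB//.
rewrite (le_trans (le_normr_Rintegral _ (integrable_realB _ is'p is'pa)))//.
apply: (@le_trans _ _ (\int[leb]_(t in `]0, T[) (s' t * e))).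
  apply: le_Rintegral => //.
  - by apply: integrable_norm => //; exact: integrable_realB.
  - exact: integrable_realZr.
  move=> t _; rewrite -mulrBr normrM (ger0_norm (s'0 t)).
  have [h|] := boolP ((t < a) || (a + b < t)).
    by rewrite s'out ?mul0r//; exact/orP.
  rewrite negb_or -!leNgt => /andP[at_ tab].
  rewrite ler_wpM2l// distrC; apply: Hp => /=.
  rewrite ltr_distlC; apply/andP; split; lra.
by rewrite RintegralZr// s'1 mul1r.
Unshelve. all: by end_near. Qed.

End fundamental_lemma.

Section weak_derivative_ftc.
Context {R : realType}.
Local Notation leb := (@lebesgue_measure R).
Implicit Types (a b c T : R) (p q h : R -> R).

Lemma smooth_step_cvg a (b_ : nat -> R) t : (forall n, 0 < b_ n) ->
  b_ n @[n --> \oo] --> 0 ->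
  smooth_step a (b_ n) t @[n --> \oo] --> (if a < t then 1 else 0 : R).
Proof.
move=> b0 bcvg; case: ifPn => [at_|]; last first.
  rewrite -leNgt => ta; under eq_fun do rewrite smooth_step_eq0//.
  exact: cvg_cst.
apply: cvg_near_cst.
have : \forall n \near \oo, b_ n <= t - a.
  by apply: (cvgr_le 0 bcvg); rewrite subr_gt0.
by apply: filterS => n bn; rewrite smooth_step_eq1// -lerBrDl.
Qed.

(** A smooth approximation of the indicator of []a, b]], compactly supported in []0, T[]. *)
Lemma test_function_step T a b e : 0 < a -> a < b -> 0 < e -> b + e < T ->
  test_function T (fun t => smooth_step a e t - smooth_step b e t).
Proof.
move=> a0 ab e0 beT; split.
  move=> n x; apply: smooth_derivable.
  rewrite (_ : (fun t => _) =
    (fun t => smooth_step a e t + -1 * smooth_step b e t)); last first.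
    by apply/funext => t; rewrite mulN1r.
  apply: smoothD; first exact: smooth_smooth_step.
  by apply: smoothM; [exact: smooth_cst|exact: smooth_smooth_step].
exists a, (b + e); split => // x; rewrite in_itv/= negb_and -!ltNge.
move=> /orP[xa|bex].
  by rewrite !smooth_step_eq0 ?subrr// ltW// (lt_trans xa).
by rewrite !smooth_step_eq1 ?subrr// ltW// (lt_trans _ bex)// ltrD2r.
Qed.

(** Test with a difference of steps of width [d n]: its derivative tends to the point mass at [a]
    minus that at [b], while the test function itself tends to the indicator of []a, b]], dominated
    by 1. *)
Lemma weak_derivative_open T p q a b : {within `[0, T], continuous p} ->
  leb.-integrable `]0, T[ (EFin \o q) ->
  (forall phi, test_function T phi ->
    \int[leb]_(t in `]0, T[) (derive1 phi t * p t) =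
    - (\int[leb]_(t in `]0, T[) (phi t * q t))) ->
  0 < a -> a < b -> b < T ->
  p b - p a = \int[leb]_(t in `]a, b]) q t.
Proof.
move=> cp iq pq a0 ab bT.
(* Half the room to the right of [b], so that all steps of width at most [d0] end before [T]. *)
pose d0 := (T - b) / 2.
have d00 : 0 < d0 by rewrite /d0; lra.
pose d n := d0 / n.+1%:R.
have d_gt0 n : 0 < d n by rewrite divr_gt0.
have dd0 n : d n <= d0 by rewrite ler_pdivrMr// ler_peMr ?ler1n// ltW.
have dcvg : d n @[n --> \oo] --> 0.
  rewrite -[X in _ --> X](mulr0 d0); apply: cvgMr; exact: cvg_harmonic.
have pd c : 0 < c -> c < T ->
    \int[leb]_(t in `]0, T[) (derive1 (smooth_step c (d n)) t * p t)
      @[n --> \oo] --> p c.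
  move=> c0 cT.
  have /cvg_at_rightP : (fun x => \int[leb]_(t in `]0, T[)
      (derive1 (smooth_step c x) t * p t)) x @[x --> 0^'+] --> p c.
    apply/cvgrPdist_le => e e0; near=> x; rewrite distrC; near: x.
    exact: smooth_step_delta.
  by apply.
have T0 : 0 < T by lra.
have mstep c n : measurable_fun `]0, T[ (smooth_step c (d n)).
  apply: measurable_funTS; apply: continuous_measurable_fun.
  exact/smooth_continuous/smooth_smooth_step.
have mq : measurable_fun `]0, T[ q by apply/measurable_EFinP; case/integrableP: iq.
pose st n t := smooth_step a (d n) t - smooth_step b (d n) t.
have ist c n : leb.-integrable `]0, T[
    (EFin \o (fun t => derive1 (smooth_step c (d n)) t * p t)).
  apply: within_continuous_integrable => x; apply: cvgM; last exact: cp.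
  apply: continuous_subspaceT; apply: smooth_continuous.
  exact: (@smooth_derive1n _ _ 1 (smooth_smooth_step c (d_gt0 n))).
have eqn n : \int[leb]_(t in `]0, T[) (derive1 (smooth_step a (d n)) t * p t) -
    \int[leb]_(t in `]0, T[) (derive1 (smooth_step b (d n)) t * p t) =
    - (\int[leb]_(t in `]0, T[) (st n t * q t)).
  rewrite -pq; last first.
    apply: test_function_step => //; have := dd0 n; rewrite /d0; lra.
  rewrite -RintegralB//; apply: eq_Rintegral => t _; rewrite -mulrBl; congr (_ * _).
  have [sa _ [dsa _]] := smooth_step_derive a (d_gt0 n).
  have [sb _ [dsb _]] := smooth_step_derive b (d_gt0 n).
  rewrite !derive1E (@derive_val _ _ _ _ _ _ _ (dsa t))
    (@derive_val _ _ _ _ _ _ _ (dsb t)).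
  exact/esym/(@derive_val _ _ _ _ _ _ _ (is_deriveB (dsa t) (dsb t))).
have lim1 : - (\int[leb]_(t in `]0, T[) (st n t * q t)) @[n --> \oo] --> p a - p b.
  under eq_fun do rewrite -eqn.
  by apply: cvgB; apply: pd => //; lra.
have lim2 : - (\int[leb]_(t in `]0, T[) (st n t * q t)) @[n --> \oo] -->
    - (\int[leb]_(t in `]0, T[) (\1_(`]a, b]%classic) t * q t)).
  apply: cvgN; apply: (@Rintegral_dominated_cvg _ _ R leb _ (fun n t => st n t * q t) _
    (fun t => `|q t|)) => //.
  - by move=> n; apply: measurable_funM => //; apply: measurable_funB; exact: mstep.
  - by apply: measurable_funM => //; exact: measurable_indic.
  - apply: aeW => t _; apply: cvgMl.
    have -> : \1_(`]a, b]%classic) t =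
        (if a < t then 1 else 0) - (if b < t then 1 else 0) :> R.
      rewrite indicE mem_setE in_itv/=.
      case: (ltP a t) => [at_|ta] /=; first by case: (ltP b t); rewrite ?subrr ?subr0.
      by rewrite ifF ?subr0//; apply/negbTE; rewrite -leNgt; lra.
    by apply: cvgB; exact: smooth_step_cvg.
  - exact: integrable_norm.
  - move=> n t _; rewrite normrM ler_piMl//.
    have := smooth_step_ge0 a (d_gt0 n) t; have := smooth_step_le1 a (d_gt0 n) t.
    have := smooth_step_ge0 b (d_gt0 n) t; have := smooth_step_le1 b (d_gt0 n) t.
    rewrite /st ler_norml; move: (smooth_step _ _ _) (smooth_step _ _ _) => u v.
    by move=> *; apply/andP; split; lra.
have : p a - p b = - (\int[leb]_(t in `]0, T[) (\1_(`]a, b]%classic) t * q t)).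
  by rewrite -(cvg_lim (@Rhausdorff R) lim1) (cvg_lim (@Rhausdorff R) lim2).
have -> : \int[leb]_(t in `]0, T[) (\1_(`]a, b]%classic) t * q t) =
    \int[leb]_(t in `]a, b]) q t.
  have -> : `]a, b]%classic = `]0, T[%classic `&` `]a, b]%classic.
    by rewrite setIidr// => t /=; rewrite !in_itv/= => /andP[? ?]; apply/andP; split; lra.
  rewrite Rintegral_mkcondr; apply: eq_Rintegral => t t0T.
  rewrite /patch indicE in_setI t0T /=.
  by case: ifPn => _; rewrite ?mul1r ?mul0r.
lra.
Unshelve. all: by end_near. Qed.

(** The endpoints 0 and [T] are out of reach of test functions. They are attained by continuity: [p]
    minus a primitive of [q] is constant on []0, T[] by the previous lemma and continuous on
    [[0, T]]. *)
Lemma weak_derivative_closed T p q : {within `[0, T], continuous p} ->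
  leb.-integrable `]0, T[ (EFin \o q) ->
  (forall phi, test_function T phi ->
    \int[leb]_(t in `]0, T[) (derive1 phi t * p t) =
    - (\int[leb]_(t in `]0, T[) (phi t * q t))) ->
  forall a b, 0 <= a -> a <= b -> b <= T ->
  p b - p a = \int[leb]_(t in `]a, b[) q t.
Proof.
move=> cp iq pq.
have [T0|T0] := ltP 0 T; last first.
  move=> a b a0 ab bT; have -> : b = a by lra.
  by rewrite subrr set_itvoo0 Rintegral_set0.
pose q0 t := if (0 < t) && (t < T) then q t else 0.
have q0E : {in `]0, T[%classic, q =1 q0}.
  by move=> t /set_mem /=; rewrite in_itv/= /q0 => ->.
have iq0 : leb.-integrable `[0, T] (EFin \o q0).
  rewrite (_ : EFin \o q0 = (EFin \o q) \_ `]0, T[).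
    apply/integrable_restrict => //.
    rewrite setIidr//; exact: subset_itv_oo_cc.
  apply/funext => t; rewrite /q0 /patch/= mem_setE in_itv/=.
  by case: ifP.
pose F x := \int[leb]_(t in `[0, x]) q0 t.
have cF : {within `[0, T], continuous F}.
  exact: (parameterized_integral_continuous (ltW T0) iq0).
have iq0S a b (b0 b1 : bool) : 0 <= a -> b <= T ->
    leb.-integrable [set` Interval (BSide b0 a) (BSide b1 b)] (EFin \o q0).
  move=> a0 bT; apply: (integrableS _ _ _ iq0) => // t.
  rewrite /= !itv_boundlr => /andP[la rb]; apply/andP; split.
    by rewrite (le_trans _ la)// /Order.le/=; case: (b0); rewrite /= ?lteifT ?lteif_imply.
  by rewrite (le_trans rb)//; case: (b1).
have FB a b : 0 <= a -> a <= b -> b <= T -> F b - F a = \int[leb]_(t in `]a, b]) q0 t.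
  move=> a0 ab bT; apply: Rintegral_itvB; rewrite ?bnd_simp//.
  exact: (iq0S _ _ true false).
pose h t := p t - F t - (p (T / 2) - F (T / 2)).
have ch : {within `[0, T], continuous h}.
  move=> x; apply: cvgB; last exact: cvg_cst.
  by apply: cvgB; [exact: cp|exact: cF].
have hh a b : 0 < a -> a < b -> b < T -> p b - F b = p a - F a.
  move=> a0 ab bT; have := weak_derivative_open cp iq pq a0 ab bT.
  have : F b - F a = \int[leb]_(t in `]a, b]) q t.
    rewrite FB ?ltW//; apply/esym/eq_Rintegral => t /set_mem/= t_ab.
    apply: q0E; rewrite inE/=; move: t_ab; rewrite !in_itv/= => /andP[? ?].
    by apply/andP; split; lra.
  lra.
have h0 t : t \in `[0, T] -> h t = 0.
  apply: within_continuous_ae_eq0 => //; apply: aeW => s /=.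
  rewrite in_itv/= /h => /andP[s0 sT].
  have [s2|s2|<-] := ltgtP s (T / 2); last by rewrite subrr.
    by have := hh s (T / 2) s0 s2; lra.
  by have := hh (T / 2) s _ s2 sT; lra.
move=> a b a0 ab bT.
have ha : h a = 0 by apply: h0; rewrite in_itv/=; apply/andP; split; lra.
have hb : h b = 0 by apply: h0; rewrite in_itv/=; apply/andP; split; lra.
transitivity (F b - F a); first by move: ha hb; rewrite /h; lra.
rewrite FB// -Rintegral_itv_bndo_bndc; last exact: iq0S.
apply/esym/eq_Rintegral => t /set_mem/= t_ab.
apply: q0E; rewrite inE/=; move: t_ab; rewrite !in_itv/= => /andP[? ?].
by apply/andP; split; lra.
Qed.

End weak_derivative_ftc.

Section strong_measurability_operations.
Context d (X : measurableType d) (R : realType).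

Import HBSimple.

Lemma strongly_measurable_real (f : X -> R) : measurable_fun setT f ->
  strongly_measurable (f : X -> R^o).
Proof.
move=> /measurable_EFinP/(approximation_sfun measurableT)[g gf].
pose s n : simples X R^o :=
  [seq (g n @^-1` [set y], y) | y <- finmap.enum_fset (fset_set (range (g n)))].
exists s.
  move=> n _ /mapP[y _ ->] /=; rewrite -[X in measurable X]setTI.
  exact: (measurable_funP (g n)).
move=> x; rewrite (_ : (fun n => _) = (fun n => g n x)).
  by have /fine_cvgP[_] := gf x I.
apply/funext => n; rewrite fimfunE fsbig_finite//= /simple_fun big_map.
by apply: eq_bigr => y _; rewrite /= mulrC.
Qed.

Lemma strongly_measurableZ (E : normedModType R) (k : X -> R) (f : X -> E) :
  measurable_fun setT k -> strongly_measurable f ->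
  strongly_measurable (fun x => k x *: f x).
Proof.
move=> /strongly_measurable_real[s ms sk] [t mt tf].
pose st n : simples X E :=
  [seq (p.1 `&` q.1, p.2 *: q.2) | p <- s n, q <- t n].
exists st.
  move=> n _ /allpairsP[[p q] /= [ps qt ->]] /=; apply: measurableI.
    exact: (ms n p ps).
  exact: (mt n q qt).
move=> x; rewrite (_ : (fun n => _) =
    (fun n => (simple_fun (s n) x : R) *: simple_fun (t n) x)).
  exact: cvgZ.
apply/funext => n; rewrite /simple_fun big_allpairs_dep scaler_suml.
apply: eq_bigr => p _; rewrite scaler_sumr; apply: eq_bigr => q _.
by rewrite /= indicI !scalerA; congr (_ *: _); rewrite mulrAC.
Qed.

Lemma strongly_measurable_linear (E F : normedModType R) (L : E -> F) M
    (f : X -> E) : linear L -> (forall e, `|L e| <= M * `|e|) ->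
  strongly_measurable f -> strongly_measurable (L \o f).
Proof.
move=> lL LM.
pose g : {linear E -> F} := HB.pack L (GRing.isLinear.Build _ _ _ _ _ lL).
apply: (strongly_measurable_map (L := g)).
apply: bounded_linear_continuous; apply/linear_boundedP.
by near=> r => x; rewrite (le_trans (LM x))// ler_wpM2r.
Unshelve. all: by end_near. Qed.

Lemma strongly_measurable_cst (E : normedModType R) (e : E) :
  strongly_measurable (fun _ : X => e).
Proof.
exists (fun=> [:: (setT, e)]).
  by move=> n p; rewrite inE => /eqP ->; exact: measurableT.
move=> x; rewrite /simple_fun big_seq1 indicT scale1r; exact: cvg_cst.
Qed.

End strong_measurability_operations.

Section gelfand_theory.
Context {R : realType} {V H : hilbertType R} (iota : {linear V -> H}).
Hypothesis ciota : continuous iota.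

Lemma innerBl (U : hilbertType R) (x y z : U) : inner (x - y) z = inner x z - inner y z.
Proof. by rewrite -scaleN1r innerDl innerZl mulN1r. Qed.

Lemma innerBr (U : hilbertType R) (x y z : U) : inner x (y - z) = inner x y - inner x z.
Proof. by rewrite innerC innerBl !(innerC _ x). Qed.

Lemma iota_bounded : exists2 M, 0 < M & forall v, `|iota v| <= M * `|v|.
Proof.
have /linear_boundedP/pinfty_ex_gt0[M M0 Mi] :=
  proj2 (linear_bounded_continuous iota) ciota.
by exists M.
Qed.

Lemma gelfand_linear : linear (gelfand iota).
Proof.
move=> k x y; apply: dual_ext => z; rewrite !gelfandE// linearP innerDl innerZl.
by rewrite -!(gelfandE _ z).
Qed.

Lemma gelfand_bounded : exists M, forall v, `|gelfand iota v| <= M * `|v|.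
Proof.
have [M M0 Mi] := iota_bounded; exists (M * M) => v.
apply: dual_norm_le => w w1; rewrite gelfandE//.
rewrite (le_trans (cauchy_schwarz _ _))// mulrAC ler_pM//.
by rewrite (le_trans (Mi w))// ler_piMr// ltW.
Qed.

End gelfand_theory.

Section form_op_theory.
Context {R : realType} {V : hilbertType R} (a : {biscalar V}) (L : R).
Hypothesis aL : forall w v, `|a w v| <= L * `|w| * `|v|.

Lemma form_op_linear : linear (form_op a).
Proof.
move=> k x y; apply: dual_ext => z; rewrite (form_opE _ _ aL) linearPl.
by rewrite -!(form_opE _ z aL).
Qed.

Lemma form_op_bounded v : 0 <= L -> `|form_op a v| <= L * `|v|.
Proof.
move=> L0; apply: dual_norm_le => w w1.
by rewrite (form_opE _ _ aL) (le_trans (aL v w))// ler_piMr// mulr_ge0.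
Qed.

End form_op_theory.

(** * Square-integrable representatives *)

Section square_integrable.
Context d (X : measurableType d) (R : realType) (mu : {measure set X -> \bar R}).
Context (D : set X).
Hypothesis mD : measurable D.

(** Only the integral is restricted to [D]: strong measurability is asked on the whole space, so
    that translates and compositions of [g] stay measurable. *)
Definition square_integrable (E : normedModType R) (g : X -> E) :=
  strongly_measurable g /\ mu.-integrable D (EFin \o (fun x => `|g x| ^+ 2)).

Lemma square_integrableP (E : normedModType R) (g : X -> E) :
  strongly_measurable g -> (\int[mu]_(x in D) (`|g x| ^+ 2)%:E < +oo)%E ->
  square_integrable g.
Proof.
move=> mg ig; split => //; apply: ge0_integrable => //.
apply: measurable_funX; apply: measurable_funTS.
exact: measurable_fun_strong_norm.
Qed.

Lemma square_integrable_le (E F : normedModType R) (f : X -> E) (g : X -> F) M :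
  square_integrable f -> strongly_measurable g ->
  (forall x, `|g x| <= M * `|f x|) -> square_integrable g.
Proof.
move=> [mf sf] mg gf; split => //.
apply: (integrable_le mD _ _ (integrable_realZl (M ^+ 2) mD sf)).
  apply: measurable_funX; apply: measurable_funTS.
  exact: measurable_fun_strong_norm.
move=> x _; rewrite ger0_norm ?exprn_ge0// -exprMn lerXn2r ?nnegrE//.
by rewrite (le_trans _ (gf x)).
Qed.

Lemma square_integrableB (E : normedModType R) (f g : X -> E) :
  square_integrable f -> square_integrable g -> square_integrable (f - g).
Proof.
move=> [mf sf] [mg sg]; split; first exact: strongly_measurableB.
have sfg := integrable_realD mD sf sg.
apply: (integrable_le mD _ _ (integrable_realZl 2 mD sfg)).
  apply: measurable_funX; apply: measurable_funTS.
  by apply: measurable_fun_strong_norm; exact: strongly_measurableB.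
move=> x _; rewrite ger0_norm ?exprn_ge0//.
have h : `|(f - g) x| <= `|f x| + `|g x| by exact: ler_normB.
apply: (@le_trans _ _ ((`|f x| + `|g x|) ^+ 2)).
  by rewrite lerXn2r ?nnegrE ?addr_ge0.
by have := sqr_ge0 (`|f x| - `|g x|); rewrite sqrrB sqrrD; lra.
Qed.

Lemma square_integrable_norm (E : normedModType R) (g : X -> E) :
  (mu D < +oo)%E -> square_integrable g ->
  mu.-integrable D (EFin \o (fun x => `|g x|)).
Proof.
move=> muD [mg sg].
have i1 : mu.-integrable D (EFin \o (fun=> 1 : R)).
  by apply: (integrable_bounded (M := 1)) => // x _; rewrite normr1.
apply: (integrable_le mD _ _ (integrable_realD mD i1 sg)).
  by apply: measurable_funTS; exact: measurable_fun_strong_norm.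
move=> x _; rewrite normr_id.
by have := sqr_ge0 (`|g x| - 1); have := normr_ge0 (g x); nra.
Qed.

Lemma square_integrableM (E F : normedModType R) (f : X -> E) (g : X -> F)
    (h : X -> R) :
  square_integrable f -> square_integrable g -> measurable_fun setT h ->
  (forall x, D x -> `|h x| <= `|f x| * `|g x|) -> mu.-integrable D (EFin \o h).
Proof.
move=> [_ sf] [_ sg] mh hfg.
apply: (integrable_le mD _ _ (integrable_realD mD sf sg)).
  exact: measurable_funTS.
move=> x Dx; rewrite (le_trans (hfg x Dx))//.
have := sqr_ge0 (`|f x| - `|g x|); have := sqr_ge0 (`|f x| + `|g x|).
by rewrite sqrrB sqrrD; lra.
Qed.

End square_integrable.

Lemma measurable_oo {R : realType} {a b : R} :
  measurable (`]a, b[%classic : set (measurableTypeR R)).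
Proof. exact: measurable_itv. Qed.

Section L2_representatives.
Context {R : realType} {E : normedModType R}.
Local Notation leb := (@lebesgue_measure R).
Implicit Types (a b : R) (f g : R -> E).

Lemma lebesgue_itvoo_lty a b : (leb `]a, b[%classic < +oo)%E.
Proof. by rewrite lebesgue_measure_itv/=; case: ifP => _; rewrite -?EFinB ltry. Qed.

Lemma mem_L2_rep a b f : mem_L2 a b f ->
  exists2 g : measurableTypeR R -> E, square_integrable leb `]a, b[%classic g &
    f = g %[ae leb in `]a, b[%classic].
Proof.
move=> [[g mg fg] fy]; exists g => //; apply: square_integrableP => //.
have -> // : (\int[leb]_(x in `]a, b[) (`|g x| ^+ 2)%:E =
    \int[leb]_(x in `]a, b[) (`|f x| ^+ 2)%:E)%E.
apply: ae_eq_integral_nomeas.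
by apply: ae_mono fg => x + Dx => ->.
Qed.

Lemma rep_mem_L2 a b f (g : measurableTypeR R -> E) :
  square_integrable leb `]a, b[%classic g ->
  f = g %[ae leb in `]a, b[%classic] -> mem_L2 a b f.
Proof.
move=> [mg sg] fg; split; first by exists g.
have -> : (\int[leb]_(x in `]a, b[) (`|f x| ^+ 2)%:E =
    \int[leb]_(x in `]a, b[) (`|g x| ^+ 2)%:E)%E.
  apply: ae_eq_integral_nomeas.
  by apply: ae_mono fg => x + Dx => ->.
exact: (integrable_lty _ sg).
Qed.

Lemma eq_normL2 a b f g : f = g %[ae leb in `]a, b[%classic] ->
  normL2 a b f = normL2 a b g.
Proof.
move=> fg; congr Num.sqrt; apply: ae_eq_Rintegral.
by apply: ae_mono fg => x + Dx => ->.
Qed.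

Lemma eq_normL2w beta a b f g : f = g %[ae leb in `]a, b[%classic] ->
  normL2w beta a b f = normL2w beta a b g.
Proof.
move=> fg; congr Num.sqrt; apply: ae_eq_Rintegral.
by apply: ae_mono fg => x + Dx => ->.
Qed.

End L2_representatives.

(** * Uniqueness of a dual-valued function with given integrals *)

Section uniqueness.
Context {R : realType} {V : normedModType R}.
Local Notation leb := (@lebesgue_measure R).

Lemma square_integrable_dual_eval T (g : measurableTypeR R -> dual V) z :
  square_integrable leb `]0, T[%classic g ->
  leb.-integrable `]0, T[ (EFin \o (fun t => g t z)).
Proof.
move=> sg; apply: integrable_dual_eval => //; first by case: sg.
by have /integrable_lty := square_integrable_norm measurable_oo
  (lebesgue_itvoo_lty _ _) sg; apply.
Qed.

(** Extended by 0 outside []0, T[], [h] has a primitive that vanishes identically, and Lebesgue's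
    differentiation theorem recovers [h] from it almost everywhere. *)
Lemma integral_subintervals_eq0 T (h : R -> R) : measurable_fun setT h ->
  leb.-integrable `]0, T[ (EFin \o h) ->
  (forall a b, 0 <= a -> a <= b -> b <= T -> \int[leb]_(t in `]a, b[) h t = 0) ->
  \forall t \ae leb, `]0, T[%classic t -> h t = 0.
Proof.
move=> mh ih h0.
pose k : R -> R := h \_ `]0, T[%classic.
have ik : leb.-integrable setT (EFin \o k).
  rewrite /k -restrict_EFin; apply/integrable_restrict => //.
  by rewrite setTI.
have mk : measurable_fun setT k by apply/measurable_EFinP; case/integrableP: ik.
have iky y : leb.-integrable `]-oo, y] (EFin \o k).
  by apply: (integrableS _ _ _ ik).
have lk : locally_integrable setT k.
  split => //; first exact: openT.
  move=> K _ cK; have mK : measurable K.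
    exact: closed_measurable (compact_closed (@Rhausdorff R) cK).
  have /integrableP[_] : leb.-integrable K (EFin \o k).
    by apply: (integrableS _ _ _ ik).
  by [].
have := FTC1Ny iky lk; apply: ae_mono => x [_].
have -> : (fun x => \int[leb]_(t in `]-oo, x]) k t) = cst 0.
  apply/funext => y; rewrite /k -Rintegral_mkcondr.
  have [y0|y0] := leP y 0.
    rewrite (_ : _ `&` _ = set0) ?Rintegral_set0//.
    apply/seteqP; split => t //=; rewrite !in_itv/= => -[? /andP[? ?]]; lra.
  have [Ty|yT] := leP T y.
    rewrite (_ : _ `&` _ = `]0, T[%classic).
      have [T0|T0] := leP 0 T; first exact: h0.
      by rewrite set_itv_ge ?Rintegral_set0// bnd_simp -leNgt ltW.
    apply/seteqP; split => t /=; first by case.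
    by move=> tT; split => //; move: tT; rewrite !in_itv/= => /andP[? ?]; lra.
  rewrite (_ : _ `&` _ = `]0, y]%classic).
    rewrite -Rintegral_itv_bndo_bndc; first by apply: h0; lra.
    apply: (integrableS _ _ _ ih) => // t /=; rewrite !in_itv/= => /andP[? ?].
    by apply/andP; split; lra.
  apply/seteqP; split => t /=; rewrite !in_itv/=.
    by case=> ? /andP[? ?]; apply/andP.
  by move=> /andP[? ?]; split=> //; apply/andP; split; lra.
by rewrite derive1_cst /k /patch => + tT; rewrite mem_set.
Qed.

Lemma separable_seq (W : normedModType R) : separable W ->
  exists s : nat -> W, forall w e, 0 < e -> exists n, `|w - s n| < e.
Proof.
move=> [S cS dS].
have [S0|[surj]] := pfcard_geP cS.
  have [||x [_]] := dS setT; [by exists 0|exact: openT|].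
  by rewrite S0.
exists surj => w e e0.
have [x [wx Sx]] : (ball w e `&` S !=set0).
  by apply: dS; [exists w; exact: ballxx|exact: ball_open].
have [n _ nx] := 'surj_surj Sx.
by exists n; rewrite nx; move: wx; rewrite -ball_normE.
Qed.

(** For each [z] the real functions [f t z] and [g t z] agree outside a null set depending on [z]. A
    dense sequence leaves one null set for all its terms, and continuity of [f t - g t] extends the
    equality to every vector. *)
Lemma dual_ae_eq T (f g : measurableTypeR R -> dual V) : separable V ->
  square_integrable leb `]0, T[%classic f ->
  square_integrable leb `]0, T[%classic g ->
  (forall z a b, 0 <= a -> a <= b -> b <= T ->
    \int[leb]_(t in `]a, b[) f t z = \int[leb]_(t in `]a, b[) g t z) ->
  f = g %[ae leb in `]0, T[%classic].
Proof.
move=> /separable_seq[s ds] sf sg fg.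
have h n : \forall t \ae leb, `]0, T[%classic t -> (f t - g t) (s n) = 0.
  have [mfg _] := square_integrableB measurable_oo sf sg.
  apply: integral_subintervals_eq0.
  - exact: (measurable_dual_eval _ mfg).
  - apply: (@square_integrable_dual_eval _ (f - g)).
    exact: square_integrableB.
  - move=> a b a0 ab bT.
    have sub (k : measurableTypeR R -> dual V) : square_integrable leb `]0, T[%classic k ->
        leb.-integrable `]a, b[ (EFin \o (fun t => k t (s n))).
      move=> /(square_integrable_dual_eval (s n)) ik; apply: (integrableS _ _ _ ik) => // t /=.
      by rewrite !in_itv/= => /andP[? ?]; apply/andP; split; lra.
    rewrite (_ : (fun t => _) = (fun t => f t (s n) - g t (s n)))//.
    by rewrite RintegralB ?fg ?subrr//; exact: sub.
have := ae_foralln h; apply: ae_mono => t ht tT.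
apply/eqP; rewrite -subr_eq0; apply/eqP/dual_ext => v.
apply/eqP; rewrite -normr_le0; apply/ler_addgt0Pl => e e0; rewrite addr0.
pose l := f t - g t; have [N N0] : exists2 N, 0 < N & `|l| <= N.
  by exists (`|l| + 1); [rewrite ltr_wpDl|rewrite lerDl].
move=> lN; have [n vn] := ds v (e / N) (divr_gt0 e0 N0).
have -> : (f t - g t) v = l (v - s n).
  by rewrite dualB ht// subr0.
rewrite (le_trans (dual_le_norm _ _))//.
rewrite (le_trans (ler_pM _ _ lN (ltW vn)))//.
by rewrite mulrC divfK// gt_eqF.
Qed.

End uniqueness.

Section weak_derivatives.
Context {R : realType} {V H : hilbertType R} (iota : {linear V -> H}) (T : R).
Local Notation mR := (measurableTypeR R).
Hypothesis ciota : continuous iota.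
Local Notation leb := (@lebesgue_measure R).
Local Notation sqi := (square_integrable leb `]0, T[%classic).
Implicit Types (u v : R -> V) (w : R -> dual V) (c : R -> H).

Lemma continuous_bounded_oo (k : R -> R) : continuous k ->
  exists M, forall t, `]0, T[%classic t -> `|k t| <= M.
Proof.
move=> ck; have : compact [set k x | x in `[0, T]].
  apply: continuous_compact; last exact: segment_compact.
  exact: continuous_subspaceT.
move=> /compact_bounded[M [_ kM]]; exists (M + 1) => t tT.
apply: (kM (M + 1)); first by rewrite ltrDl.
by exists t => //; exact: (subset_itv_oo_cc tT).
Qed.

Lemma integrableM_continuous (k : R -> R) (g : mR -> R) :
  continuous k -> leb.-integrable `]0, T[ (EFin \o g) ->
  leb.-integrable `]0, T[ (EFin \o (fun t => k t * g t)).
Proof.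
move=> ck ig; have [M kM] := continuous_bounded_oo ck.
have mg : measurable_fun (`]0, T[%classic : set mR) g.
  by apply/measurable_EFinP; case/integrableP: ig.
have ig' := integrable_realZl M measurable_oo (integrable_norm ig).
apply: (integrable_le measurable_oo _ _ ig').
  apply: measurable_funM => //.
  by apply: measurable_funTS; exact: continuous_measurable_fun.
by move=> t tT; rewrite normrM ler_wpM2r// kM.
Qed.

Lemma bochner_scale (k : R -> R) w (w0 : mR -> dual V) z :
  continuous k -> sqi w0 -> w = w0 %[ae leb in `]0, T[%classic] ->
  bochner leb `]0, T[%classic (fun t => k t *: w t) z =
    \int[leb]_(t in `]0, T[) (k t * w0 t z).
Proof.
move=> ck sw0 ww0.
have mk : measurable_fun (setT : set mR) k.
  exact: continuous_measurable_fun.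
have nw0 := square_integrable_norm measurable_oo (lebesgue_itvoo_lty _ _) sw0.
have mkw0 : strongly_measurable (fun t : mR => k t *: w0 t).
  by apply: strongly_measurableZ => //; case: sw0.
rewrite bochner_dualE.
- apply: ae_eq_Rintegral; apply: ae_mono ww0 => t + tT => /(_ tT) ->.
  by [].
- exact: measurable_oo.
- exact: lebesgue_itvoo_lty.
- exists (fun t => k t *: w0 t) => //.
  by apply: ae_mono ww0 => t + tT => /(_ tT) ->.
- have -> : (\int[leb]_(x in `]0%R, T[) `|k x *: w x|%:E =
      \int[leb]_(x in `]0%R, T[) `|k x *: w0 x|%:E)%E.
    apply: ae_eq_integral_nomeas.
    by apply: ae_mono ww0 => t + tT => /(_ tT) ->.
  have [M kM] := continuous_bounded_oo ck.
  apply: (integrable_lty measurable_oo).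
  have nw0' := integrable_realZl M measurable_oo nw0.
  apply: (integrable_le measurable_oo _ _ nw0').
    by apply: measurable_funTS; exact: measurable_fun_strong_norm.
  by move=> t tT; rewrite normr_id normrZ ler_wpM2r// kM.
Qed.

Lemma square_integrable_gelfand (u0 : mR -> V) :
  sqi u0 -> sqi (gelfand iota \o u0).
Proof.
move=> su0; have [M gM] := gelfand_bounded ciota.
apply: (square_integrable_le measurable_oo su0 (M := M)).
  by apply: (strongly_measurable_linear (M := M)) => //;
    [exact: gelfand_linear|case: su0].
by move=> t; exact: gM.
Qed.

Lemma test_function_continuous phi : test_function T phi ->
  continuous phi /\ continuous (derive1 phi).
Proof.
move=> [dphi _]; split => t; apply: differentiable_continuous;
  apply/derivable1_diffP; first exact: (dphi 0 t).
exact: (dphi 1 t).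
Qed.

Lemma continuous_inner c (h : H) : {within `[0, T], continuous c} ->
  {within `[0, T], continuous (fun t => inner (c t) h)}.
Proof.
move=> cc x.
have ci : continuous (fun y : H => inner y h).
  have lI : scalar (fun y : H => inner y h).
    by move=> k y z; rewrite innerDl innerZl.
  pose I : {linear H -> R} := HB.pack (fun y : H => inner y h)
    (GRing.isLinear.Build _ _ _ _ _ lI).
  apply: (@bounded_linear_continuous _ _ _ I); apply/linear_boundedP.
  near=> r => y; rewrite (le_trans (cauchy_schwarz _ _))// mulrC ler_wpM2r//.
exact: (@continuous_comp _ _ _ (c : subspace `[0, T] -> H) _ x (cc x) (ci _)).
Unshelve. all: by end_near. Qed.

(** At a fixed [z] the vector-valued identity says that [w0 t z] is the scalar weak derivative of
    [inner (iota (u0 t)) (iota z)], which puts it within reach of [weak_derivative_closed]. *)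
Lemma is_weak_derivativeE u w (u0 : mR -> V)
    (w0 : mR -> dual V) phi z :
  sqi u0 -> u = u0 %[ae leb in `]0, T[%classic] ->
  sqi w0 -> w = w0 %[ae leb in `]0, T[%classic] ->
  test_function T phi -> is_weak_derivative iota T u w ->
  \int[leb]_(t in `]0, T[) (derive1 phi t * inner (iota (u0 t)) (iota z)) =
  - (\int[leb]_(t in `]0, T[) (phi t * w0 t z)).
Proof.
move=> su0 uu0 sw0 ww0 tphi uw.
have [cphi cphi'] := test_function_continuous tphi.
have gu : (fun t => gelfand iota (u t)) = (gelfand iota \o u0)
    %[ae leb in `]0, T[%classic].
  by apply: ae_mono uu0 => t + tT => /(_ tT) /= ->.
have e1 := bochner_scale z cphi sw0 ww0.
have e2 := bochner_scale z cphi' (square_integrable_gelfand su0) gu.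
have e3 : bochner leb `]0, T[%classic
      (fun t => derive1 phi t *: gelfand iota (u t)) z =
    - (bochner leb `]0, T[%classic (fun t => phi t *: w t) z).
  by rewrite (uw phi tphi).
rewrite -e1 -e3 e2; apply: eq_Rintegral => t _.
by rewrite /= gelfandE.
Qed.

(** This identity, with [z] frozen, is all that the energy inequality asks of the weak
    derivative. *)
Lemma weak_derivative_pairing u w (w0 : mR -> dual V) c z a b :
  mem_L2 0 T u -> sqi w0 -> w = w0 %[ae leb in `]0, T[%classic] ->
  is_weak_derivative iota T u w -> continuous_rep iota T u c ->
  0 <= a -> a <= b -> b <= T ->
  inner (c b) (iota z) - inner (c a) (iota z) = \int[leb]_(t in `]a, b[) w0 t z.
Proof.
move=> /mem_L2_rep[u0 su0 uu0] sw0 ww0 uw [cc cu].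
move: a b; apply: (weak_derivative_closed (p := fun t => inner (c t) (iota z))).
- exact: continuous_inner.
- exact: square_integrable_dual_eval.
- move=> phi tphi; rewrite -(is_weak_derivativeE z su0 uu0 sw0 ww0 tphi uw).
  apply: ae_eq_Rintegral.
  by apply: ae_mono2 uu0 cu => t + + tT => /(_ tT) ut /(_ tT) ->; rewrite ut.
Qed.

Lemma is_weak_derivativeB u1 u2 w1 w2 :
  mem_L2 0 T u1 -> mem_L2 0 T u2 -> mem_L2 0 T w1 -> mem_L2 0 T w2 ->
  is_weak_derivative iota T u1 w1 -> is_weak_derivative iota T u2 w2 ->
  is_weak_derivative iota T (u1 - u2) (w1 - w2).
Proof.
move=> /mem_L2_rep[v1 sv1 uv1] /mem_L2_rep[v2 sv2 uv2].
move=> /mem_L2_rep[y1 sy1 wy1] /mem_L2_rep[y2 sy2 wy2] d1 d2 phi tphi.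
have [cphi cphi'] := test_function_continuous tphi.
have sv := square_integrableB measurable_oo sv1 sv2.
have sy := square_integrableB measurable_oo sy1 sy2.
have gv : (fun t => gelfand iota ((u1 - u2) t)) = (gelfand iota \o (v1 - v2))
    %[ae leb in `]0, T[%classic].
  by apply: ae_mono2 uv1 uv2 => t + + tT => /(_ tT) h1 /(_ tT) h2;
    rewrite /= !fctE h1 h2.
have wy : w1 - w2 = y1 - y2 %[ae leb in `]0, T[%classic].
  by apply: ae_mono2 wy1 wy2 => t + + tT => /(_ tT) h1 /(_ tT) h2;
    rewrite !fctE h1 h2.
apply: dual_ext => z.
transitivity (- (bochner leb `]0, T[%classic
  (fun t => phi t *: (w1 - w2) t) z)); last by [].
apply: etrans (bochner_scale z cphi' (square_integrable_gelfand sv) gv) _.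
apply: etrans (esym (congr1 -%R (bochner_scale z cphi sy wy))).
have e1 := is_weak_derivativeE z sv1 uv1 sy1 wy1 tphi d1.
have e2 := is_weak_derivativeE z sv2 uv2 sy2 wy2 tphi d2.
have -> : \int[leb]_(t in `]0, T[) (phi t * (y1 - y2) t z) =
    \int[leb]_(t in `]0, T[) (phi t * y1 t z) -
    \int[leb]_(t in `]0, T[) (phi t * y2 t z).
  rewrite -RintegralB.
  - by apply: eq_Rintegral => t _; rewrite -mulrBr.
  - exact: measurable_oo.
  - exact: (integrableM_continuous cphi (square_integrable_dual_eval z sy1)).
  - exact: (integrableM_continuous cphi (square_integrable_dual_eval z sy2)).
rewrite opprD -e1 -e2.
have igel (v : mR -> V) : sqi v ->
    leb.-integrable `]0, T[ (EFin \o (fun t => inner (iota (v t)) (iota z))).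
  move=> /square_integrable_gelfand/(square_integrable_dual_eval z); apply: eq_integrable => //.
  by move=> t _; rewrite /= gelfandE.
rewrite -RintegralB.
- apply: eq_Rintegral => t _; rewrite -mulrBr; congr (_ * _).
  by rewrite /= gelfandE// -innerBl -linearB.
- exact: measurable_oo.
- exact: (integrableM_continuous cphi' (igel _ sv1)).
- exact: (integrableM_continuous cphi' (igel _ sv2)).
Qed.

End weak_derivatives.

(** * The energy inequality *)

Section translation.
Context {R : realType}.
Local Notation mR := (measurableTypeR R).
Local Notation leb := (@lebesgue_measure R).
Local Open Scope ereal_scope.

Lemma lebesgue_measure_translation (s : R) (A : set mR) :
  measurable A ->
  pushforward leb (fun x : mR => (x - s)%R : mR) A
    = leb A.
Proof.
have ms : measurable_fun (setT : set mR)
    (fun x : mR => (x - s)%R : mR).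
  exact: measurable_funB.
move=> mA; apply/esym.
apply: (@lebesgue_measure_unique R (pushforward leb
  (fun x : mR => (x - s)%R : mR))) => // X [[a b]] _ <-.
transitivity (leb ((fun x : mR => (x - s)%R) @^-1` `]a, b])) => //.
rewrite (_ : _ @^-1` _ = `](a + s)%R, (b + s)%R]%classic).
  by rewrite !lebesgue_measure_itv/= !lte_fin ltrD2r -!EFinB; congr (if _ then _%:E else _);
    ring.
apply/seteqP; split => x /=; rewrite !in_itv/= => /andP[? ?]; apply/andP; split; lra.
Qed.

Lemma ge0_integral_translation (s : R) (f : mR -> \bar R) :
  measurable_fun setT f -> (forall x, 0 <= f x) ->
  \int[leb]_x f (x - s)%R = \int[leb]_x f x.
Proof.
move=> mf f0.
have ms : measurable_fun (setT : set mR)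
    (fun x : mR => (x - s)%R : mR).
  exact: measurable_funB.
have := @ge0_integral_pushforward _ _ _ _ _ _ ms leb setT f measurableT mf _.
rewrite preimage_setT => <- //.
apply: eq_measure_integral => A mA _.
exact: lebesgue_measure_translation.
Qed.

End translation.

(* The variation of a charge is finite but not canonically a finite measure. *)
Section finite_measure_of.
Context d (Y : measurableType d) (R : realType) (m : {measure set Y -> \bar R}).
Hypothesis mfin : (m setT < +oo)%E.

Definition finite_measure_of (_ : (m setT < +oo)%E) : set Y -> \bar R := m.

HB.instance Definition _ := Measure.on (finite_measure_of mfin).

Let finite_measure_of_fin : fin_num_fun (finite_measure_of mfin).
Proof.
move=> A mA; rewrite ge0_fin_numE//; apply: le_lt_trans mfin.
by apply: le_measure; rewrite ?inE.
Qed.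

HB.instance Definition _ :=
  Measure_isFinite.Build _ _ _ (finite_measure_of mfin) finite_measure_of_fin.

End finite_measure_of.

Section tonelli_finite.
Context d1 d2 (X : measurableType d1) (Y : measurableType d2) (R : realType).
Context (l : {sigma_finite_measure set X -> \bar R}).
Context (m : {measure set Y -> \bar R}).
Hypothesis mfin : (m setT < +oo)%E.
Local Open Scope ereal_scope.

Let m' : {finite_measure set Y -> \bar R} := finite_measure_of mfin.

Lemma tonelli_finite (D : set X) (S : set Y) (f : X * Y -> \bar R) :
  measurable D -> measurable S -> measurable_fun setT f -> (forall z, 0 <= f z) ->
  \int[l]_(x in D) \int[m]_(y in S) f (x, y) =
  \int[m]_(y in S) \int[l]_(x in D) f (x, y).
Proof.
move=> mD mS mf f0.
pose g := f \_ (D `*` S).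
have mg : measurable_fun setT g.
  apply/measurable_restrict; first exact: measurableX.
    exact: measurableT.
  by rewrite setTI; exact: measurable_funTS.
have g0 z : 0 <= g z by apply: erestrict_ge0.
have := @fubini_tonelli _ _ _ _ _ l m' g mg g0.
rewrite (_ : \int[l]_x _ = \int[l]_(x in D) \int[m]_(y in S) f (x, y)); last first.
  rewrite [RHS]integral_mkcond; apply: eq_integral => x _.
  rewrite /patch; case: ifPn => [xD|xD].
    rewrite [RHS]integral_mkcond; apply: eq_integral => y _.
    by rewrite /g /patch in_setX xD.
  rewrite integral0_eq// => y _.
  by rewrite /g /patch in_setX (negbTE xD).
move=> ->.
rewrite [RHS]integral_mkcond; apply: eq_integral => y _.
rewrite /patch; case: ifPn => [yS|yS].
  rewrite [RHS]integral_mkcond; apply: eq_integral => x _.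
  by rewrite /g /patch in_setX yS andbT.
rewrite integral0_eq// => x _.
by rewrite /g /patch in_setX (negbTE yS) andbF.
Qed.

Lemma measurable_tonelli_finite (S : set Y) (f : X * Y -> \bar R) :
  measurable S -> measurable_fun setT f -> (forall z, 0 <= f z) ->
  measurable_fun setT (fun x => \int[m]_(y in S) f (x, y)).
Proof.
move=> mS mf f0.
pose g := f \_ (setT `*` S).
have mg : measurable_fun setT g.
  apply/measurable_restrict; first exact: measurableX.
    exact: measurableT.
  by rewrite setTI; exact: measurable_funTS.
have g0 z : 0 <= g z by apply: erestrict_ge0.
have := @measurable_fun_fubini_tonelli_F _ _ _ _ _ m' g mg g0.
apply: eq_measurable_fun => x _.
rewrite /fubini_F [RHS]integral_mkcond; apply: eq_integral => y _.
by rewrite /g /patch in_setX in_setT.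
Qed.

End tonelli_finite.

Lemma young_ineq (R : realType) (a b e : R) : 0 < e ->
  2 * (a * b) <= e * a ^+ 2 + e^-1 * b ^+ 2.
Proof.
move=> e0; rewrite -(ler_pM2l e0) mulrDr [X in _ <= _ + X]mulrA divff ?gt_eqF// mul1r.
by have := sqr_ge0 (e * a - b); rewrite sqrrB exprMn; lra.
Qed.

(** * Integrals over a short window of the past *)

Section past_window.
Context {R : realType} (T : R).
Local Notation mR := (measurableTypeR R).
Local Notation leb := (@lebesgue_measure R).
Local Notation D := (`]0, T[%classic : set mR).
Local Notation D2 := (D `*` D).
Local Notation leb2 := (leb \x leb)%E.
Implicit Types (h : R) (f : mR -> R).

(** The first coordinate is the present, the second a time less than [h] earlier. *)
Definition window h : set (mR * mR) :=
  [set z | z.1 - h < z.2 < z.1].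

Lemma measurable_window h : measurable (window h).
Proof.
have m1 : measurable_fun setT
    (fun z : mR * mR => (z.1 - h : R)).
  by apply: measurable_funB.
have m2 : measurable_fun setT
    (fun z : mR * mR => (z.2 : R)).
  exact: measurable_snd.
have m3 : measurable_fun setT
    (fun z : mR * mR => (z.1 : R)).
  exact: measurable_fst.
rewrite (_ : window h = ~` (setT `&` [set z | z.2 <= z.1 - h]) `&`
    ~` (setT `&` [set z | z.1 <= z.2])).
  by apply: measurableI; apply: measurableC; apply: measurable_fun_le.
apply/seteqP; split => z /=.
  by move=> /andP[z1 z2]; split=> -[_]; rewrite leNgt ?z1 ?z2.
move=> [h1 h2]; apply/andP; split; rewrite ltNge; apply/negP => ?.
  exact: h1.
exact: h2.
Qed.

Lemma measurable_oo2 : measurable (D2 : set (mR * mR)).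
Proof. by apply: measurableX; exact: measurable_oo. Qed.

Lemma ge0_product_integral (F : mR * mR -> R) :
  measurable_fun setT F -> (forall z, 0 <= F z) ->
  (\int[leb2]_(z in D2) (F z)%:E =
    \int[leb]_(x in D) \int[leb]_(y in D) (F (x, y))%:E)%E /\
  (\int[leb2]_(z in D2) (F z)%:E =
    \int[leb]_(y in D) \int[leb]_(x in D) (F (x, y))%:E)%E.
Proof.
move=> mF F0.
pose G := (EFin \o F) \_ D2.
have mG : measurable_fun setT G.
  apply/measurable_restrict; [exact: measurable_oo2|exact: measurableT|].
  by rewrite setTI; apply: measurable_funTS; exact/measurable_EFinP.
have G0 z : (0 <= G z)%E by apply: erestrict_ge0 => // t _; rewrite lee_fin.
rewrite integral_mkcond; split.
  rewrite (fubini_tonelli1 _ mG G0) [RHS]integral_mkcond.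
  apply: eq_integral => x _; rewrite /fubini_F /patch.
  case: ifPn => [xD|xD].
    rewrite [RHS]integral_mkcond; apply: eq_integral => y _.
    by rewrite /G /patch in_setX xD.
  rewrite integral0_eq// => y _.
  by rewrite /G /patch in_setX (negbTE xD).
rewrite (fubini_tonelli2 _ mG G0) [RHS]integral_mkcond.
apply: eq_integral => y _; rewrite /fubini_G /patch.
case: ifPn => [yD|yD].
  rewrite [RHS]integral_mkcond; apply: eq_integral => x _.
  by rewrite /G /patch in_setX yD andbT.
rewrite integral0_eq// => x _.
by rewrite /G /patch in_setX (negbTE yD) andbF.
Qed.

(** The inner real integrals read 0 where a section of [F] is not integrable; by Fubini such
    sections form a null set, so the iterated integrals keep their value. *)
Lemma product_Rintegral (F : mR * mR -> R) :
  leb2.-integrable D2 (EFin \o F) ->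
  \int[leb2]_(z in D2) F z = \int[leb]_(x in D) \int[leb]_(y in D) F (x, y) /\
  \int[leb2]_(z in D2) F z = \int[leb]_(y in D) \int[leb]_(x in D) F (x, y).
Proof.
move=> iF.
pose G := (EFin \o F) \_ D2.
have iG : leb2.-integrable setT G.
  by apply/integrable_restrict; [exact: measurable_oo2|exact: measurableT|rewrite setTI].
have patch1 x : x \in D -> (fun y => G (x, y)) = (fun y => (F (x, y))%:E) \_ D.
  by move=> xD; apply/funext => y; rewrite /G /patch in_setX xD.
have patch2 y : y \in D -> (fun x => G (x, y)) = (fun x => (F (x, y))%:E) \_ D.
  by move=> yD; apply/funext => x; rewrite /G /patch in_setX yD andbT.
have IE : \int[leb2]_(z in D2) F z = fine (\int[leb2]_z G z)%E.
  by rewrite /Rintegral integral_mkcond.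
split; rewrite IE.
  rewrite -(integral12_prod_meas1 iG); congr fine.
  rewrite [RHS]integral_mkcond; apply: ae_eq_integral_nomeas.
  apply: ae_mono (ae_integrable1 iG) => x ix _.
  rewrite /fubini_F [RHS]/patch; case: ifPn => [xD|xD]; last first.
    by rewrite integral0_eq// => y _; rewrite /G /patch in_setX (negbTE xD).
  have e : (\int[leb]_y G (x, y) = \int[leb]_(y in D) (F (x, y))%:E)%E.
    by rewrite [RHS]integral_mkcond -patch1.
  by rewrite /Rintegral fineK -e// integrable_fin_num.
rewrite -(integral21_prod_meas1 iG); congr fine.
rewrite [RHS]integral_mkcond; apply: ae_eq_integral_nomeas.
apply: ae_mono (ae_integrable2 iG) => y iy _.
rewrite /fubini_G [RHS]/patch; case: ifPn => [yD|yD]; last first.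
  by rewrite integral0_eq// => x _; rewrite /G /patch in_setX (negbTE yD) andbF.
have e : (\int[leb]_x G (x, y) = \int[leb]_(x in D) (F (x, y))%:E)%E.
  by rewrite [RHS]integral_mkcond -patch2.
by rewrite /Rintegral fineK -e// integrable_fin_num.
Qed.

Lemma window_indic1 h (x y : R) :
  \1_(window h) (x, y) = \1_(`]y, y + h[%classic) x :> R.
Proof.
have E : ((x, y) \in window h) = (x \in `]y, y + h[%classic).
  apply/idP/idP; rewrite !inE /window/= in_itv/= => /andP[? ?]; apply/andP; split;
  lra.
by rewrite !indicE E.
Qed.

Lemma window_indic2 h (x y : R) :
  \1_(window h) (x, y) = \1_(`]x - h, x[%classic) y :> R.
Proof.
have E : ((x, y) \in window h) = (y \in `]x - h, x[%classic).
  apply/idP/idP => /set_mem xy; apply/mem_set; move: xy.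
    by rewrite /window/= in_itv/=.
  by rewrite /window/= in_itv/=.
by rewrite !indicE E.
Qed.

Lemma integral_indic_le h (a b : R) : 0 <= h -> b - a = h ->
  (\int[leb]_(x in D) (\1_(`]a, b[%classic) x)%:E <= h%:E)%E.
Proof.
move=> h0 bah; rewrite integral_indic; [|exact: measurable_oo..].
apply: (@le_trans _ _ (leb `]a, b[%classic)).
  apply: le_measure; rewrite ?inE; [|exact: measurable_oo|by move=> x []].
  by apply: measurableI; exact: measurable_oo.
rewrite lebesgue_measure_itv/= lte_fin; case: ifP => _; rewrite ?lee_fin//.
by rewrite bah.
Qed.

(** A section of the window is an interval of length [h], so integrating the other variable out
    costs a factor at most [h]. *)
Lemma window_integral2 h f : 0 <= h -> measurable_fun setT f -> (forall x, 0 <= f x) ->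
  (\int[leb2]_(z in D2) (\1_(window h) z * f z.2)%:E <=
    h%:E * \int[leb]_(x in D) (f x)%:E)%E.
Proof.
move=> h0 mf f0.
have mF : measurable_fun setT (fun z => \1_(window h) z * f z.2 : R).
  apply: measurable_funM; first by apply: measurable_indic; exact: measurable_window.
  by apply: measurableT_comp => //; exact: measurable_snd.
rewrite (ge0_product_integral mF _).2; last first.
  by move=> z; rewrite mulr_ge0// indicE.
have mfD : measurable_fun D f by exact: measurable_funTS.
rewrite -ge0_integral_realZl//.
apply: ae_le_ge0_integral.
- by move=> y _; apply: integral_ge0 => x _; rewrite lee_fin mulr_ge0// indicE.
- by move=> y _; rewrite lee_fin mulr_ge0.
apply: aeW => y _; under eq_integral do rewrite mulrC window_indic1 /=.
rewrite ge0_integral_realZl//.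
rewrite mulrC EFinM lee_wpmul2l ?lee_fin//.
by apply: integral_indic_le => //; rewrite addrC addKr.
Qed.

Lemma window_integral1 h f : 0 <= h -> measurable_fun setT f -> (forall x, 0 <= f x) ->
  (\int[leb2]_(z in D2) (\1_(window h) z * f z.1)%:E <=
    h%:E * \int[leb]_(x in D) (f x)%:E)%E.
Proof.
move=> h0 mf f0.
have mF : measurable_fun setT (fun z => \1_(window h) z * f z.1 : R).
  apply: measurable_funM; first by apply: measurable_indic; exact: measurable_window.
  by apply: measurableT_comp => //; exact: measurable_fst.
rewrite (ge0_product_integral mF _).1; last first.
  by move=> z; rewrite mulr_ge0// indicE.
have mfD : measurable_fun D f by exact: measurable_funTS.
rewrite -ge0_integral_realZl//.
apply: ae_le_ge0_integral.
- by move=> y _; apply: integral_ge0 => x _; rewrite lee_fin mulr_ge0// indicE.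
- by move=> y _; rewrite lee_fin mulr_ge0.
apply: aeW => x _; under eq_integral do rewrite mulrC window_indic2 /=.
rewrite ge0_integral_realZl//.
rewrite mulrC EFinM lee_wpmul2l ?lee_fin//.
by apply: integral_indic_le => //; rewrite opprB addrC subrK.
Qed.

(** The bound is of order [h], hence uniform after division by [h]; the free [e] later balances a
    large [p] against a small [q]. *)
Lemma window_integral_le h (p q : mR -> R) e : 0 <= h -> 0 < e ->
  measurable_fun setT p -> measurable_fun setT q ->
  (forall x, 0 <= p x) -> (forall x, 0 <= q x) ->
  (\int[leb2]_(z in D2) (\1_(window h) z * (p z.2 * q z.1))%:E <=
    h%:E * (e%:E * \int[leb]_(x in D) (p x ^+ 2)%:E +
            e^-1%:E * \int[leb]_(x in D) (q x ^+ 2)%:E))%E.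
Proof.
move=> h0 e0 mp mq p0 q0.
have e'0 : 0 < e^-1 by rewrite invr_gt0.
have mp2 : measurable_fun setT (fun x => e * p x ^+ 2).
  by apply: measurable_funM => //; exact: measurable_funX.
have mq2 : measurable_fun setT (fun x => e^-1 * q x ^+ 2).
  by apply: measurable_funM => //; exact: measurable_funX.
have p20 x : 0 <= e * p x ^+ 2 by rewrite mulr_ge0 ?exprn_ge0// ltW.
have q20 x : 0 <= e^-1 * q x ^+ 2 by rewrite mulr_ge0 ?exprn_ge0// ltW.
have F1m : measurable_fun setT (fun z => \1_(window h) z * (e * p z.2 ^+ 2)).
  apply: measurable_funM; first by apply: measurable_indic; exact: measurable_window.
  exact: (measurableT_comp mp2 measurable_snd).
have F2m : measurable_fun setT (fun z => \1_(window h) z * (e^-1 * q z.1 ^+ 2)).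
  apply: measurable_funM; first by apply: measurable_indic; exact: measurable_window.
  exact: (measurableT_comp mq2 measurable_fst).
apply: (@le_trans _ _ (\int[leb2]_(z in D2) ((\1_(window h) z * (e * p z.2 ^+ 2))%:E +
    (\1_(window h) z * (e^-1 * q z.1 ^+ 2))%:E))%E).
  apply: ae_le_ge0_integral.
  - by move=> z _; rewrite lee_fin mulr_ge0 ?indicE// mulr_ge0.
  - by move=> z _; rewrite -EFinD lee_fin addr_ge0// mulr_ge0 ?indicE.
  apply: aeW => z _; rewrite -EFinD lee_fin -mulrDr ler_wpM2l ?indicE//.
  apply: le_trans (young_ineq _ _ e0).
  by rewrite mulr_natl mulr2n lerDl mulr_ge0.
rewrite ge0_integralD; first last.
- by apply/measurable_EFinP; exact: measurable_funTS.
- by move=> z _; rewrite lee_fin mulr_ge0 ?indicE.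
- by apply/measurable_EFinP; exact: measurable_funTS.
- by move=> z _; rewrite lee_fin mulr_ge0 ?indicE.
- exact: measurable_oo2.
have int0 (f : mR -> R) : (0 <= \int[leb]_(x in D) (f x ^+ 2)%:E)%E.
  by apply: integral_ge0 => x _; rewrite lee_fin sqr_ge0.
have scale (k : R) (f : mR -> R) : 0 <= k -> measurable_fun setT f ->
    (\int[leb]_(x in D) (k * f x ^+ 2)%:E = k%:E * \int[leb]_(x in D) (f x ^+ 2)%:E)%E.
  move=> k0 mf; apply: ge0_integral_realZl => //.
  - by apply: measurable_funTS; exact: measurable_funX.
  - by move=> x _; exact: sqr_ge0.
apply: le_trans (leeD (window_integral2 h0 mp2 p20) (window_integral1 h0 mq2 q20)) _.
rewrite !scale// ?(ltW e0)// ?(ltW e'0)//.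
have A1 : (0 <= e%:E * \int[leb]_(x in D) (p x ^+ 2)%:E)%E.
  by apply: mule_ge0 => //; rewrite lee_fin ltW.
have A2 : (0 <= e^-1%:E * \int[leb]_(x in D) (q x ^+ 2)%:E)%E.
  by apply: mule_ge0 => //; rewrite lee_fin ltW.
by rewrite (ge0_muleDr _ A1 A2) lexx.
Qed.

End past_window.

Section averages.
Context {R : realType} (T : R).
Local Notation leb := (@lebesgue_measure R).
Local Notation D := (`]0, T[%classic : set (measurableTypeR R)).

Lemma lipschitz1_continuous (K : R -> R) :
  (forall x y, x <= y -> `|K y - K x| <= y - x) -> continuous K.
Proof.
move=> lK x; apply/cvgrPdist_lt => e e0.
near=> y.
have xy : `|x - y| < e by near: y; exact: cvgr_dist_lt.
have [yx|yx] := leP y x.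
  by rewrite (le_lt_trans (lK _ _ yx))// (le_lt_trans _ xy)// ler_norm.
rewrite distrC (le_lt_trans (lK _ _ (ltW yx)))//.
by rewrite (le_lt_trans _ xy)// distrC ler_norm.
Unshelve. all: by end_near. Qed.

(** [I h y] is the increment from [y] to [y + h] of a primitive of [k] cut off outside []0, T[]. The
    primitive is 1-Lipschitz, whence measurability and the bound by [h], and Lebesgue's theorem
    gives the limit of the quotients. *)
Lemma average_cvg (k : R -> R) : measurable_fun setT k -> (forall x, `|k x| <= 1) ->
  exists I : R -> R -> R, [/\
    forall h (y : R), 0 <= h ->
      I h y = \int[leb]_(x in D) (\1_(`]y, y + h[%classic) x * k x),
    forall h, 0 <= h -> measurable_fun setT (I h),
    forall h y, 0 <= h -> `|I h y| <= h &
    \forall y \ae leb, D y -> I n.+1%:R^-1 y * n.+1%:R @[n --> \oo] --> k y].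
Proof.
move=> mk k1; pose q := k \_ D.
have q1 x : `|q x| <= 1.
  by rewrite /q /patch; case: ifP => // _; rewrite normr0.
have iq : leb.-integrable setT (EFin \o q).
  rewrite /q -restrict_EFin; apply/integrable_restrict => //; rewrite setTI.
  apply: (integrable_bounded (M := 1)) => //; first exact: lebesgue_itvoo_lty.
  exact: measurable_funTS.
have mq : measurable_fun setT q by apply/measurable_EFinP; case/integrableP: iq.
have iqS (A : set (measurableTypeR R)) : measurable A -> leb.-integrable A (EFin \o q).
  by move=> mA; apply: (integrableS _ _ _ iq).
have iqy y : leb.-integrable `]-oo, y] (EFin \o q).
  by apply: iqS; exact: measurable_itv.
have lq : locally_integrable setT q.
  split => //; first exact: openT.
  move=> C _ cC; have mC : measurable C.
    exact: closed_measurable (compact_closed (@Rhausdorff R) cC).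
  by have /integrableP[] := iqS C mC.
pose K x := \int[leb]_(t in `]-oo, x]) q t.
have KB x y : x <= y -> K y - K x = \int[leb]_(t in `]x, y]) q t.
  by move=> xy; apply: Rintegral_itvB; rewrite ?bnd_simp.
have lK x y : x <= y -> `|K y - K x| <= y - x.
  move=> xy; rewrite KB//.
  have lexy : leb `]x, y]%classic = (y - x)%:E.
    rewrite lebesgue_measure_itv/= lte_fin; case: ltP => // yx.
    by congr EFin; lra.
  have ixy : leb.-integrable `]x, y] (EFin \o q) by exact: iqS.
  apply: (@le_trans _ _ (\int[leb]_(t in `]x, y]) `|q t|)).
    exact: le_normr_Rintegral.
  apply: (@le_trans _ _ (\int[leb]_(t in `]x, y]) 1)).
    apply: le_Rintegral => //; first exact: integrable_norm.
    apply: (integrable_bounded (M := 1)) => //.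
      by have := ltry (y - x); rewrite -lexy.
    by move=> t _; rewrite normr1.
  rewrite Rintegral_cst// mul1r.
  by have := lexx (y - x); rewrite -[X in X <= _ -> _]/(fine (y - x)%:E) -lexy.
have mK : measurable_fun setT K.
  exact: continuous_measurable_fun (lipschitz1_continuous lK).
exists (fun h y => K (y + h) - K y); split.
- move=> h y h0; rewrite KB ?lerDl// -Rintegral_itv_bndo_bndc; last first.
    by apply: iqS; exact: measurable_itv.
  rewrite Rintegral_mkcond [RHS]Rintegral_mkcond; apply: eq_Rintegral => x _.
  rewrite /q /patch indicE.
  by case: (x \in `]y, y + h[%classic); case: (x \in D); rewrite ?mul1r ?mul0r.
- move=> h h0; apply: measurable_funB => //.
  by apply: measurableT_comp => //; exact: measurable_funD.
- move=> h y h0; have := lK y (y + h); rewrite lerDl => /(_ h0).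
  by rewrite (_ : y + h - y = h)//; ring.
- have := FTC1Ny iqy lq; apply: ae_mono => y [dK K'] yD.
  have -> : k y = derive1 K y by rewrite K' /q /patch mem_set.
  have hcvg : n.+1%:R^-1 @[n --> \oo] --> (0 : R)^'.
    move=> A /= A0; have := @cvg_harmonic R _ A0.
    apply: (@filterS _ \oo) => n /=; apply.
    by rewrite gt_eqF// invr_gt0.
  have := cvg_comp _ _ hcvg dK; rewrite derive1E.
  apply: cvg_trans; apply: near_eq_cvg; near=> n.
  by rewrite /= invrK /GRing.scale/= mulr1 mulrC (addrC _ y).
Unshelve. all: by end_near. Qed.

End averages.

Section past_average.
Context {R : realType} {V : normedModType R} (T : R).
Local Notation mR := (measurableTypeR R).
Local Notation leb := (@lebesgue_measure R).
Local Notation D := (`]0, T[%classic : set mR).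
Local Notation D2 := (D `*` D).
Local Notation leb2 := (leb \x leb)%E.
Local Notation sqi := (square_integrable leb D).
Context (om : R -> R) (g : mR -> dual V).
Hypothesis mom : measurable_fun (setT : set mR) om.
Hypothesis om1 : forall x, `|om x| <= 1.
Hypothesis sg : sqi g.
Implicit Types (w : mR -> V) (h : R).

Definition past_integrand h w (z : mR * mR) : R :=
  \1_(window h) z * (om z.1 * g z.2 (w z.1)).

(* Divided by [h], the average of [g s (w t)] over [t - h < s < t], which tends to
   [present_form] as [h] tends to 0. *)
Definition past_form h w : R := \int[leb2]_(z in D2) past_integrand h w z.

Definition present_form w : R := \int[leb]_(t in D) (om t * g t (w t)).

Definition sqnorm (E : normedModType R) (f : mR -> E) : R :=
  \int[leb]_(t in D) (`|f t| ^+ 2).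

Lemma sqnorm_ge0 (E : normedModType R) (f : mR -> E) : 0 <= sqnorm f.
Proof. by apply: Rintegral_ge0 => t _; rewrite exprn_ge0. Qed.

Lemma sqnormE (E : normedModType R) (f : mR -> E) : sqi f ->
  (\int[leb]_(t in D) (`|f t| ^+ 2)%:E = (sqnorm f)%:E)%E.
Proof. by move=> [_ sf]; rewrite -EFin_Rintegral//; exact: measurable_oo. Qed.

Lemma measurable_pair2_eval w : strongly_measurable w ->
  measurable_fun (setT : set (mR * mR))
    (fun z => g z.2 (w z.1)).
Proof.
move=> mw; have [mg _] := sg.
apply: (@measurable_fun_strong2 _ _ _ _ _ (fun (l : dual V) v => l v)
  (g \o snd) (w \o fst)).
- exact: dual_eval_seq_continuous2.
- by apply: strongly_measurable_comp => //; exact: measurable_snd.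
- by apply: strongly_measurable_comp => //; exact: measurable_fst.
Qed.

Lemma measurable_past_integrand h w : strongly_measurable w ->
  measurable_fun setT (past_integrand h w).
Proof.
move=> mw; apply: measurable_funM.
  by apply: measurable_indic; exact: measurable_window.
apply: measurable_funM; last exact: measurable_pair2_eval.
exact: (measurableT_comp mom measurable_fst).
Qed.

Lemma past_integrand_le h w e : 0 <= h -> 0 < e -> sqi w ->
  (\int[leb2]_(z in D2) `|past_integrand h w z|%:E <=
    (h * (e * sqnorm g + e^-1 * sqnorm w))%:E)%E.
Proof.
move=> h0 e0 sw; have [mw _] := sw; have [mg _] := sg.
rewrite EFinM EFinD !EFinM -!sqnormE//.
apply: le_trans (window_integral_le T h0 e0 (measurable_fun_strong_norm mg)
  (measurable_fun_strong_norm mw) (fun=> normr_ge0 _) (fun=> normr_ge0 _)).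
apply: ae_le_ge0_integral => [z _|z _|].
- by rewrite lee_fin.
- by rewrite lee_fin mulr_ge0 ?indicE// mulr_ge0.
apply: aeW => z _; rewrite lee_fin /past_integrand normrM.
rewrite ger0_norm ?indicE// ler_wpM2l//.
rewrite normrM -[leRHS]mul1r ler_pM//.
exact: dual_le_norm.
Qed.

Lemma integrable_past h w : 0 <= h -> sqi w ->
  leb2.-integrable D2 (EFin \o past_integrand h w).
Proof.
move=> h0 sw; have [mw _] := sw; apply/integrableP; split.
  apply/measurable_EFinP; apply: measurable_funTS.
  exact: measurable_past_integrand.
apply: le_lt_trans (ltry _); apply: (past_integrand_le h0 ltr01 sw).
Qed.

Lemma past_form_le h w e : 0 <= h -> 0 < e -> sqi w ->
  `|past_form h w| <= h * (e * sqnorm g + e^-1 * sqnorm w).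
Proof.
move=> h0 e0 sw; have iw := integrable_past h0 sw.
rewrite -lee_fin (le_trans _ (past_integrand_le h0 e0 sw))//.
rewrite EFin_normr_Rintegral//; last exact: measurable_oo2.
apply: le_abse_integral; first exact: measurable_oo2.
by case/integrableP: iw.
Qed.

Lemma past_formB h w1 w2 : 0 <= h -> sqi w1 -> sqi w2 ->
  past_form h (w1 - w2) = past_form h w1 - past_form h w2.
Proof.
move=> h0 sw1 sw2; rewrite -RintegralB//; first last.
- exact: integrable_past.
- exact: integrable_past.
- exact: measurable_oo2.
apply: eq_Rintegral => z _; rewrite /past_integrand -mulrBr -mulrBr -dualB.
by [].
Qed.

Lemma present_integrable w : sqi w ->
  leb.-integrable D (EFin \o (fun t => om t * g t (w t))).
Proof.
move=> sw; have [mw _] := sw; have [mg _] := sg.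
apply: (square_integrableM measurable_oo sg sw).
  apply: measurable_funM => //.
  apply: (@measurable_fun_strong2 _ _ _ _ _ (fun (l : dual V) v => l v) g w) => //.
  exact: dual_eval_seq_continuous2.
move=> t _; rewrite normrM -[leRHS]mul1r ler_pM//.
exact: dual_le_norm.
Qed.

Lemma present_form_le w e : 0 < e -> sqi w ->
  `|present_form w| <= e * sqnorm g + e^-1 * sqnorm w.
Proof.
move=> e0 sw; have iw := present_integrable sw.
have [mw iww] := sw; have [mg igg] := sg.
rewrite (le_trans (le_normr_Rintegral measurable_oo iw))//.
have e1 : sqnorm g * e = \int[leb]_(t in D) (`|g t| ^+ 2 * e).
  by rewrite RintegralZr//; exact: measurable_oo.
have e2 : sqnorm w * e^-1 = \int[leb]_(t in D) (`|w t| ^+ 2 * e^-1).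
  by rewrite RintegralZr//; exact: measurable_oo.
rewrite [e * _]mulrC [e^-1 * _]mulrC e1 e2.
have i1 := integrable_realZr e measurable_oo igg.
have i2 := integrable_realZr e^-1 measurable_oo iww.
rewrite -(RintegralD measurable_oo i1 i2).
apply: le_Rintegral.
- exact: measurable_oo.
- exact: integrable_norm.
- exact: (integrable_realD measurable_oo i1 i2).
move=> t _; have := @young_ineq R (`|g t|) (`|w t|) e e0.
rewrite ![_ * _ ^+ 2]mulrC; apply: le_trans.
apply: (@le_trans _ _ (`|g t| * `|w t|)).
  by rewrite normrM -[leRHS]mul1r ler_pM//; exact: dual_le_norm.
by rewrite mulr_natl mulr2n lerDl mulr_ge0.
Qed.

Lemma present_formB w1 w2 : sqi w1 -> sqi w2 ->
  present_form (w1 - w2) = present_form w1 - present_form w2.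
Proof.
move=> sw1 sw2.
rewrite -(RintegralB measurable_oo (present_integrable sw1) (present_integrable sw2)).
by apply: eq_Rintegral => z _; rewrite -mulrBr -dualB.
Qed.

Lemma square_integrable_indic (A : set mR) (v : V) : measurable A ->
  sqi (fun t => (\1_A t : R) *: v).
Proof.
move=> mA; split.
  by apply: strongly_measurableZ; [exact: measurable_indic|exact: strongly_measurable_cst].
apply: (integrable_bounded (M := `|v| ^+ 2)); first exact: measurable_oo.
- exact: lebesgue_itvoo_lty.
- apply: measurable_funX; apply: measurable_funTS.
  apply: measurable_fun_strong_norm.
  by apply: strongly_measurableZ; [exact: measurable_indic|exact: strongly_measurable_cst].
move=> t _; rewrite ger0_norm ?exprn_ge0// normrZ exprMn ler_piMl ?exprn_ge0//.
by rewrite exprn_ile1// indicE ger0_norm ?lern1 ?leq_b1.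
Qed.

(** For [w = 1_A v] Fubini moves the average from [g] to the bounded real function [om 1_A], now
    taken over the future window []s, s + h[]. There Lebesgue's theorem applies, with [|g s v|] as
    dominating function. *)
Lemma past_form_indic_cvg (A : set mR) (v : V) : measurable A ->
  past_form n.+1%:R^-1 (fun t => (\1_A t : R) *: v) * n.+1%:R @[n --> \oo] -->
  present_form (fun t => (\1_A t : R) *: v).
Proof.
move=> mA; have sA := square_integrable_indic v mA.
have n0 n : 0 <= n.+1%:R^-1 :> R by [].
pose k t := om t * \1_A t.
have mk : measurable_fun (setT : set mR) k.
  by apply: measurable_funM => //; exact: measurable_indic.
have k1 x : `|k x| <= 1.
  rewrite /k normrM -[leRHS]mulr1 ler_pM// indicE ger0_norm//.
  by rewrite lern1 leq_b1.
have [I [IE mI I1 Icvg]] := average_cvg T mk k1.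
have igv := square_integrable_dual_eval v sg.
have mgv : measurable_fun setT (fun t => g t v).
  by apply: measurable_dual_eval; case: sg.
have pE n : past_form n.+1%:R^-1 (fun t => (\1_A t : R) *: v) * n.+1%:R =
    \int[leb]_(y in D) (g y v * (I n.+1%:R^-1 y * n.+1%:R)).
  rewrite /past_form (product_Rintegral (integrable_past (n0 n) sA)).2.
  under [RHS]eq_Rintegral do rewrite mulrA.
  rewrite RintegralZr; last 2 first.
  - exact: measurable_oo.
  - apply: (integrable_le measurable_oo _ _
      (integrable_realZr n.+1%:R^-1 measurable_oo (integrable_norm igv))).
      by apply: measurable_funTS; apply: measurable_funM => //; exact: mI.
    by move=> y _; rewrite normrM ler_wpM2l// I1.
  congr (_ * _); apply: eq_Rintegral => y _.
  rewrite IE// -RintegralZl; last 2 first.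
  - exact: measurable_oo.
  - apply: (integrable_bounded (M := 1)); [exact: measurable_oo| | |].
    + exact: lebesgue_itvoo_lty.
    + by apply: measurable_funTS; apply: measurable_funM.
    + move=> x _; rewrite normrM -[leRHS]mulr1 ler_pM// indicE ger0_norm//.
      by rewrite lern1 leq_b1.
  apply: eq_Rintegral => x _.
  by rewrite /past_integrand /= window_indic1 dualZ /k; ring.
under eq_fun do rewrite pE.
have -> : present_form (fun t => (\1_A t : R) *: v) = \int[leb]_(y in D) (g y v * k y).
  by apply: eq_Rintegral => y _; rewrite dualZ /k; ring.
apply: (@Rintegral_dominated_cvg _ _ R leb D
  (fun n y => g y v * (I n.+1%:R^-1 y * n.+1%:R)) _ (fun y => `|g y v|)).
- exact: measurable_oo.
- move=> n; apply: measurable_funTS; apply: measurable_funM => //.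
  by apply: measurable_funM => //; exact: mI.
- by apply: measurable_funTS; apply: measurable_funM.
- by apply: ae_mono Icvg => y + yD => /(_ yD) Iy; exact: cvgMr.
- exact: integrable_norm.
- move=> n y _; rewrite normrM ler_piMr// normrM (ger0_norm (ler0n _ _)).
  by rewrite -ler_pdivlMr// div1r I1.
Qed.

Lemma past_form_cvgB w1 w2 : sqi w1 -> sqi w2 ->
  past_form n.+1%:R^-1 w1 * n.+1%:R @[n --> \oo] --> present_form w1 ->
  past_form n.+1%:R^-1 w2 * n.+1%:R @[n --> \oo] --> present_form w2 ->
  past_form n.+1%:R^-1 (w1 - w2) * n.+1%:R @[n --> \oo] --> present_form (w1 - w2).
Proof.
move=> sw1 sw2 c1 c2; rewrite present_formB//.
under eq_fun do rewrite past_formB// mulrBl.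
exact: cvgB.
Qed.

Lemma past_form_simple_cvg (s : simples mR V) :
  measurable_simple s -> sqi (simple_fun s) /\
  past_form n.+1%:R^-1 (simple_fun s) * n.+1%:R @[n --> \oo] -->
    present_form (simple_fun s).
Proof.
pose ind (A : set mR) (v : V) (t : mR) :=
  (\1_A t : R) *: v.
have ind0 : ind setT 0 = (fun=> 0) by apply/funext => t; rewrite /ind scaler0.
have s0 : sqi (ind setT 0) by apply: square_integrable_indic.
have c0 := @past_form_indic_cvg setT 0 measurableT.
elim: s => [_|p s ih /measurable_simple_cons[mp /ih[ss cs]]].
  have -> : simple_fun [::] = ind setT 0.
    by rewrite ind0; apply/funext => t; rewrite /simple_fun big_nil.
  by [].
(* The sum is written with subtractions only, so that [past_form_cvgB] covers it. *)
have -> : simple_fun (p :: s) = ind p.1 p.2 - (ind setT 0 - simple_fun s).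
  apply/funext => t; rewrite simple_fun_cons.
  have -> : (ind p.1 p.2 - (ind setT 0 - simple_fun s)) t =
    ind p.1 p.2 t - (ind setT 0 t - simple_fun s t) by [].
  by rewrite ind0 sub0r opprK.
have sp := square_integrable_indic p.2 mp.
have s1 := square_integrableB measurable_oo s0 ss.
split; first exact: (square_integrableB measurable_oo sp s1).
apply: (past_form_cvgB sp s1); first exact: past_form_indic_cvg.
exact: (past_form_cvgB s0 ss).
Qed.

Lemma simple_L2_cvg w : sqi w -> exists s : nat -> simples mR V,
  (forall n, measurable_simple (s n)) /\
  sqnorm (w - simple_fun (s n)) @[n --> \oo] --> 0.
Proof.
move=> sw; have [mw iw] := sw.
have [s [ms sw_cvg sle]] := strongly_measurable_approx mw.
exists s; split => //.
have mws n : measurable_fun D (fun t => `|(w - simple_fun (s n)) t| ^+ 2).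
  apply: measurable_funX; apply: measurable_funTS.
  apply: measurable_fun_strong_norm; apply: strongly_measurableB => //.
  exact: simple_strongly_measurable.
have i1 : leb.-integrable D (EFin \o (fun=> 2 : R)).
  apply: (integrable_bounded (M := 2)); [exact: measurable_oo| | |].
  - exact: lebesgue_itvoo_lty.
  - exact: measurable_cst.
  - by move=> t _; rewrite ger0_norm.
(* The norm of [w - s_n] is at most [2 |w| + 1], whose square is at most [8 |w|^2 + 2]. *)
have id := integrable_realD measurable_oo
  (integrable_realZl 8 measurable_oo iw) i1.
have := @Rintegral_dominated_cvg _ _ R leb D
  (fun n t => `|(w - simple_fun (s n)) t| ^+ 2) (fun=> 0) _ measurable_oo
  mws (measurable_cst _) _ id.
rewrite (_ : \int[leb]_(x in D) 0 = 0); last first.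
  by rewrite Rintegral_cst ?mul0r//; exact: measurable_oo.
apply.
- apply: aeW => t _; have -> : 0 = `|w t - w t| ^+ 2 by rewrite subrr normr0 expr0n.
  apply: (@cvg_comp _ _ _ _ (fun y : R => y ^+ 2) _ _ _ _ (@exprn_continuous _ 2 _)).
  by apply: cvg_norm; apply: cvgB => //; exact: cvg_cst.
- move=> n t _; rewrite ger0_norm ?exprn_ge0//.
  have h : `|(w - simple_fun (s n)) t| <= 2 * `|w t| + 1.
    by rewrite (le_trans (ler_normB _ _))//; have := sle n t; lra.
  apply: (@le_trans _ _ ((2 * `|w t| + 1) ^+ 2)).
    by rewrite lerXn2r ?nnegrE// addr_ge0// mulr_ge0.
  have := sqr_ge0 (2 * `|w t| - 1); rewrite !sqrrD sqrrN !exprMn; lra.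
Qed.

(** By [past_form_le] the quotients are bounded uniformly in [h], so the convergence known for
    simple functions passes to their [L2] limits. *)
Lemma past_form_cvg w : sqi w ->
  past_form n.+1%:R^-1 w * n.+1%:R @[n --> \oo] --> present_form w.
Proof.
move=> sw; have [s [ms scvg]] := simple_L2_cvg sw.
apply/cvgrPdist_le => e e0.
pose G := sqnorm g; have G0 : 0 <= G := sqnorm_ge0 g.
(* This Young parameter makes the contribution of [g] at most [e / 8]; [w] is then approximated so
   closely that the other contribution, divided by [e1], is at most [e / 8] too. The 1 guards
   against [G = 0]. *)
pose e1 := e / (8 * (G + 1)).
have e10 : 0 < e1 by rewrite divr_gt0// mulr_gt0//; lra.
have e1G : e1 * G <= e / 8.
  by rewrite /e1 -mulrA (ler_pM2l e0) mulrC ler_pdivrMr ?mulr_gt0//; lra.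
have [m sm] : exists m, sqnorm (w - simple_fun (s m)) <= e1 * (e / 8).
  have : \forall m \near \oo, sqnorm (w - simple_fun (s m)) <= e1 * (e / 8).
    by apply: (cvgr_le 0 scvg); rewrite mulr_gt0// divr_gt0.
  by move=> [m _ hm]; exists m; apply: hm => /=.
have [ss cs] := past_form_simple_cvg (ms m).
have sd := square_integrableB measurable_oo sw ss.
have e1N : e1^-1 * sqnorm (w - simple_fun (s m)) <= e / 8.
  by rewrite mulrC ler_pdivrMr// mulrC.
have b1 n : `|past_form n.+1%:R^-1 (w - simple_fun (s m)) * n.+1%:R| <= e / 4.
  have n0 : 0 < n.+1%:R^-1 :> R by rewrite invr_gt0.
  rewrite normrM (ger0_norm (ler0n _ _)) -ler_pdivlMr//.
  rewrite (le_trans (past_form_le (ltW n0) e10 sd))// mulrC ler_wpM2r//.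
  by rewrite -/G; lra.
have b2 : `|present_form (w - simple_fun (s m))| <= e / 4.
  by rewrite (le_trans (present_form_le e10 sd))// -/G; lra.
have : \forall n \near \oo,
    `|present_form (simple_fun (s m)) - past_form n.+1%:R^-1 (simple_fun (s m)) * n.+1%:R|
      <= e / 2.
  by move/cvgrPdist_le: cs; apply; rewrite divr_gt0.
apply: filterS => n b3.
have -> : present_form w - past_form n.+1%:R^-1 w * n.+1%:R =
  present_form (w - simple_fun (s m)) +
  (present_form (simple_fun (s m)) - past_form n.+1%:R^-1 (simple_fun (s m)) * n.+1%:R) -
  past_form n.+1%:R^-1 (w - simple_fun (s m)) * n.+1%:R.
  by rewrite present_formB// past_formB//; ring.
rewrite (le_trans (ler_normB _ _))//.
have := ler_normD (present_form (w - simple_fun (s m)))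
  (present_form (simple_fun (s m)) - past_form n.+1%:R^-1 (simple_fun (s m)) * n.+1%:R).
have := b1 n; lra.
Qed.

End past_average.

Lemma product_Rintegral_integrable (R : realType) (T : R)
    (F : measurableTypeR R * measurableTypeR R -> R) :
  let leb := @lebesgue_measure R in
  let D := (`]0, T[%classic : set (measurableTypeR R)) in
  (leb \x leb)%E.-integrable (D `*` D) (EFin \o F) ->
  leb.-integrable D (EFin \o (fun x => \int[leb]_(y in D) F (x, y))).
Proof.
move=> leb D iF.
pose G := (EFin \o F) \_ (D `*` D).
have iG : (leb \x leb)%E.-integrable setT G.
  by apply/integrable_restrict; [exact: measurable_oo2|exact: measurableT|rewrite setTI].
have iFG := integrable_fubini_F iG.
have mFG : measurable_fun setT (fubini_F leb G) by case/integrableP: iFG.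
have E x : x \in D -> \int[leb]_(y in D) F (x, y) = fine (fubini_F leb G x).
  move=> xD; rewrite /Rintegral /fubini_F; congr fine.
  rewrite integral_mkcond; apply: eq_integral => y _.
  by rewrite /G /patch in_setX xD.
have iFGD : leb.-integrable D (fubini_F leb G).
  by apply: (integrableS _ _ _ iFG) => //; exact: measurable_oo.
apply: (le_integrable measurable_oo _ _ iFGD).
  apply/measurable_EFinP.
  apply: (eq_measurable_fun (fine \o fubini_F leb G)).
    by move=> x xD; rewrite E.
  by apply: measurable_funTS; apply: measurableT_comp.
move=> x Dx; rewrite /= E ?mem_set//.
by case: (fubini_F leb G x) => [r||] //=; rewrite ?normr0 ?leey.
Qed.

Lemma ae_le_Rintegral d (X : measurableType d) (R : realType)
    (mu : {measure set X -> \bar R}) (D : set X) (f g : X -> R) : measurable D ->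
  mu.-integrable D (EFin \o f) -> mu.-integrable D (EFin \o g) ->
  (\forall x \ae mu, D x -> f x <= g x) ->
  \int[mu]_(x in D) f x <= \int[mu]_(x in D) g x.
Proof.
move=> mD If Ig fg; rewrite -subr_ge0 -RintegralB//.
rewrite (ae_eq_Rintegral (g := fun x => `|g x - f x|)); last first.
  by apply: ae_mono fg => x + Dx => /(_ Dx) fgx; rewrite ger0_norm ?subr_ge0.
by apply: Rintegral_ge0.
Qed.

Section energy.
Context {R : realType} {V H : hilbertType R} (iota : {linear V -> H}) (T : R).
Local Notation mR := (measurableTypeR R).
Local Notation leb := (@lebesgue_measure R).
Local Notation D := (`]0, T[%classic : set mR).
Local Notation sqi := (square_integrable leb D).
Context (c : R -> H) (w : mR -> V) (g : mR -> dual V).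
Hypothesis sw : sqi w.
Hypothesis sg : sqi g.
Hypothesis cc : {within `[0, T], continuous c}.
Hypothesis cw : \forall t \ae leb, D t -> c t = iota (w t).
Hypothesis c0 : c 0 = 0.
Hypothesis cg : forall z a b, 0 <= a -> a <= b -> b <= T ->
  inner (c b) (iota z) - inner (c a) (iota z) = \int[leb]_(t in `]a, b[) g t z.

(** The extension by 0 to negative times is consistent with [c 0 = 0], so a step back from [t] to
    [t - h] may leave the interval. *)
Let N : mR -> R := (fun x => `|c x| ^+ 2) \_ D.

Let N_ge0 x : 0 <= N x.
Proof. by rewrite /N /patch; case: ifP => // _; rewrite sqr_ge0. Qed.

Let cc2 : {within `[0, T], continuous (fun x => `|c x| ^+ 2)}.
Proof.
move=> x; apply: (@continuous_comp _ _ _ (fun x : subspace `[0, T] => `|c x|)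
  (fun y : R => y ^+ 2)); last exact: exprn_continuous.
by apply: cvg_norm; exact: cc.
Qed.

Let measurable_N : measurable_fun setT N.
Proof.
apply/measurable_restrict; [exact: measurable_oo|exact: measurableT|].
rewrite setTI; apply: (@measurable_funS _ _ _ _ `[0, T]%classic) => //.
  exact: subset_itv_oo_cc.
by apply: subspace_continuous_measurable_fun.
Qed.

Let N_bounded : exists M, forall x, N x <= M.
Proof.
have : compact [set `|c x| ^+ 2 | x in `[0, T]].
  by apply: continuous_compact => //; exact: segment_compact.
move=> /compact_bounded[M [_ kM]]; exists (`|M| + 1) => x.
rewrite /N /patch; case: ifPn => [/set_mem xD|_]; last by rewrite addr_ge0.
rewrite (le_trans (ler_norm _))// (kM (`|M| + 1))//.
  by rewrite (le_lt_trans (ler_norm _))// ltrDl.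
by exists x => //; exact: (subset_itv_oo_cc xD).
Qed.

Let integrableN (k : R -> R) h : measurable_fun (setT : set mR) k ->
  (forall x, `|k x| <= 1) ->
  leb.-integrable D (EFin \o (fun x => k x * N (x - h))).
Proof.
move=> mk k1; have [M NM] := N_bounded.
apply: (integrable_bounded (M := M)); first exact: measurable_oo.
- exact: lebesgue_itvoo_lty.
- apply: measurable_funTS; apply: measurable_funM => //.
  by apply: measurableT_comp => //; exact: measurable_funB.
move=> x _; rewrite normrM -[leRHS]mul1r ler_pM//.
by rewrite ger0_norm ?N_ge0.
Qed.

Section weight.
Context (om : R -> R).
Hypothesis mom : measurable_fun (setT : set mR) om.
Hypothesis om0 : forall x, 0 <= om x.
Hypothesis om1 : forall x, om x <= 1.

Let om_norm x : `|om x| <= 1.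
Proof. by rewrite ger0_norm. Qed.

Lemma past_form_ge h : 0 < h ->
  \int[leb]_(t in D) (om t * N t) - \int[leb]_(t in D) (om t * N (t - h)) <=
    2 * past_form T om g h w.
Proof.
move=> h0.
have ip := integrable_past mom om_norm sg (ltW h0) sw.
have i1 := integrable_realZl 2 measurable_oo (product_Rintegral_integrable ip).
have iN h' := integrableN h' mom om_norm.
have i2 := iN 0; have e2 : (fun x => om x * N (x - 0)) = (fun x => om x * N x).
  by apply/funext => x; rewrite subr0.
rewrite e2 in i2.
rewrite /past_form (product_Rintegral ip).1 -RintegralZl; last 2 first.
- exact: measurable_oo.
- exact: product_Rintegral_integrable.
rewrite -(RintegralB measurable_oo i2 (iN h)).
apply: (ae_le_Rintegral measurable_oo
  (integrable_realB measurable_oo i2 (iN h)) i1).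
apply: ae_mono cw => r crw rD; move: (rD); rewrite /= in_itv/= => /andP[r0 rT].
have -> : \int[leb]_(y in D) past_integrand om g h w (r, y) =
    om r * \int[leb]_(y in D) (\1_(`]r - h, r[%classic) y * g y (w r)).
  rewrite -RintegralZl; first by apply: eq_Rintegral => y _;
    rewrite /past_integrand /= window_indic2 mulrCA.
    exact: measurable_oo.
  have [mg _] := sg.
  have igv := square_integrable_dual_eval (w r) sg.
  apply: (integrable_le measurable_oo _ _ (integrable_norm igv)).
    apply: measurable_funTS; apply: measurable_funM.
      by apply: measurable_indic; exact: measurable_oo.
    exact: measurable_dual_eval.
  by move=> y _; rewrite normrM ler_piMl// indicE ger0_norm// lern1 leq_b1.
rewrite mulrCA -mulrBr ler_wpM2l//.
(* The start of the window, cut off at time 0. Since [c] vanishes there, [N (r - h)] is [|c r'|^2]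
   also when [r <= h]. *)
pose r' := Num.max (r - h) 0.
have Nr' : N (r - h) = `|c r'| ^+ 2.
  rewrite /N /patch; case: ifPn => [/set_mem/=|].
    by rewrite in_itv/= /r' => /andP[rh _]; rewrite (max_idPl (ltW rh)).
  rewrite notin_setE/= in_itv/= => /negP; rewrite negb_and -!leNgt.
  move=> /orP[rh|]; last by lra.
  by rewrite /r' (max_idPr rh) c0 normr0 expr0n.
have -> : N r = `|c r| ^+ 2 by rewrite /N /patch mem_set.
have -> : \int[leb]_(y in D) (\1_(`]r - h, r[%classic) y * g y (w r)) =
    inner (c r) (c r) - inner (c r') (c r).
  rewrite {2 3}(crw rD) cg; last 3 first.
  - by rewrite /r' le_max lexx orbT.
  - by rewrite /r' ge_max; apply/andP; split; lra.
  - exact: ltW.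
  rewrite Rintegral_mkcond [RHS]Rintegral_mkcond; apply: eq_Rintegral => y _.
  rewrite /patch indicE !mem_setE !in_itv/= /r' gt_max.
  have [y0|y0] := ltP 0 y; last by rewrite andbF.
  have [yr|yr] := ltP y r; last by rewrite !andbF mul0r; case: ifP.
  by rewrite (lt_trans yr rT) !andbT/=; case: ifP; rewrite ?mul1r ?mul0r.
rewrite Nr'.
have := inner_norm (c r - c r'); rewrite innerBl !innerBr !inner_norm (innerC (c r) (c r')).
by have := sqr_ge0 (`|c r - c r'|); lra.
Qed.

(** Summation by parts: a translation by [h] moves the difference from [N] to the weight. It is an
    inequality because []0, T[] is enlarged to the whole line before translating, which adds
    nonnegative mass. *)
Lemma past_form_shift h : 0 < h ->
  \int[leb]_(t in D) ((om t - om (t + h)) * N t) <= 2 * past_form T om g h w.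
Proof.
move=> h0; apply: le_trans (past_form_ge h0).
have mh : measurable_fun (setT : set mR) (fun x => om (x + h)).
  by apply: (measurableT_comp mom); exact: measurable_funD.
have e2 (k : R -> R) : (fun x => k x * N (x - 0)) = (fun x => k x * N x).
  by apply/funext => x; rewrite subr0.
have i1 := integrableN 0 mom om_norm; rewrite e2 in i1.
have i2 := @integrableN (fun x => om (x + h)) 0 mh (fun x => om_norm (x + h)).
rewrite e2 in i2.
under eq_Rintegral do rewrite mulrBl.
rewrite (RintegralB measurable_oo i1 i2) lerD2l lerN2.
rewrite -lee_fin !EFin_Rintegral//; [|exact: measurable_oo..|exact: integrableN].
pose F x := ((om (x + h) * N x)%:E)%E.
have F0 x : (0 <= F x)%E by rewrite lee_fin mulr_ge0 ?N_ge0.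
have mF : measurable_fun (setT : set mR) F.
  by apply/measurable_EFinP; apply: measurable_funM.
apply: (@le_trans _ _ (\int[leb]_(x in (setT : set mR)) F (x - h)%R)%E).
  rewrite integral_mkcond; apply: ge0_le_integral => //.
  - by move=> x _; rewrite /patch; case: ifP => // _; rewrite lee_fin mulr_ge0 ?N_ge0.
  - apply/(measurable_restrictT _ _).1; first exact: measurable_oo.
    by case/integrableP: (integrableN h mom om_norm).
  - by apply: (measurableT_comp mF); exact: measurable_funB.
  - move=> x _; rewrite /patch /F subrK; case: ifP => // _.
    by rewrite lee_fin mulr_ge0 ?N_ge0.
rewrite ge0_integral_translation// [leRHS]integral_mkcond.
apply: ge0_le_integral => //.
  by apply/(measurable_restrictT _ _).1; [exact: measurable_oo|exact: measurable_funTS].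
move=> x _; rewrite /patch /F; case: ifPn => // xD.
by rewrite /N /patch (negbTE xD) mulr0.
Qed.

Lemma present_form_ge0 : {homo om : x y /~ x <= y} -> 0 <= present_form T om g w.
Proof.
move=> omd; have pc := past_form_cvg mom om_norm sg sw.
rewrite -(cvg_lim (@Rhausdorff R) pc); apply: limr_ge; first by apply/cvg_ex; eexists; exact: pc.
apply: nearW => n; rewrite mulr_ge0// -(@pmulr_rge0 _ 2)//.
apply: le_trans (past_form_shift _); last by rewrite invr_gt0.
apply: Rintegral_ge0 => x _; rewrite mulr_ge0 ?N_ge0// subr_ge0 omd//.
by rewrite lerDl invr_ge0.
Qed.

End weight.

(* For the weight [1_(s < t)] the left-hand side of [past_form_shift] is the integral
   of [`|c s| ^+ 2] over [t - h <= s < t]. *)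
Lemma sup_energy_le t : 0 <= t <= T -> `|c t| ^+ 2 <= 2 * (sqnorm T g + sqnorm T w).
Proof.
move=> /andP[t0 tT]; set K := 2 * _.
have K0 : 0 <= K by rewrite mulr_ge0// addr_ge0// sqnorm_ge0.
have [->|tn0] := eqVneq t 0; first by rewrite c0 normr0 expr0n.
have {}t0 : 0 < t by rewrite lt_def tn0.
rewrite leNgt; apply/negP => Kt.
(* If [|c t|^2] exceeded [K], continuity would keep [|c|^2] above the midpoint [K'] on some [[t - h,
   t[] and the averaged energy would be at least [K' h]. But [past_form_le] with [e = 1] bounds it
   by [K h]. *)
pose K' := (K + `|c t| ^+ 2) / 2.
have KK' : K < K' by rewrite /K'; lra.
have K't : K' < `|c t| ^+ 2 by rewrite /K'; lra.
have [h [h0 ht hK]] : exists h, [/\ 0 < h, h < t &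
    forall x, t - h <= x < t -> K' <= `|c x| ^+ 2].
  have tI : `[0, T]%classic t by rewrite /= in_itv/= (ltW t0).
  have /cvgrPdist_lt/(_ (`|c t| ^+ 2 - K')) := (subspace_continuousP _ _).1 cc2 _ tI.
  rewrite subr_gt0 => /(_ K't).
  rewrite near_withinE => -[e /= e0 te].
  exists (Num.min (e / 2) (t / 2)); rewrite lt_min gt_min !divr_gt0//=.
  split => //; first by apply/orP; right; lra.
  move=> x /andP[xl xt].
  have m1 : Num.min (e / 2) (t / 2) <= e / 2 by rewrite ge_min lexx.
  have m2 : Num.min (e / 2) (t / 2) <= t / 2 by rewrite ge_min lexx orbT.
  have /te : ball t e x by rewrite /ball/= ger0_norm; lra.
  have xI : `[0, T]%classic x by rewrite /= in_itv/=; apply/andP; split; lra.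
  by move=> /(_ xI) h; have := ler_norm (`|c t| ^+ 2 - `|c x| ^+ 2); lra.
pose om : R -> R := \1_(`]-oo, t[%classic).
have mom : measurable_fun (setT : set mR) om.
  by apply: measurable_indic; exact: measurable_itv.
have omE (x : R) : om x = (x < t)%R%:R by rewrite /om indicE mem_setE in_itv.
have om0 x : 0 <= om x by rewrite omE.
have om1 x : om x <= 1 by rewrite omE lern1 leq_b1.
have omn x : `|om x| <= 1 by rewrite ger0_norm.
have := past_form_shift mom om0 om1 h0.
have := past_form_le mom omn sg (ltW h0) ltr01 sw.
rewrite invr1 !mul1r => pl; have := ler_norm (past_form T om g h w).
set A := past_form _ _ _ _ _; move=> An.
suff : K' * h <= \int[leb]_(x in D) ((om x - om (x + h)) * N x).
  move=> h1 h2; rewrite -/A in h2.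
  have : K * h < K' * h by rewrite ltr_pM2r.
  by move: pl h1 h2 An; rewrite -/A /K; move: (K') => k; lra.
pose S := (`[t - h, t[%classic : set mR).
have mS : measurable S by exact: measurable_itv.
pose k x := om x - om (x + h).
have kE (x : R) : k x = (\1_S x : R).
  rewrite /k !omE indicE mem_setE in_itv/= lerBlDr.
  have [a|a] := ltP x t; have [b|b] := ltP (x + h) t; rewrite ?subrr ?subr0//=.
  by move: b; rewrite ltNge (le_trans a)// lerDl ltW.
have mk : measurable_fun (setT : set mR) k.
  by rewrite (_ : k = \1_S); [exact: measurable_indic|exact/funext/kE].
have k1 x : `|k x| <= 1 by rewrite kE indicE ger0_norm// lern1 leq_b1.
have ik := integrableN 0 mk k1.
have iS : leb.-integrable D (EFin \o (fun x => K' * (\1_S x : R))).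
  apply: (integrable_bounded (M := `|K'|)); [exact: measurable_oo| | |].
  - exact: lebesgue_itvoo_lty.
  - by apply: measurable_funTS; apply: measurable_funM => //; exact: measurable_indic.
  - by move=> x _; rewrite normrM -[leRHS]mulr1 ler_wpM2l// -kE.
have SD : S `<=` D.
  move=> x; rewrite /S/= !in_itv/= => /andP[a b].
  by rewrite (lt_le_trans b tT) (lt_le_trans _ a)// subr_gt0.
have -> : K' * h = \int[leb]_(x in D) (K' * (\1_S x : R)).
  rewrite (_ : (fun x => K' * _) = ((cst K') \_ S)); last first.
    apply/funext => x; rewrite /patch indicE; case: ifP; rewrite ?mulr1 ?mulr0//.
  rewrite -Rintegral_mkcondr setIidr// Rintegral_cst//.
  congr (_ * _); have : leb S = h%:E; last by rewrite /S => e; rewrite [X in fine X]e.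
  have := @lebesgue_measure_itv R `[t - h, t[; rewrite /= lte_fin ltrBlDr ltrDl h0.
  by move=> ->; rewrite -EFinD; congr EFin; ring.
have e0 : (fun x => k x * N (x - 0)) = (fun x => k x * N x).
  by apply/funext => x; rewrite subr0.
rewrite e0 in ik; apply: (le_Rintegral measurable_oo iS ik) => x xD.
rewrite kE mulrC; have [xS|xS] := pselect (S x); last first.
  by rewrite indicE memNset// !mul0r.
rewrite ler_wpM2l ?indicE// /N /patch mem_set//.
by apply: hK; move: xS; rewrite /S/= in_itv.
Qed.

End energy.

(** * Signed kernels *)

Section charge_integral.
Context d (X : measurableType d) (R : realType).
Implicit Types (s : {charge set X -> \bar R}) (m : {measure set X -> \bar R}).
Implicit Types (D : set X) (phi : X -> R).
Local Open Scope ereal_scope.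

Lemma pos_part_ltyT s : pos_part s setT < +oo.
Proof. by rewrite ltey_eq fin_num_measure. Qed.

Lemma neg_part_ltyT s : neg_part s setT < +oo.
Proof. by rewrite ltey_eq fin_num_measure. Qed.

Lemma tvarE s A : tvar s A = pos_part s A + neg_part s A.
Proof. by []. Qed.

Lemma tvar_ltyT s : tvar s setT < +oo.
Proof. by rewrite tvarE lte_add_pinfty// ?pos_part_ltyT// neg_part_ltyT. Qed.

Lemma measure_le_lty m D : m setT < +oo -> measurable D -> m D < +oo.
Proof. by move=> mfin mD; apply: le_lt_trans mfin; apply: le_measure; rewrite ?inE. Qed.

Lemma charge_posneg s A : measurable A -> s A = pos_part s A - neg_part s A.
Proof. by move=> mA; rewrite (jordan_decomp (hahn_posneg s) mA) /cadd/= cscaleN1. Qed.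

Lemma pos_partE s A : measurable A -> pos_part s A = s (A `&` hahn_pos s).
Proof.
by move=> mA; have := jordan_posE (hahn_posneg s) A; rewrite cjordan_posE /crestr0 mem_set.
Qed.

Lemma neg_partE s A : measurable A -> neg_part s A = - s (A `&` hahn_neg s).
Proof.
by move=> mA; have := jordan_negE (hahn_posneg s) A; rewrite cjordan_negE /crestr0 mem_set.
Qed.

(** On the two Hahn sets the variation is [s] and [- s] respectively, so the bound applies to each
    half of [A]. All triangle inequalities for variations follow from this minimality. *)
Lemma tvar_minimal s m : (forall A, measurable A -> `|s A| <= m A) ->
  forall A, measurable A -> tvar s A <= m A.
Proof.
move=> sm A mA; have [[mP _] [mN _] PN PN0] := hahn_posneg s.
rewrite tvarE pos_partE// neg_partE//.
apply: (@le_trans _ _ (m (A `&` hahn_pos s) + m (A `&` hahn_neg s))).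
  apply: leeD.
    by apply: le_trans (sm _ _); [exact: lee_abs|exact: measurableI].
  by apply: le_trans (sm _ _); [rewrite -abseN; exact: lee_abs|exact: measurableI].
rewrite -measureU.
- by rewrite -setIUr PN setIT.
- exact: measurableI.
- exact: measurableI.
- by rewrite setIACA PN0 setI0.
Qed.

Lemma tvar_csub s1 s2 A : measurable A -> tvar (csub s1 s2) A <= tvar s1 A + tvar s2 A.
Proof.
move=> mA; rewrite -(measure_addE (tvar s1) (tvar s2)).
apply: (@tvar_minimal _ (measure_add (tvar s1) (tvar s2)) _ A mA) => {mA}A mA.
rewrite [leRHS](measure_addE (tvar s1) (tvar s2) A) /csub /cadd/= (le_trans (lee_abs_add _ _))//.
by apply: leeD; rewrite ?abseN; exact: abse_charge_variation.
Qed.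

Lemma tvar_le_csub s1 s2 A : measurable A -> tvar s1 A <= tvar s2 A + tvar (csub s1 s2) A.
Proof.
move=> mA; rewrite -(measure_addE (tvar s2) (tvar (csub s1 s2))).
apply: (@tvar_minimal _ (measure_add (tvar s2) (tvar (csub s1 s2))) _ A mA) => {mA}A mA.
rewrite [leRHS](measure_addE (tvar s2) (tvar (csub s1 s2)) A).
have -> : s1 A = s2 A + csub s1 s2 A.
  rewrite /csub /cadd/= /copp addeCA subee ?adde0//.
  exact: fin_num_measure.
rewrite (le_trans (lee_abs_add _ _))//.
by apply: leeD; exact: abse_charge_variation.
Qed.

Lemma ge0_integral_tvar s D (f : X -> \bar R) : measurable D -> measurable_fun D f ->
  (forall x, D x -> 0 <= f x) ->
  \int[tvar s]_(x in D) f x = \int[pos_part s]_(x in D) f x + \int[neg_part s]_(x in D) f x.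
Proof.
move=> mD mf f0; rewrite -ge0_integral_measure_add//.
by apply: eq_measure_integral => A mA _; exact/esym/(measure_addE (pos_part s) (neg_part s)).
Qed.

Lemma integrable_tvar s D phi : measurable D ->
  (tvar s).-integrable D (EFin \o phi) ->
  (pos_part s).-integrable D (EFin \o phi) /\ (neg_part s).-integrable D (EFin \o phi).
Proof.
move=> mD /integrableP[mphi]; rewrite ge0_integral_tvar//; last exact: measurableT_comp.
move=> iphi; split; apply/integrableP; split => //; apply: le_lt_trans iphi.
  by rewrite leeDl// integral_ge0.
by rewrite leeDr// integral_ge0.
Qed.

Lemma ge0_le_measure_integral_in m1 m2 D (f : X -> \bar R) :
  (forall A, measurable A -> m1 A <= m2 A) -> measurable D -> measurable_fun D f ->
  (forall x, D x -> 0 <= f x) -> \int[m1]_(x in D) f x <= \int[m2]_(x in D) f x.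
Proof.
move=> m12 mD mf f0; rewrite integral_mkcond [leRHS]integral_mkcond.
apply: ge0_le_measure_integral => //; last exact/(measurable_restrictT _ mD).
by move=> x; apply: erestrict_ge0.
Qed.

Definition charge_integral s D phi : R :=
  (\int[pos_part s]_(x in D) phi x - \int[neg_part s]_(x in D) phi x)%R.

Lemma charge_integral_le s D phi : measurable D ->
  (tvar s).-integrable D (EFin \o phi) ->
  (`|charge_integral s D phi| <= \int[tvar s]_(x in D) `|phi x|)%R.
Proof.
move=> mD iphi; have [ip iN] := integrable_tvar mD iphi.
have -> : (\int[tvar s]_(x in D) `|phi x| =
    \int[pos_part s]_(x in D) `|phi x| + \int[neg_part s]_(x in D) `|phi x|)%R.
  apply: EFin_inj; rewrite EFinD !EFin_Rintegral//; [|exact: integrable_norm..].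
  rewrite ge0_integral_tvar//; case/integrableP: (integrable_norm iphi) => //.
by rewrite (le_trans (ler_normB _ _))// lerD// le_normr_Rintegral.
Qed.

Lemma charge_integralB s D phi psi : measurable D ->
  (tvar s).-integrable D (EFin \o phi) -> (tvar s).-integrable D (EFin \o psi) ->
  charge_integral s D (fun x => phi x - psi x)%R =
  (charge_integral s D phi - charge_integral s D psi)%R.
Proof.
move=> mD /(integrable_tvar mD)[p1 n1] /(integrable_tvar mD)[p2 n2].
by rewrite /charge_integral !RintegralB//; ring.
Qed.

Lemma integrable_csub s1 s2 D phi : measurable D ->
  (tvar s1).-integrable D (EFin \o phi) -> (tvar s2).-integrable D (EFin \o phi) ->
  (tvar (csub s1 s2)).-integrable D (EFin \o phi).
Proof.
move=> mD /integrableP[mphi i1] /integrableP[_ i2]; apply/integrableP; split => //.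
apply: (@le_lt_trans _ _ (\int[measure_add (tvar s1) (tvar s2)]_(x in D) `|(EFin \o phi) x|)).
  apply: ge0_le_measure_integral_in => //; last exact: measurableT_comp.
  by move=> A mA; rewrite [leRHS](measure_addE (tvar s1) (tvar s2) A) tvar_csub.
by rewrite ge0_integral_measure_add//; [rewrite lte_add_pinfty|exact: measurableT_comp].
Qed.

(** Jordan parts are not additive: those of [s1 - s2] are not differences of the parts of [s1] and
    [s2]. With the negative terms moved across, however, [p1 + n2 + n3] and [n1 + p2 + p3] are equal
    as measures, and their integrals are compared. *)
Lemma charge_integral_csub s1 s2 D phi : measurable D ->
  (tvar s1).-integrable D (EFin \o phi) -> (tvar s2).-integrable D (EFin \o phi) ->
  (charge_integral s1 D phi - charge_integral s2 D phi =
  charge_integral (csub s1 s2) D phi)%R.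
Proof.
move=> mD i1 i2; have [p3 n3] := integrable_tvar mD (integrable_csub mD i1 i2).
have [p1 n1] := integrable_tvar mD i1; have [p2 n2] := integrable_tvar mD i2.
pose ma := @measure_add _ X R.
have add3 (m1 m2 m3 : {measure set X -> \bar R}) : m1.-integrable D (EFin \o phi) ->
    m2.-integrable D (EFin \o phi) -> m3.-integrable D (EFin \o phi) ->
    \int[ma (ma m1 m2) m3]_(x in D) (phi x)%:E = (\int[m1]_(x in D) phi x +
      \int[m2]_(x in D) phi x + \int[m3]_(x in D) phi x)%R%:E.
  move=> j1 j2 j3; have [mphi _] := integrableP _ _ _ j1.
  rewrite !EFinD !EFin_Rintegral// !integral_measure_add//.
  apply/integrableP; split => //; rewrite ge0_integral_measure_add//; last exact: measurableT_comp.
  by case/integrableP: j1 => _ k1; case/integrableP: j2 => _ k2; rewrite lte_add_pinfty.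
have : \int[ma (ma (pos_part s1) (neg_part s2)) (neg_part (csub s1 s2))]_(x in D) (phi x)%:E =
    \int[ma (ma (neg_part s1) (pos_part s2)) (pos_part (csub s1 s2))]_(x in D) (phi x)%:E.
  apply: eq_measure_integral => A mA _; rewrite /ma.
  have maE (m1 m2 m3 : {measure set X -> \bar R}) :
    measure_add (measure_add m1 m2) m3 A = m1 A + m2 A + m3 A.
    rewrite [LHS](measure_addE (measure_add m1 m2) m3); congr (_ + _).
    exact: (measure_addE m1 m2).
  rewrite [LHS]maE [RHS]maE.
  have csubE : csub s1 s2 A = s1 A - s2 A by [].
  have := charge_posneg (csub s1 s2) mA; rewrite csubE.
  rewrite (charge_posneg s1 mA) (charge_posneg s2 mA).
  have f s : pos_part s A \is a fin_num by exact: fin_num_measure.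
  have g s : neg_part s A \is a fin_num by exact: fin_num_measure.
  rewrite -(fineK (f s1)) -(fineK (f s2)) -(fineK (f (csub s1 s2))).
  rewrite -(fineK (g s1)) -(fineK (g s2)) -(fineK (g (csub s1 s2))).
  by rewrite -!EFinB -!EFinD => -[e]; congr EFin; lra.
rewrite !add3// => -[]; rewrite /charge_integral; lra.
Qed.

End charge_integral.

(** The best choice is [e = sqrt Q / sqrt P]. Adding [d > 0] to both roots keeps the quotient
    meaningful when one of them vanishes, at the cost of an error [d (a + b)] that is arbitrarily
    small. *)
Lemma le_sqrt_young (R : realType) (y P Q : R) : 0 <= P -> 0 <= Q ->
  (forall e, 0 < e -> y <= 2^-1 * (e * P + e^-1 * Q)) ->
  y <= Num.sqrt P * Num.sqrt Q.
Proof.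
move=> P0 Q0 h; set a := Num.sqrt P; set b := Num.sqrt Q.
have a0 : 0 <= a by exact: sqrtr_ge0.
have b0 : 0 <= b by exact: sqrtr_ge0.
have Pa : P = a ^+ 2 by rewrite sqr_sqrtr.
have Qb : Q = b ^+ 2 by rewrite sqr_sqrtr.
suff hd d : 0 < d -> y <= a * b + d * (a + b).
  apply/ler_addgt0Pr => e e0.
  have ab : 0 < a + b + 1 by lra.
  have := hd (e / (a + b + 1)); rewrite divr_gt0// => /(_ isT) /le_trans; apply.
  rewrite lerD2l mulrAC ler_pdivrMr// ler_pM2l//; lra.
move=> d0; have ad : 0 < a + d by lra.
have bd : 0 < b + d by lra.
have := h ((b + d) / (a + d)); rewrite divr_gt0// => /(_ isT) /le_trans; apply.
have t1 : (b + d) / (a + d) * P <= (b + d) * a.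
  rewrite mulrAC ler_pdivrMr// Pa; have : 0 <= (b + d) * a * d by rewrite !mulr_ge0// ltW.
  lra.
have t2 : ((b + d) / (a + d))^-1 * Q <= (a + d) * b.
  rewrite invf_div mulrAC ler_pdivrMr// Qb; have : 0 <= (a + d) * b * d by rewrite !mulr_ge0// ltW.
  lra.
have : 0 <= d * (a + b) by rewrite mulr_ge0// ?addr_ge0// ltW.
lra.
Qed.

Lemma measurable_expRM (R : realType) (b : R) :
  measurable_fun (setT : set (measurableTypeR R)) (fun x => expR (b * x)).
Proof. by apply: measurableT_comp; [exact: measurable_expR|exact: measurable_funM]. Qed.

Lemma integrable_expRM (R : realType) (tau beta : R)
    (m : {measure set (measurableTypeR R) -> \bar R}) : (m setT < +oo)%E -> 0 <= beta ->
  m.-integrable `[0, tau]%classic (EFin \o (fun s => expR (- beta * s))).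
Proof.
move=> mfin b0; apply: (integrable_bounded (M := 1)); first exact: measurable_itv.
- by apply: (measure_le_lty mfin); exact: measurable_itv.
- by apply: measurable_funTS; exact: measurable_expRM.
move=> s; rewrite /= in_itv/= => /andP[s0 _].
by rewrite ger0_norm ?expR_ge0// -expR0 ler_expR mulNr oppr_le0 mulr_ge0.
Qed.

(** * Young's inequality for convolution with a finite measure on the delays *)

Section delayed_integral.
Context {R : realType} (T tau : R).
Local Notation mR := (measurableTypeR R).
Local Notation leb := (@lebesgue_measure R).
Local Notation D := (`]0, T[%classic : set mR).
Local Notation J := (`](- tau), T[%classic : set mR).
Local Notation I := (`[0, tau]%classic : set mR).
Context (m : {measure set mR -> \bar R}).
Hypothesis mfin : (m setT < +oo)%E.
Implicit Types (p q : mR -> R) (beta : R).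

Let mI : measurable I. Proof. exact: measurable_itv. Qed.

Definition delayed_integral p (t : R) : R := \int[m]_(s in I) p (t - s).

Lemma delayed_integral_ge0 p t : (forall x, 0 <= p x) -> 0 <= delayed_integral p t.
Proof. by move=> p0; exact: Rintegral_ge0. Qed.

Let measurable_shift p : measurable_fun setT p ->
  measurable_fun (setT : set (mR * mR))
    (fun z => (p (z.1 - z.2))%:E).
Proof.
move=> mp; apply/measurable_EFinP; apply: (measurableT_comp mp).
by apply: measurable_funB; [exact: measurable_fst|exact: measurable_snd].
Qed.

Lemma measurable_delayed_integral p : measurable_fun setT p -> (forall x, 0 <= p x) ->
  measurable_fun (setT : set mR) (delayed_integral p).
Proof.
move=> mp p0; apply: (@measurableT_comp _ _ _ _ _ _ fine) => //.
apply: (measurable_tonelli_finite (X := mR) mfin mI (measurable_shift mp)).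
by move=> z; rewrite lee_fin.
Qed.

Lemma shifted_integral_le (f : mR -> \bar R) (s : R) :
  measurable_fun setT f -> (forall x, (0 <= f x)%E) -> I s ->
  (\int[leb]_(t in D) f (t - s)%R <= \int[leb]_(t in J) f t)%E.
Proof.
move=> mf f0; rewrite /= in_itv/= => /andP[s0 st].
have mF : measurable_fun setT (f \_ J).
  by apply/(measurable_restrictT _ _).1; [exact: measurable_oo|exact: measurable_funTS].
have F0 x : (0 <= (f \_ J) x)%E by apply: erestrict_ge0.
rewrite [leRHS]integral_mkcond -(ge0_integral_translation s mF F0) integral_mkcond.
apply: ge0_le_integral => //.
- by move=> x _; apply: erestrict_ge0.
- apply/(measurable_restrictT _ _).1; first exact: measurable_oo.
  apply: measurable_funTS; apply: (measurableT_comp mf); exact: measurable_funB.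
- by apply: (measurableT_comp mF); exact: measurable_funB.
move=> x _; rewrite {1}/patch; case: ifPn => [/set_mem|_ //].
rewrite /= in_itv/= => /andP[x0 xT].
by rewrite /patch mem_set//= in_itv/=; apply/andP; split; lra.
Qed.

Definition delayed_kernel beta p q (z : mR * mR) : \bar R :=
  (expR (- 2 * beta * z.1) * (q z.1 * p (z.1 - z.2)))%:E.

Lemma delayed_kernel_ge0 beta p q z : (forall x, 0 <= p x) -> (forall x, 0 <= q x) ->
  (0 <= delayed_kernel beta p q z)%E.
Proof. by move=> p0 q0; rewrite lee_fin !mulr_ge0// expR_ge0. Qed.

Lemma measurable_delayed_kernel beta p q : measurable_fun setT p -> measurable_fun setT q ->
  measurable_fun setT (delayed_kernel beta p q).
Proof.
move=> mp mq; apply/measurable_EFinP; apply: measurable_funM.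
  apply: measurableT_comp; first exact: measurable_expR.
  by apply: measurable_funM => //; exact: measurable_fst.
apply: measurable_funM; first exact: (measurableT_comp mq measurable_fst).
by apply/measurable_EFinP; exact: measurable_shift.
Qed.

(** For a fixed delay [s] the weight splits as [exp(-2 beta t) = exp(-beta s) exp(-beta (t - s))
    exp(-beta t)]. The last two factors go to [p (t - s)] and [q t]; the first remains and,
    integrated against [m], is the origin of [kappa]. *)
Lemma delayed_double_integral_le beta p q P Q e : 0 < e ->
  measurable_fun setT p -> measurable_fun setT q ->
  (forall x, 0 <= p x) -> (forall x, 0 <= q x) ->
  (\int[leb]_(x in J) (expR (- 2 * beta * x) * p x ^+ 2)%:E = P%:E)%E ->
  (\int[leb]_(x in D) (expR (- 2 * beta * x) * q x ^+ 2)%:E = Q%:E)%E ->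
  (\int[leb]_(t in D) \int[m]_(s in I) delayed_kernel beta p q (t, s) <=
   \int[m]_(s in I) (expR (- beta * s))%:E * (2^-1 * (e * P + e^-1 * Q))%:E)%E.
Proof.
move=> e0 mp mq p0 q0 EP EQ; pose F := delayed_kernel beta p q.
have mF : measurable_fun setT F by exact: measurable_delayed_kernel.
have F0 z : (0 <= F z)%E by exact: delayed_kernel_ge0.
rewrite (tonelli_finite leb mfin measurable_oo mI mF F0).
have P0 : 0 <= P.
  by rewrite -lee_fin -EP; apply: integral_ge0 => x _; rewrite lee_fin mulr_ge0 ?expR_ge0 ?sqr_ge0.
have Q0 : 0 <= Q.
  by rewrite -lee_fin -EQ; apply: integral_ge0 => x _; rewrite lee_fin mulr_ge0 ?expR_ge0 ?sqr_ge0.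
have K0 : 0 <= 2^-1 * (e * P + e^-1 * Q).
  by rewrite mulr_ge0// addr_ge0// mulr_ge0// ?invr_ge0 ltW.
have meI : measurable_fun I (fun s => (expR (- beta * s))%:E).
  by apply/measurable_EFinP; apply: measurable_funTS; exact: measurable_expRM.
have eI0 s : I s -> (0 <= (expR (- beta * s))%:E)%E by rewrite lee_fin expR_ge0.
rewrite -(ge0_integralZr m mI meI eI0) ?lee_fin//.
apply: ae_le_ge0_integral => [s _|s _|].
- by apply: integral_ge0 => t _; exact: F0.
- by rewrite mule_ge0// lee_fin expR_ge0.
apply: aeW => s sI.
pose f1 (x : mR) := expR (- 2 * beta * x) * p x ^+ 2.
pose f2 (x : mR) := expR (- 2 * beta * x) * q x ^+ 2.
have f10 x : 0 <= f1 x by rewrite mulr_ge0 ?expR_ge0 ?sqr_ge0.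
have f20 x : 0 <= f2 x by rewrite mulr_ge0 ?expR_ge0 ?sqr_ge0.
have mf1 : measurable_fun setT f1.
  by apply: measurable_funM; [exact: measurable_expRM|exact: measurable_funX].
have mf2 : measurable_fun setT f2.
  by apply: measurable_funM; [exact: measurable_expRM|exact: measurable_funX].
have mf1s : measurable_fun (setT : set mR)
    (fun t : mR => f1 (t - s)).
  by apply: (measurableT_comp mf1); exact: measurable_funB.
pose k1 := expR (- beta * s) * (2^-1 * e); pose k2 := expR (- beta * s) * (2^-1 * e^-1).
have k10 : 0 <= k1 by rewrite mulr_ge0 ?expR_ge0// mulr_ge0// ltW.
have k20 : 0 <= k2 by rewrite mulr_ge0 ?expR_ge0// mulr_ge0// invr_ge0 ltW.
apply: (@le_trans _ _ (\int[leb]_(t in D) ((k1 * f1 (t - s))%:E + (k2 * f2 t)%:E))%E).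
  apply: ae_le_ge0_integral => [t _|t _|].
  - exact: F0.
  - by rewrite adde_ge0// lee_fin mulr_ge0.
  apply: aeW => t _; rewrite -EFinD lee_fin /F /delayed_kernel/= /k1 /k2 /f1 /f2.
  pose a := expR (- beta * (t - s)) * p (t - s); pose b := expR (- beta * t) * q t.
  have E2 (x : R) : expR (- 2 * beta * x) = expR (- beta * x) ^+ 2.
    by rewrite -expRM_natl; congr expR; ring.
  have Es : expR (- beta * t) = expR (- beta * s) * expR (- beta * (t - s)).
    by rewrite -expRD; congr expR; ring.
  rewrite !E2 -!exprMn -/a -/b.
  have -> : expR (- beta * t) ^+ 2 * (q t * p (t - s)) = expR (- beta * s) * (a * b).
    by rewrite /a /b expr2 {1}Es; ring.
  have := @young_ineq R a b e e0; rewrite -!mulrA -mulrDr ler_pM2l ?expR_gt0//; lra.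
rewrite ge0_integralD//; last first.
- by apply/measurable_EFinP; apply: measurable_funTS; apply: measurable_funM.
- by move=> t _; rewrite lee_fin mulr_ge0.
- by apply/measurable_EFinP; apply: measurable_funTS; apply: measurable_funM.
- by move=> t _; rewrite lee_fin mulr_ge0.
rewrite !ge0_integral_realZl//; [|exact: measurable_funTS..].
rewrite [X in (_ + _ * X)%E]EQ.
apply: (@le_trans _ _ (k1%:E * P%:E + k2%:E * Q%:E)%E).
  rewrite leeD2r// lee_wpmul2l// -EP.
  by apply: (@shifted_integral_le (fun t => (f1 t)%:E)) => //; exact/measurable_EFinP.
by rewrite -!EFinM -!EFinD lee_fin /k1 /k2; lra.
Qed.

(** The real-valued [delayed_integral] reads 0 where the inner integral is infinite, which can only
    lower the left-hand side. *)
Lemma delayed_form_le beta p q P Q e : 0 < e ->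
  measurable_fun setT p -> measurable_fun setT q ->
  (forall x, 0 <= p x) -> (forall x, 0 <= q x) ->
  (\int[leb]_(x in J) (expR (- 2 * beta * x) * p x ^+ 2)%:E = P%:E)%E ->
  (\int[leb]_(x in D) (expR (- 2 * beta * x) * q x ^+ 2)%:E = Q%:E)%E ->
  (\int[leb]_(t in D) (expR (- 2 * beta * t) * (q t * delayed_integral p t))%:E <=
   \int[m]_(s in I) (expR (- beta * s))%:E * (2^-1 * (e * P + e^-1 * Q))%:E)%E.
Proof.
move=> e0 mp mq p0 q0 EP EQ; pose F := delayed_kernel beta p q.
have F0 z : (0 <= F z)%E by exact: delayed_kernel_ge0.
apply: (@le_trans _ _ (\int[leb]_(t in D) \int[m]_(s in I) F (t, s))%E).
  apply: ae_le_ge0_integral => [t _|t _|].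
  - by rewrite lee_fin !mulr_ge0 ?expR_ge0 ?delayed_integral_ge0.
  - by apply: integral_ge0 => s _; exact: F0.
  apply: aeW => t _; rewrite mulrA EFinM.
  have mpt : measurable_fun I (fun s : mR => p (t - s)).
    by apply: measurable_funTS; apply: (measurableT_comp mp); exact: measurable_funB.
  have -> : (\int[m]_(s in I) F (t, s) =
      (expR (- 2 * beta * t) * q t)%:E * \int[m]_(s in I) (p (t - s))%:E)%E.
    rewrite -ge0_integral_realZl// ?mulr_ge0 ?expR_ge0//.
    by apply: eq_integral => s _; rewrite /F /delayed_kernel/= mulrA.
  apply: lee_wpmul2l; first by rewrite lee_fin mulr_ge0 ?expR_ge0.
  rewrite /delayed_integral /Rintegral.
  have : (0 <= \int[m]_(s in I) (p (t - s))%:E)%E by apply: integral_ge0 => s _; rewrite lee_fin.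
  by case: (integral _ _ _) => [r||]//= _; rewrite leey.
exact: delayed_double_integral_le.
Qed.

Lemma delayed_form_bound beta p q P Q : 0 <= beta ->
  measurable_fun setT p -> measurable_fun setT q ->
  (forall x, 0 <= p x) -> (forall x, 0 <= q x) ->
  (\int[leb]_(x in J) (expR (- 2 * beta * x) * p x ^+ 2)%:E = P%:E)%E ->
  (\int[leb]_(x in D) (expR (- 2 * beta * x) * q x ^+ 2)%:E = Q%:E)%E ->
  leb.-integrable D
    (EFin \o (fun t => expR (- 2 * beta * t) * (q t * delayed_integral p t))) /\
  \int[leb]_(t in D) (expR (- 2 * beta * t) * (q t * delayed_integral p t)) <=
   (\int[m]_(s in I) expR (- beta * s)) * (Num.sqrt P * Num.sqrt Q).
Proof.
move=> b0 mp mq p0 q0 EP EQ.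
set k := \int[m]_(s in I) _.
have k0 : 0 <= k by apply: Rintegral_ge0 => s _; exact: expR_ge0.
have kE : (\int[m]_(s in I) (expR (- beta * s))%:E = k%:E)%E.
  by rewrite /k EFin_Rintegral//; exact: integrable_expRM.
have h e : 0 < e ->
    (\int[leb]_(t in D) (expR (- 2 * beta * t) * (q t * delayed_integral p t))%:E <=
     (k * (2^-1 * (e * P + e^-1 * Q)))%:E)%E.
  move=> e0; have := delayed_form_le e0 mp mq p0 q0 EP EQ.
  by rewrite kE -EFinM.
have F0 t : 0 <= expR (- 2 * beta * t) * (q t * delayed_integral p t).
  by rewrite !mulr_ge0 ?expR_ge0 ?delayed_integral_ge0.
have iF : leb.-integrable D
    (EFin \o (fun t => expR (- 2 * beta * t) * (q t * delayed_integral p t))).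
  apply/integrableP; split.
    apply/measurable_EFinP; apply: measurable_funTS; apply: measurable_funM.
      exact: measurable_expRM.
    by apply: measurable_funM => //; exact: measurable_delayed_integral.
  under eq_integral do rewrite /= ger0_norm//.
  by apply: le_lt_trans (h 1 ltr01) _; exact: ltry.
split=> //; have P0 : 0 <= P.
  by rewrite -lee_fin -EP; apply: integral_ge0 => x _; rewrite lee_fin mulr_ge0 ?expR_ge0 ?sqr_ge0.
have Q0 : 0 <= Q.
  by rewrite -lee_fin -EQ; apply: integral_ge0 => x _; rewrite lee_fin mulr_ge0 ?expR_ge0 ?sqr_ge0.
(* With [k] under both roots, [h] is the hypothesis of [le_sqrt_young] for [k P] and [k Q]. *)
have -> : k * (Num.sqrt P * Num.sqrt Q) = Num.sqrt (k * P) * Num.sqrt (k * Q).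
  by rewrite !sqrtrM// mulrACA -expr2 sqr_sqrtr.
apply: le_sqrt_young; rewrite ?mulr_ge0// => e e0.
rewrite -lee_fin EFin_Rintegral//.
by apply: le_trans (h _ e0) _; rewrite lee_fin; lra.
Qed.

(** The double integral bound with [q = 1], [beta = 0] and [e = 1] makes the inner integrals finite
    for almost every [t]. *)
Lemma ae_integrable_delayed p P : measurable_fun setT p -> (forall x, 0 <= p x) ->
  (\int[leb]_(x in J) (p x ^+ 2)%:E = P%:E)%E ->
  \forall t \ae leb, D t ->
    m.-integrable I (EFin \o (fun s : mR => p (t - s))).
Proof.
move=> mp p0 EP.
have EP' : (\int[leb]_(x in J) (expR (- 2 * 0 * x) * p x ^+ 2)%:E = P%:E)%E.
  by rewrite -EP; apply: eq_integral => x _; rewrite mulr0 mul0r expR0 mul1r.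
have i1 : leb.-integrable D (EFin \o (fun=> 1 : R)).
  apply: (integrable_bounded (M := 1)); [exact: measurable_oo| | |].
  - exact: lebesgue_itvoo_lty.
  - exact: measurable_cst.
  - by move=> t _; rewrite ger0_norm.
have EQ : (\int[leb]_(x in D) (expR (- 2 * 0 * x) * 1 ^+ 2)%:E =
    (\int[leb]_(t in D) 1)%R%:E)%E.
  rewrite EFin_Rintegral//.
  by apply: eq_integral => x _; rewrite mulr0 mul0r expR0 mul1r expr1n.
have h := @delayed_double_integral_le 0 p (fun=> 1) P _ 1 ltr01 mp (measurable_cst _)
  p0 (fun=> ler01) EP' EQ.
have mF := @measurable_delayed_kernel 0 p (fun=> 1) mp (measurable_cst _).
have F0 z := @delayed_kernel_ge0 0 p (fun=> 1) z p0 (fun=> ler01).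
have : leb.-integrable D (fun t => \int[m]_(s in I) delayed_kernel 0 p (fun=> 1%R) (t, s))%E.
  apply/integrableP; split.
    apply: measurable_funTS.
    exact: (measurable_tonelli_finite (X := mR) mfin mI mF F0).
  under eq_integral do rewrite gee0_abs ?integral_ge0//.
  apply: le_lt_trans h _; rewrite -EFin_Rintegral ?integrable_expRM//.
  exact: ltry.
move=> /(integrable_ae measurable_oo); apply: ae_mono => t + tD => /(_ tD) ft.
apply/integrableP; split.
  apply/measurable_EFinP; apply: measurable_funTS; apply: (measurableT_comp mp).
  exact: measurable_funB.
move: ft; rewrite ge0_fin_numE ?integral_ge0//; apply: le_lt_trans.
apply: ae_le_ge0_integral => //; apply: aeW => s _; rewrite /delayed_kernel/= ger0_norm//.
by rewrite mulr0 mul0r expR0 !mul1r.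
Qed.

End delayed_integral.

Section delay_operator.
Context {R : realType} {V : hilbertType R} (a1 : {biscalar V}) (L tau : R).
Local Notation mR := (measurableTypeR R).
Hypothesis L0 : 0 <= L.
Hypothesis a1L : forall w v, `|a1 w v| <= L * `|w| * `|v|.
Local Notation I := (`[0, tau]%classic : set mR).
Implicit Types (s : {charge set mR -> \bar R}).
Implicit Types (g : mR -> V) (t : R).

Let mI : measurable I. Proof. exact: measurable_itv. Qed.

Let strongly_measurable_shift g t : strongly_measurable g ->
  strongly_measurable (fun x : mR => g (t - x)).
Proof.
move=> mg; apply: (strongly_measurable_comp (phi := fun x : mR => t - x)) => //.
exact: measurable_funB.
Qed.

Let strongly_measurable_form g t : strongly_measurable g ->
  strongly_measurable (fun x : mR => form_op a1 (g (t - x))).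
Proof.
move=> mg; apply: (strongly_measurable_linear (form_op_linear a1L) (M := L)
  (f := fun x : mR => g (t - x))).
  by move=> e; exact: form_op_bounded.
exact: strongly_measurable_shift.
Qed.

Let form_integrable (m : {measure set mR -> \bar R}) g t v :
  strongly_measurable g ->
  m.-integrable I (EFin \o (fun x : mR => `|g (t - x)|)) ->
  m.-integrable I (EFin \o (fun x : mR => a1 (g (t - x)) v)).
Proof.
move=> mg ig; apply: (integrable_le mI _ _ (integrable_realZl (L * `|v|) mI ig)).
  apply: measurable_funTS.
  have := measurable_dual_eval v (strongly_measurable_form t mg).
  by apply: eq_measurable_fun => x _; rewrite (form_opE _ _ a1L).
by move=> x _; rewrite (le_trans (a1L _ _))// mulrAC.
Qed.

Lemma delay_opE s g t v : strongly_measurable g ->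
  (tvar s).-integrable I (EFin \o (fun x : mR => `|g (t - x)|)) ->
  delay_op a1 tau s g t v =
  charge_integral s I (fun x : mR => a1 (g (t - x)) v).
Proof.
move=> mg ig; have [ip iN] := integrable_tvar mI ig.
have bE (m : {measure set mR -> \bar R}) : (m setT < +oo)%E ->
    m.-integrable I (EFin \o (fun x : mR => `|g (t - x)|)) ->
    bochner m I (fun x => form_op a1 (g (t - x))) v = \int[m]_(x in I) a1 (g (t - x)) v.
  move=> mfin im; rewrite bochner_dualE//.
  - by apply: eq_Rintegral => x _; rewrite (form_opE _ _ a1L).
  - exact: measure_le_lty.
  - eexists; first exact: (strongly_measurable_form t mg).
    by apply: aeW.
  have [_] := integrableP _ _ _ (integrable_realZl L mI im).
  apply: le_lt_trans; apply: ae_le_ge0_integral => //; apply: aeW => x _.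
  by rewrite /= lee_fin (le_trans _ (ler_norm _))// form_op_bounded.
pose F x := form_op a1 (g (t - x)).
have -> : delay_op a1 tau s g t v = bochner (pos_part s) I F v - bochner (neg_part s) I F v by [].
rewrite /charge_integral; congr (_ - _).
  exact: (bE _ (pos_part_ltyT s) ip).
exact: (bE _ (neg_part_ltyT s) iN).
Qed.

(** The term [K_(s1) g2] is subtracted and added: [s1] then acts on the unknown [g1 - g2], and the
    kernel difference acts on [g2] alone. This decides which kernel appears in [kappa] and which
    trajectory on the right of the estimates. *)
Lemma delay_op_diff_le s1 s2 g1 g2 t v :
  strongly_measurable g1 -> strongly_measurable g2 ->
  (tvar s1).-integrable I (EFin \o (fun x : mR => `|g1 (t - x)|)) ->
  (tvar s1).-integrable I (EFin \o (fun x : mR => `|g2 (t - x)|)) ->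
  (tvar s2).-integrable I (EFin \o (fun x : mR => `|g2 (t - x)|)) ->
  `|(delay_op a1 tau s1 g1 t - delay_op a1 tau s2 g2 t) v| <=
  L * `|v| * (delayed_integral tau (tvar s1) (fun x => `|g1 x - g2 x|) t +
    delayed_integral tau (tvar (csub s1 s2)) (fun x => `|g2 x|) t).
Proof.
move=> m1 m2 i11 i12 i22.
have -> : (delay_op a1 tau s1 g1 t - delay_op a1 tau s2 g2 t) v =
    charge_integral s1 I (fun x : mR => a1 (g1 (t - x)) v) -
    charge_integral s2 I (fun x : mR => a1 (g2 (t - x)) v).
  exact: (congr2 (fun x y => x - y) (delay_opE v m1 i11) (delay_opE v m2 i22)).
have j11 := form_integrable v m1 i11; have j12 := form_integrable v m2 i12.
have j22 := form_integrable v m2 i22.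
rewrite -(subrKA (charge_integral s1 I (fun x => a1 (g2 (t - x)) v))).
rewrite -(charge_integralB mI j11 j12) (charge_integral_csub mI j12 j22).
have jd := integrable_realB mI j11 j12.
have j3 := integrable_csub mI j12 j22; have i3 := integrable_csub mI i12 i22.
have md : measurable_fun I (fun x : mR => `|g1 (t - x) - g2 (t - x)|).
  apply: measurable_funTS; apply: measurable_fun_strong_norm.
  by apply: strongly_measurableB; exact: strongly_measurable_shift.
have id : (tvar s1).-integrable I
    (EFin \o (fun x : mR => `|g1 (t - x) - g2 (t - x)|)).
  apply: (integrable_le mI md _ (integrable_realD mI i11 i12)) => x _.
  by rewrite normr_id ler_normB.
have Lv : 0 <= L * `|v| by rewrite mulr_ge0.
rewrite (le_trans (ler_normD _ _))// mulrDr lerD//.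
  apply: le_trans (charge_integral_le mI jd) _.
  rewrite /delayed_integral -(RintegralZl _ mI id).
  apply: (le_Rintegral mI (integrable_norm jd) (integrable_realZl (L * `|v|) mI id)) => x _.
  have := linearBl a1 v (g1 (t - x)) (g2 (t - x)) => /= <-.
  by rewrite (le_trans (a1L _ _))// mulrAC.
apply: le_trans (charge_integral_le mI j3) _.
rewrite /delayed_integral -(RintegralZl _ mI i3).
apply: (le_Rintegral mI (integrable_norm j3) (integrable_realZl (L * `|v|) mI i3)) => x _.
by rewrite (le_trans (a1L _ _))// mulrAC.
Qed.

End delay_operator.

Lemma delayed_form_bound0 (R : realType) (T tau : R)
    (m : {measure set (measurableTypeR R) -> \bar R}) (p q : measurableTypeR R -> R) P Q :
  (m setT < +oo)%E -> measurable_fun setT p -> measurable_fun setT q ->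
  (forall x, 0 <= p x) -> (forall x, 0 <= q x) ->
  (\int[@lebesgue_measure R]_(x in `](- tau)%R, T[) (p x ^+ 2)%:E = P%:E)%E ->
  (\int[@lebesgue_measure R]_(x in `]0%R, T[) (q x ^+ 2)%:E = Q%:E)%E ->
  (@lebesgue_measure R).-integrable `]0, T[
    (EFin \o (fun t => q t * delayed_integral tau m p t)) /\
  \int[@lebesgue_measure R]_(t in `]0, T[) (q t * delayed_integral tau m p t) <=
   fine (m `[0, tau]%classic) * (Num.sqrt P * Num.sqrt Q).
Proof.
move=> mfin mp mq p0 q0 EP EQ.
have w0 (x : R) : expR (- 2 * 0 * x) = 1 by rewrite mulr0 mul0r expR0.
have EP' : (\int[@lebesgue_measure R]_(x in `](- tau)%R, T[)
    (expR (- 2 * 0 * x) * p x ^+ 2)%:E = P%:E)%E.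
  by rewrite -EP; apply: eq_integral => x _; rewrite w0 mul1r.
have EQ' : (\int[@lebesgue_measure R]_(x in `]0%R, T[)
    (expR (- 2 * 0 * x) * q x ^+ 2)%:E = Q%:E)%E.
  by rewrite -EQ; apply: eq_integral => x _; rewrite w0 mul1r.
have := delayed_form_bound mfin (lexx 0) mp mq p0 q0 EP' EQ'.
have -> : (fun t => expR (- 2 * 0 * t) * (q t * delayed_integral tau m p t)) =
    (fun t => q t * delayed_integral tau m p t).
  by apply/funext => t; rewrite w0 mul1r.
have -> // : \int[m]_(s in `[0, tau]) expR (- 0 * s) = fine (m `[0, tau]%classic).
have -> : (fun s : measurableTypeR R => expR (- 0 * s)) = cst 1.
  by apply/funext => s; rewrite oppr0 mul0r expR0.
by rewrite Rintegral_cst ?mul1r.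
Qed.

Lemma young_half (R : realType) (a b e : R) : 0 < e ->
  b * a <= 2^-1 * e * a ^+ 2 + 2^-1 / e * b ^+ 2.
Proof. by move=> e0; have := young_ineq a b e0; lra. Qed.

(** * Stability in the kernel *)

Section comparison.
Context {R : realType} {V H : hilbertType R} (iota : {linear V -> H}) (T tau : R).
Local Notation mR := (measurableTypeR R).
Context (a0 a1 : {biscalar V}) (L0 L1 alpha : R).
Hypothesis L0_ge0 : 0 <= L0.
Hypothesis L1_ge0 : 0 <= L1.
Hypothesis tau_ge0 : 0 <= tau.
Hypothesis a0L : forall w v, `|a0 w v| <= L0 * `|w| * `|v|.
Hypothesis a1L : forall w v, `|a1 w v| <= L1 * `|w| * `|v|.
Hypothesis a0_coercive : forall v, alpha * `|v| ^+ 2 <= a0 v v.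
Local Notation leb := (@lebesgue_measure R).
Local Notation D := (`]0, T[%classic : set mR).
Local Notation J := (`](- tau), T[%classic : set mR).
Local Notation I := (`[0, tau]%classic : set mR).
Local Notation sqi := (square_integrable leb D).
Context (s1 s2 : {charge set mR -> \bar R}).
Context (c : R -> H) (w : mR -> V) (dw : mR -> dual V).
Context (g1 g2 : mR -> V).
Hypothesis sw : sqi w.
Hypothesis sdw : sqi dw.
Hypothesis cc : {within `[0, T], continuous c}.
Hypothesis cw : \forall t \ae leb, D t -> c t = iota (w t).
Hypothesis c0 : c 0 = 0.
Hypothesis cdw : forall z a b, 0 <= a -> a <= b -> b <= T ->
  inner (c b) (iota z) - inner (c a) (iota z) = \int[leb]_(t in `]a, b[) dw t z.
Hypothesis sg1 : square_integrable leb J g1.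
Hypothesis sg2 : square_integrable leb J g2.
Hypothesis g12 : \forall x \ae leb, J x ->
  g1 x - g2 x = if 0 < x then w x else 0.
Hypothesis eqn : \forall t \ae leb, D t ->
  dw t + form_op a0 (w t) + (delay_op a1 tau s1 g1 t - delay_op a1 tau s2 g2 t) = 0.

Let p1 : mR -> R := fun x => `|g1 x - g2 x|.
Let p2 : mR -> R := fun x => `|g2 x|.
Let dI1 := delayed_integral tau (tvar s1) p1.
Let dI2 := delayed_integral tau (tvar (csub s1 s2)) p2.

Let mp1 : measurable_fun setT p1.
Proof.
have [m1 _] := sg1; have [m2 _] := sg2.
exact: (measurable_fun_strong_norm (strongly_measurableB m1 m2)).
Qed.

Let mp2 : measurable_fun setT p2.
Proof. by have [m2 _] := sg2; exact: measurable_fun_strong_norm. Qed.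

Let mw : measurable_fun (setT : set mR) (fun t => `|w t|).
Proof. by have [m2 _] := sw; exact: measurable_fun_strong_norm. Qed.

Let mdw : measurable_fun (setT : set mR) (fun t => `|dw t|).
Proof. by have [m2 _] := sdw; exact: measurable_fun_strong_norm. Qed.

Let G : R := \int[leb]_(x in J) (p2 x ^+ 2).

Let EG : (\int[leb]_(x in J) (p2 x ^+ 2)%:E = G%:E)%E.
Proof. by have [_ i] := sg2; rewrite /G EFin_Rintegral//; exact: measurable_oo. Qed.

(** The exceptional null set does not depend on [v]: one may take [v = w t] for the energy, and the
    supremum over [v] for the norm of [dw t]. *)
Lemma difference_pairing_le : \forall t \ae leb, D t ->
  forall v, `|dw t v + a0 (w t) v| <= L1 * `|v| * (dI1 t + dI2 t).
Proof.
have ae (s : {charge set mR -> \bar R}) (g : mR -> V) :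
    square_integrable leb J g -> \forall t \ae leb, D t ->
    (tvar s).-integrable I (EFin \o (fun x : mR => `|g (t - x)|)).
  move=> [mg ig]; apply: (ae_integrable_delayed (p := fun x => `|g x|)
    (P := \int[leb]_(x in J) (`|g x| ^+ 2)) (tvar_ltyT s)) => //.
    exact: measurable_fun_strong_norm.
  by rewrite EFin_Rintegral//; exact: measurable_oo.
have [m1 _] := sg1; have [m2 _] := sg2.
have ae12 := ae_mono2 (fun t a b => conj a b) (ae s1 g1 sg1) (ae s1 g2 sg2).
have ae3 := ae_mono2 (fun t a b => conj a b) (ae s2 g2 sg2) eqn.
apply: ae_mono2 ae12 ae3 => t [i11 i12] [i22 e] tD v.
have := delay_op_diff_le L1_ge0 a1L v m1 m2 (i11 tD) (i12 tD) (i22 tD).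
rewrite -/dI1 -/dI2; apply: le_trans.
set d := delay_op _ _ _ _ _ - _ in e *.
have : (dw t + form_op a0 (w t) + d) v = 0 by rewrite e.
have -> : (dw t + form_op a0 (w t) + d) v = dw t v + form_op a0 (w t) v + d v by [].
by rewrite (form_opE _ _ a0L) => /eqP; rewrite addr_eq0 => /eqP ->; rewrite normrN.
Qed.

Let energy beta : R := \int[leb]_(t in D) (expR (- 2 * beta * t) * `|w t| ^+ 2).

Let expR_le1 beta (t : R) : 0 <= beta -> 0 <= t -> expR (- 2 * beta * t) <= 1.
Proof.
by move=> b0 t0; rewrite -expR0 ler_expR -mulrA mulNr oppr_le0 !mulr_ge0.
Qed.

Let integrable_energy beta : 0 <= beta ->
  leb.-integrable D (EFin \o (fun t => expR (- 2 * beta * t) * `|w t| ^+ 2)).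
Proof.
move=> b0; have [_ iw] := sw; apply: (integrable_le measurable_oo _ _ iw).
  by apply: measurable_funTS; apply: measurable_funM; [exact: measurable_expRM|exact: measurable_funX].
move=> t; rewrite /= in_itv/= => /andP[t0 _].
by rewrite ger0_norm ?mulr_ge0 ?expR_ge0 ?sqr_ge0// ler_piMl ?sqr_ge0// expR_le1// ltW.
Qed.

Let energy_ge0 beta : 0 <= energy beta.
Proof. by apply: Rintegral_ge0 => t _; rewrite mulr_ge0 ?expR_ge0 ?sqr_ge0. Qed.

Let E_energy beta : 0 <= beta ->
  (\int[leb]_(t in D) (expR (- 2 * beta * t) * `|w t| ^+ 2)%:E = (energy beta)%:E)%E.
Proof.
by move=> b0; rewrite /energy EFin_Rintegral//; exact: integrable_energy.
Qed.

(** The shared history cancels in [p1], so no contribution from negative times, where the weight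
    exceeds 1, has to be absorbed. *)
Let E_past beta : 0 <= beta ->
  (\int[leb]_(x in J) (expR (- 2 * beta * x) * p1 x ^+ 2)%:E = (energy beta)%:E)%E.
Proof.
move=> b0; rewrite -E_energy//.
rewrite (ae_eq_integral_nomeas (g := fun x : mR =>
  ((fun t => (expR (- 2 * beta * t) * `|w t| ^+ 2)%:E) \_ (`]0, +oo[%classic : set R)) x)).
  rewrite -integral_mkcondr; congr (integral _ _ _).
  apply/seteqP; split => x /=; rewrite !in_itv/= ?andbT; first by move=> [/andP[_ ->] ->].
  by move=> /andP[x0 ->]; rewrite x0 (le_lt_trans _ x0)// oppr_le0.
apply: ae_mono g12 => x + xJ => /(_ xJ) gx; rewrite /p1 gx /patch mem_setE in_itv/= andbT.
by case: ifP => // _; rewrite normr0 expr0n mulr0.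
Qed.

Let E_past0 : (\int[leb]_(x in J) (p1 x ^+ 2)%:E = (sqnorm T w)%:E)%E.
Proof.
have w0 (x : R) : expR (- 2 * 0 * x) = 1 by rewrite mulr0 mul0r expR0.
have -> : sqnorm T w = energy 0 by apply: eq_Rintegral => x _; rewrite w0 mul1r.
by rewrite -E_past//; apply: eq_integral => x _; rewrite w0 mul1r.
Qed.

Lemma weighted_stability beta : 0 <= beta -> 0 < alpha - L1 * kappa tau s1 beta ->
  Num.sqrt (\int[leb]_(t in D) (expR (- 2 * beta * t) * `|w t| ^+ 2)) <=
  L1 * normM tau (csub s1 s2) / (alpha - L1 * kappa tau s1 beta) *
  Num.sqrt (\int[leb]_(t in J) (`|g2 t| ^+ 2)).
Proof.
move=> b0 ka; rewrite -/(energy beta) -/G; set X := energy beta.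
set k := kappa _ _ _ in ka *; set N := normM _ _.
(* The exponential frozen at its value at 0 for negative times: it agrees with the weight on []0,
   T[] and is bounded by 1 and nonincreasing on the whole line, as the energy inequality asks. *)
pose om (t : R) := expR (- 2 * beta * Num.max t 0).
have om0 t : 0 <= om t by exact: expR_ge0.
have om1 t : om t <= 1 by rewrite expR_le1// le_max lexx orbT.
have omd : {homo om : x y /~ x <= y}.
  move=> x y xy; rewrite ler_expR -!mulrA !mulNr lerN2 !ler_wpM2l//.
  by rewrite ge_max !le_max xy lexx !orbT.
have mom : measurable_fun (setT : set mR) om.
  apply: (measurableT_comp (measurable_expRM (- 2 * beta))).
  by apply: measurable_maxr => //; exact: measurable_cst.
have omE t : D t -> om t = expR (- 2 * beta * t).
  by rewrite /= in_itv/= => /andP[t0 _]; rewrite /om (max_idPl (ltW t0)).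
(* In the term with [s1 - s2] the whole weight stays with [w] and the bound for [beta = 0] is
   applied. This leaves [g2] unweighted and the total mass of [s1 - s2] in the result; [om <= 1]
   keeps the norm of [q] below the weighted norm of [w]. *)
pose q (t : mR) := om t * `|w t|.
have q0 t : 0 <= q t by rewrite mulr_ge0.
have mq : measurable_fun setT q by exact: measurable_funM.
have q2 t : D t -> q t ^+ 2 <= expR (- 2 * beta * t) * `|w t| ^+ 2.
  move=> tD; rewrite /q -omE// exprMn ler_wpM2r ?sqr_ge0// expr2 ler_piMr//.
have iq : leb.-integrable D (EFin \o (fun t => q t ^+ 2)).
  apply: (integrable_le measurable_oo _ _ (integrable_energy b0)).
    by apply: measurable_funTS; exact: measurable_funX.
  by move=> t tD; rewrite ger0_norm ?sqr_ge0// q2.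
pose Q := \int[leb]_(t in D) (q t ^+ 2).
have EQ : (\int[leb]_(t in D) (q t ^+ 2)%:E = Q%:E)%E by rewrite /Q EFin_Rintegral.
have QX : Q <= X by exact: (le_Rintegral measurable_oo iq (integrable_energy b0) q2).
have Q0 : 0 <= Q by apply: Rintegral_ge0 => t _; exact: sqr_ge0.
have [j1 B1] := delayed_form_bound (tvar_ltyT s1) b0 mp1 mw (fun=> normr_ge0 _)
  (fun=> normr_ge0 _) (E_past b0) (E_energy b0).
have [j2 B2] := delayed_form_bound0 (tvar_ltyT (csub s1 s2)) mp2 mq (fun=> normr_ge0 _)
  q0 EG EQ.
rewrite -/dI1 -/dI2 -/X -/k -/N in j1 B1 j2 B2.
have pos := present_form_ge0 sw sdw cc cw c0 cdw mom om0 om1 omd.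
have omn t : `|om t| <= 1 by rewrite ger0_norm.
have ipr := present_integrable mom omn sdw sw.
have k1 := integrable_realZl (- alpha) measurable_oo (integrable_energy b0).
have k2 := integrable_realZl L1 measurable_oo j1.
have k3 := integrable_realZl L1 measurable_oo j2.
have k12 := integrable_realD measurable_oo k1 k2.
have k123 := integrable_realD measurable_oo k12 k3.
(* The equation tested with [om t *: w t]: coercivity yields the first term, the delayed difference
   the second, the change of kernel the third. *)
have : present_form T om dw w <= - alpha * X + L1 * (k * X) + L1 * (N * (Num.sqrt G * Num.sqrt X)).
  apply: (le_trans (ae_le_Rintegral measurable_oo ipr k123 _)).
    apply: ae_mono difference_pairing_le => t + tD => /(_ tD (w t)) h.
    rewrite omE// /q omE//.
    have := a0_coercive (w t); have := ler_norm (dw t (w t) + a0 (w t) (w t)).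
    have := expR_ge0 (- 2 * beta * t); set E := expR _ => E0 h1 h2.
    have h3 : dw t (w t) <= - alpha * `|w t| ^+ 2 + L1 * `|w t| * (dI1 t + dI2 t).
      by move: (le_trans h1 h) h2; lra.
    by move: (ler_wpM2l E0 h3); lra.
  rewrite (RintegralD measurable_oo k12 k3) (RintegralD measurable_oo k1 k2).
  rewrite (RintegralZl _ measurable_oo (integrable_energy b0)).
  rewrite (RintegralZl _ measurable_oo j1) (RintegralZl _ measurable_oo j2).
  rewrite -/X -addrA -addrA lerD2l lerD// ler_wpM2l//.
    by rewrite -expr2 sqr_sqrtr ?energy_ge0// in B1.
  apply: (le_trans B2); rewrite ler_wpM2l ?fine_ge0// ler_wpM2l ?sqrtr_ge0//.
  by rewrite ler_sqrt// energy_ge0.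
move=> /(le_trans pos) h.
have [X0|X0] := eqVneq (Num.sqrt X) 0.
  rewrite X0 !mulr_ge0 ?sqrtr_ge0 ?invr_ge0 ?fine_ge0//; exact: ltW.
have Xp : 0 < Num.sqrt X by rewrite lt_def X0 sqrtr_ge0.
rewrite mulrAC ler_pdivlMr// -(ler_pM2r Xp).
have : Num.sqrt X * Num.sqrt X = X by rewrite -expr2 sqr_sqrtr ?energy_ge0.
move: h; set x := Num.sqrt X; set g := Num.sqrt G => h xx.
have -> : x * (alpha - L1 * k) * x = (x * x) * (alpha - L1 * k) by ring.
by rewrite xx; move: h; lra.
Qed.

(** The pointwise bound for [|dw t|] is multiplied by [|dw t|] itself, so that the convolution
    bounds apply with [q = |dw|]; a factor [sqrt Y] is then divided out. There is nothing to absorb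
    here, so [beta = 0] and total masses replace [kappa]. *)
Lemma derivative_stability : Num.sqrt (sqnorm T dw) <=
  (L0 + L1 * normM tau s1) * Num.sqrt (sqnorm T w) +
  L1 * normM tau (csub s1 s2) * Num.sqrt (\int[leb]_(t in J) (`|g2 t| ^+ 2)).
Proof.
rewrite -/G; set Y := sqnorm T dw; set X := sqnorm T w.
have [j1 B1] := delayed_form_bound0 (tvar_ltyT s1) mp1 mdw (fun=> normr_ge0 _)
  (fun=> normr_ge0 _) E_past0 (sqnormE sdw).
have [j2 B2] := delayed_form_bound0 (tvar_ltyT (csub s1 s2)) mp2 mdw (fun=> normr_ge0 _)
  (fun=> normr_ge0 _) EG (sqnormE sdw).
rewrite -/dI1 -/dI2 -/Y -/X in j1 B1 j2 B2.
have j0 : leb.-integrable D (EFin \o (fun t => `|dw t| * `|w t|)).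
  apply: (square_integrableM measurable_oo sdw sw); first exact: measurable_funM.
  by move=> t _; rewrite normrM !normr_id.
have [_ iY] := sdw; have [_ iX] := sw.
have B0 : \int[leb]_(t in D) (`|dw t| * `|w t|) <= Num.sqrt X * Num.sqrt Y.
  apply: le_sqrt_young; rewrite ?sqnorm_ge0// => e e0.
  have i1 := integrable_realZl (2^-1 * e) measurable_oo iX.
  have i2 := integrable_realZl (2^-1 * e^-1) measurable_oo iY.
  rewrite mulrDr !mulrA.
  rewrite -(RintegralZl _ measurable_oo iX) -(RintegralZl _ measurable_oo iY).
  rewrite -(RintegralD measurable_oo i1 i2).
  apply: (le_Rintegral measurable_oo j0 (integrable_realD measurable_oo i1 i2)).
  by move=> t _; exact: young_half.
have k0 := integrable_realZl L0 measurable_oo j0.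
have k1 := integrable_realZl L1 measurable_oo j1.
have k2 := integrable_realZl L1 measurable_oo j2.
have k01 := integrable_realD measurable_oo k0 k1.
have k012 := integrable_realD measurable_oo k01 k2.
have YY : Num.sqrt Y * Num.sqrt Y = Y by rewrite -expr2 sqr_sqrtr ?sqnorm_ge0.
have h : Y <= L0 * (Num.sqrt X * Num.sqrt Y) +
    L1 * (normM tau s1 * (Num.sqrt X * Num.sqrt Y)) +
    L1 * (normM tau (csub s1 s2) * (Num.sqrt G * Num.sqrt Y)).
  apply: (le_trans (ae_le_Rintegral measurable_oo iY k012 _)).
    apply: ae_mono difference_pairing_le => t + tD => /(_ tD) hv.
    have : `|dw t| <= L0 * `|w t| + L1 * (dI1 t + dI2 t).
      apply: dual_norm_le => v v1; have := hv v.
      have b1 : 0 <= dI1 t by apply: delayed_integral_ge0 => x; exact: normr_ge0.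
      have b2 : 0 <= dI2 t by apply: delayed_integral_ge0 => x; exact: normr_ge0.
      have := ler_normB (dw t v + a0 (w t) v) (a0 (w t) v); rewrite addrK.
      have := a0L (w t) v; have := normr_ge0 v; have := normr_ge0 (w t).
      move=> c1 c2 c3 c4 c5.
      have e1 : L0 * `|w t| * `|v| <= L0 * `|w t| by rewrite ler_piMr// mulr_ge0.
      have e2 : L1 * `|v| * (dI1 t + dI2 t) <= L1 * (dI1 t + dI2 t).
        by rewrite ler_wpM2r ?addr_ge0// ler_piMr.
      by rewrite (le_trans c4)// [leRHS]addrC lerD// ?(le_trans c5)// (le_trans c3).
    move=> /(ler_wpM2l (normr_ge0 (dw t))); rewrite -expr2 => /le_trans; apply.
    by rewrite le_eqVlt; apply/orP; left; apply/eqP; ring.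
  rewrite (RintegralD measurable_oo k01 k2) (RintegralD measurable_oo k0 k1).
  rewrite (RintegralZl _ measurable_oo j0).
  rewrite (RintegralZl _ measurable_oo j1) (RintegralZl _ measurable_oo j2).
  by rewrite !lerD// ler_wpM2l.
have [Y0|Y0] := eqVneq (Num.sqrt Y) 0.
  by rewrite Y0 addr_ge0// !mulr_ge0 ?sqrtr_ge0 ?addr_ge0 ?mulr_ge0 ?fine_ge0.
have Yp : 0 < Num.sqrt Y by rewrite lt_def Y0 sqrtr_ge0.
rewrite -(ler_pM2r Yp) YY (le_trans h)// le_eqVlt; apply/orP; left; apply/eqP.
ring.
Qed.

End comparison.

(** * Differences of weak solutions *)

Section weak_solutions.
Context {R : realType} {V H : hilbertType R} (iota : {linear V -> H}) (T tau : R).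
Local Notation mR := (measurableTypeR R).
Context (a0 a1 : {biscalar V}) (L0 : R) (u0 : H) (f : R -> dual V) (psi : R -> V).
Hypothesis T_gt0 : 0 < T.
Hypothesis tau_gt0 : 0 < tau.
Hypothesis V_separable : separable V.
Hypothesis iota_continuous : continuous iota.
Hypothesis a0L : forall w v, `|a0 w v| <= L0 * `|w| * `|v|.
Hypothesis psi_L2 : mem_L2 (- tau) 0 psi.
Local Notation leb := (@lebesgue_measure R).
Local Notation D := (`]0, T[%classic : set mR).
Local Notation J := (`](- tau), T[%classic : set mR).
Implicit Types (u v : R -> V) (c : R -> H) (g : mR -> V).
Implicit Types (s : {charge set mR -> \bar R}).

Lemma continuous_rep_eq0 u c1 c2 : continuous_rep iota T u c1 ->
  continuous_rep iota T u c2 -> c1 0 = c2 0.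
Proof.
move=> [cc1 cu1] [cc2 cu2]; apply/eqP; rewrite -subr_eq0 -normr_eq0; apply/eqP.
have h : {within `[0, T], continuous (fun t => `|c1 t - c2 t|)}.
  move=> x; apply: cvg_norm; apply: cvgB; [exact: cc1|exact: cc2].
apply: (within_continuous_ae_eq0 T_gt0 h); last by rewrite in_itv/= lexx ltW.
apply: ae_mono2 cu1 cu2 => t e1 e2 tD; rewrite e1// e2// subrr normr0//.
Qed.

Lemma continuous_repB u v cu cv : continuous_rep iota T u cu ->
  continuous_rep iota T v cv -> continuous_rep iota T (u - v) (cu - cv).
Proof.
move=> [cc1 cu1] [cc2 cu2]; split.
  by move=> x; apply: cvgB; [exact: cc1|exact: cc2].
apply: ae_mono2 cu1 cu2 => t e1 e2 tD.
have -> : (cu - cv) t = cu t - cv t by [].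
by rewrite e1// e2// -linearB.
Qed.

Lemma weak_derivativeP u : mem_W iota T u ->
  mem_L2 0 T (weak_derivative iota T u) /\
  is_weak_derivative iota T u (weak_derivative iota T u).
Proof.
move=> [_ [dw dwL dwu]].
by apply: (@xgetPex _ (fun=> 0) [set w | mem_L2 0 T w /\ is_weak_derivative iota T u w]); exists dw.
Qed.

Lemma mem_L2B (E : normedModType R) (a b : R) (h1 h2 : R -> E) :
  mem_L2 a b h1 -> mem_L2 a b h2 -> mem_L2 a b (h1 - h2).
Proof.
move=> /mem_L2_rep[r1 sr1 e1] /mem_L2_rep[r2 sr2 e2].
apply: (rep_mem_L2 (square_integrableB measurable_oo sr1 sr2)).
apply: ae_mono2 e1 e2 => t e1 e2 tD.
have -> : (h1 - h2) t = h1 t - h2 t by [].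
by rewrite e1// e2.
Qed.

(** [weak_derivative] is a choice by [xget]; uniqueness almost everywhere is what relates the
    derivative chosen for [u - v] to those chosen for [u] and [v]. *)
Lemma weak_derivative_ae_unique u c (w1 w2 : R -> dual V) : mem_L2 0 T u ->
  continuous_rep iota T u c -> mem_L2 0 T w1 -> mem_L2 0 T w2 ->
  is_weak_derivative iota T u w1 -> is_weak_derivative iota T u w2 ->
  w1 = w2 %[ae leb in D].
Proof.
move=> uL cu /mem_L2_rep[r1 sr1 e1] /mem_L2_rep[r2 sr2 e2] d1 d2.
have e12 : r1 = r2 %[ae leb in D].
  apply: (dual_ae_eq V_separable sr1 sr2) => z a b a_ge0 ab bT.
  rewrite -(weak_derivative_pairing iota_continuous z uL sr1 e1 d1 cu a_ge0 ab bT).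
  exact: (weak_derivative_pairing iota_continuous z uL sr2 e2 d2 cu a_ge0 ab bT).
apply: ae_mono2 (ae_mono2 (fun t a b => conj a b) e1 e2) e12 => t [h1 h2] h12 tD.
by rewrite h1// h2// h12.
Qed.

Lemma weak_derivativeB u v cu cv : mem_W iota T u -> mem_W iota T v ->
  continuous_rep iota T u cu -> continuous_rep iota T v cv ->
  weak_derivative iota T (u - v) =
    weak_derivative iota T u - weak_derivative iota T v %[ae leb in D].
Proof.
move=> wu wv cru crv; have [Lu du] := weak_derivativeP wu.
have [Lv dv] := weak_derivativeP wv; have [u2 _] := wu; have [v2 _] := wv.
have dB := is_weak_derivativeB iota_continuous u2 v2 Lu Lv du dv.
have uv2 := mem_L2B u2 v2; have dL := mem_L2B Lu Lv.
have wuv : mem_W iota T (u - v) by split => //; eexists; [exact: dL|].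
have [Luv duv] := weak_derivativeP wuv.
exact: (weak_derivative_ae_unique uv2 (continuous_repB cru crv) Luv dL duv dB).
Qed.

(** Time 0 lies in neither of the open intervals on which [psi] and [u] are controlled, and is
    discarded as a null set. *)
Lemma ae_neq0 : \forall x \ae leb, x != 0 :> R.
Proof.
exists [set 0 : mR]; split => //.
  exact: lebesgue_measure_set1.
by move=> x /= /negP; rewrite negbK => /eqP.
Qed.

Lemma joined_square_integrable u g : mem_L2 0 T u -> strongly_measurable g ->
  joined psi u = g %[ae leb in J] -> square_integrable leb J g.
Proof.
move=> /mem_L2_rep[ru [mru iru] eu] mg eg; apply: square_integrableP => //.
have [rp [mrp irp] ep] := mem_L2_rep psi_L2.
pose F1 := (fun x : mR => (`|rp x| ^+ 2)%:E) \_
  (`](- tau), 0[%classic : set mR).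
pose F2 := (fun x : mR => (`|ru x| ^+ 2)%:E) \_ D.
have F10 x : (0 <= F1 x)%E by apply: erestrict_ge0 => y _; rewrite lee_fin sqr_ge0.
have F20 x : (0 <= F2 x)%E by apply: erestrict_ge0 => y _; rewrite lee_fin sqr_ge0.
have mF1 : measurable_fun setT F1.
  apply/(measurable_restrictT _ _).1; first exact: measurable_oo.
  by have [] := integrableP _ _ _ irp.
have mF2 : measurable_fun setT F2.
  apply/(measurable_restrictT _ _).1; first exact: measurable_oo.
  by have [] := integrableP _ _ _ iru.
apply: (@le_lt_trans _ _ (\int[leb]_(x in J) (F1 x + F2 x))%E).
  apply: ae_le_ge0_integral => [x _|x _|].
  - by rewrite lee_fin sqr_ge0.
  - by rewrite adde_ge0.
  have h1 := ae_mono2 (fun t a b => conj a b) eu ep.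
  have h2 := ae_mono2 (fun t a b => conj a b) eg ae_neq0.
  apply: ae_mono2 h1 h2 => x [eux epx] [egx x0] xJ.
  move: (xJ); rewrite /= in_itv/= => /andP[xt xT].
  rewrite -(egx xJ) /joined; have [xn|xp|xe] := ltgtP x 0; last by rewrite xe eqxx in x0.
  - have xI : `](- tau), 0[%classic x by rewrite /= in_itv/= xt.
    by rewrite (epx xI) /F1 {1}/patch mem_set// leeDl.
  - have xI : `]0, T[%classic x by rewrite /= in_itv/= xp.
    by rewrite (eux xI) /F2 /patch mem_set// leeDr.
rewrite ge0_integralD//; last first.
- exact: measurable_funTS.
- exact: measurable_funTS.
rewrite -[X in (X + _)%E]integral_mkcondr -[X in (_ + X)%E]integral_mkcondr.
rewrite !setIidr; last 2 first.
- by move=> x /=; rewrite !in_itv/= => /andP[x0 ->]; rewrite (lt_trans _ x0)// oppr_lt0.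
- by move=> x /=; rewrite !in_itv/= => /andP[-> x0]; rewrite (lt_trans x0).
have fin (A : set mR) (r : mR -> V) :
    leb.-integrable A (EFin \o (fun x => `|r x| ^+ 2)) ->
    (\int[leb]_(x in A) (`|r x| ^+ 2)%:E < +oo)%E.
  move=> /integrableP[_]; under eq_integral do rewrite /= ger0_norm ?sqr_ge0//.
  by [].
by rewrite lte_add_pinfty// fin.
Qed.

Lemma form_opB (x y : V) : form_op a0 (x - y) = form_op a0 x - form_op a0 y.
Proof.
apply: dual_ext => z.
have -> : (form_op a0 x - form_op a0 y) z = form_op a0 x z - form_op a0 y z by [].
rewrite !(form_opE _ _ a0L); exact: (linearBl a0 z x y).
Qed.

(** Turns two solutions into representatives that satisfy the hypotheses of the comparison
    estimates. *)
Lemma weak_solution_difference s1 s2 u v cu cv :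
  weak_solution iota a0 a1 T tau s1 u0 f psi u ->
  weak_solution iota a0 a1 T tau s2 u0 f psi v ->
  continuous_rep iota T u cu -> continuous_rep iota T v cv ->
  exists (w : mR -> V) (dw : mR -> dual V) g1 g2,
  [/\ [/\ square_integrable leb D w, u - v = w %[ae leb in D],
          square_integrable leb D dw &
          weak_derivative iota T (u - v) = dw %[ae leb in D]],
      [/\ {within `[0, T], continuous (cu - cv)},
          \forall t \ae leb, D t -> (cu - cv) t = iota (w t),
          (cu - cv) 0 = 0 &
          forall z a b, 0 <= a -> a <= b -> b <= T ->
            inner ((cu - cv) b) (iota z) - inner ((cu - cv) a) (iota z) =
            \int[leb]_(t in `]a, b[) dw t z],
      [/\ square_integrable leb J g1, square_integrable leb J g2,
          joined psi v = g2 %[ae leb in J] &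
          \forall x \ae leb, J x -> g1 x - g2 x = if 0 < x then w x else 0] &
      \forall t \ae leb, D t -> dw t + form_op a0 (w t) +
        (delay_op a1 tau s1 g1 t - delay_op a1 tau s2 g2 t) = 0].
Proof.
move=> [wu [c1 rc1 c10] [g1 [mg1 eg1 eq1]]] [wv [c2 rc2 c20] [g2 [mg2 eg2 eq2]]] cru crv.
have [u2 _] := wu; have [v2 _] := wv.
have rB := continuous_repB cru crv.
have wB := weak_derivativeB wu wv cru crv.
have [Lu du] := weak_derivativeP wu; have [Lv dv] := weak_derivativeP wv.
have uv2 := mem_L2B u2 v2.
have dB := is_weak_derivativeB iota_continuous u2 v2 Lu Lv du dv.
have [w sw ew] := mem_L2_rep uv2.
have [dw sdw edw] := mem_L2_rep (mem_L2B Lu Lv).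
exists w, dw, g1, g2; split.
- split => //; apply: ae_mono2 wB edw => t h1 h2 tD; rewrite h1// h2//.
- have [rB1 rB2] := rB; split => //.
  + by apply: ae_mono2 rB2 ew => t h1 h2 tD; rewrite h1// h2.
  (* The initial value is known for the continuous representatives contained in the two solutions;
     [cu] and [cv] agree with them at 0. *)
  + have -> : (cu - cv) 0 = cu 0 - cv 0 by [].
    rewrite (continuous_rep_eq0 cru rc1) (continuous_rep_eq0 crv rc2).
    by rewrite c10 c20 subrr.
  + move=> z a b a_ge0 ab bT.
    exact: (weak_derivative_pairing iota_continuous z uv2 sdw edw dB rB a_ge0 ab bT).
- split=> //; first exact: joined_square_integrable u2 mg1 eg1.
    exact: joined_square_integrable v2 mg2 eg2.
  have h1 := ae_mono2 (fun t a b => conj a b) eg1 eg2.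
  have h2 := ae_mono2 (fun t a b => conj a b) ew ae_neq0.
  apply: ae_mono2 h1 h2 => x [e1 e2] [ewx x0] xJ.
  rewrite -(e1 xJ) -(e2 xJ) /joined; have [xn|xp|xe] := ltgtP x 0.
  + by rewrite subrr.
  + by rewrite -ewx//; move: xJ; rewrite /= !in_itv/= => /andP[_ ->]; rewrite xp.
  + by rewrite xe eqxx in x0.
have h1 := ae_mono2 (fun t a b => conj a b) eq1 eq2.
have h2 := ae_mono2 (fun t a b => conj a b) ew edw.
apply: ae_mono2 h1 h2 => t [e1 e2] [ewt edt] tD.
rewrite -(ewt tD) -(edt tD).
have -> : (u - v) t = u t - v t by [].
have -> : (weak_derivative iota T u - weak_derivative iota T v) t =
  weak_derivative iota T u t - weak_derivative iota T v t by [].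
rewrite form_opB.
have := e1 tD; have := e2 tD.
move: (weak_derivative iota T u t) (weak_derivative iota T v t) => d1 d2.
move: (form_op a0 (u t)) (form_op a0 (v t)) (delay_op a1 tau s1 g1 t) (delay_op a1 tau s2 g2 t).
move=> x1 x2 y1 y2 E2 E1.
by rewrite [d1 - d2 + _]addrACA [_ + (y1 - y2)]addrACA E1 -!opprD E2 subrr.
Qed.

End weak_solutions.

(** * Dependence of [kappa] on the kernel and on the weight *)

Section kappa.
Context {R : realType} (tau : R).
Implicit Types (s : {charge set (measurableTypeR R) -> \bar R}) (beta : R).
Local Notation I := (`[0, tau]%classic : set (measurableTypeR R)).

Let mI : measurable I. Proof. exact: measurable_itv. Qed.

Let weight_le1 beta x : 0 <= beta -> I x -> expR (- beta * x) <= 1.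
Proof.
move=> b0; rewrite /= in_itv/= => /andP[x0 _].
by rewrite -expR0 ler_expR mulNr oppr_le0 mulr_ge0.
Qed.

Let tvar_fin s : tvar s I \is a fin_num.
Proof. by rewrite ge0_fin_numE// (measure_le_lty (tvar_ltyT s)). Qed.

Lemma normM_ge0 s : 0 <= normM tau s.
Proof. exact: fine_ge0. Qed.

Lemma normM_le_csub s1 s2 : normM tau s1 <= normM tau s2 + normM tau (csub s1 s2).
Proof.
rewrite /normM -lee_fin EFinD !fineK ?tvar_fin//; exact: tvar_le_csub.
Qed.

Lemma kappa_le_csub s1 s2 beta : 0 <= beta ->
  kappa tau s1 beta <= kappa tau s2 beta + normM tau (csub s1 s2).
Proof.
move=> b0; rewrite /kappa /normM -lee_fin EFinD.
have iw s := integrable_expRM tau (tvar_ltyT s) b0.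
rewrite !EFin_Rintegral//.
have mw : measurable_fun I (fun x => (expR (- beta * x))%:E).
  by apply/measurable_EFinP; apply: measurable_funTS; exact: measurable_expRM.
have w0 x : I x -> (0 <= (expR (- beta * x))%:E)%E by rewrite lee_fin expR_ge0.
apply: (@le_trans _ _ (\int[measure_add (tvar s2) (tvar (csub s1 s2))]_(x in I)
    (expR (- beta * x))%:E)%E).
  apply: ge0_le_measure_integral_in => // A mA.
  by rewrite [leRHS](measure_addE (tvar s2) (tvar (csub s1 s2)) A) tvar_le_csub.
rewrite ge0_integral_measure_add// leeD2l//.
apply: (@le_trans _ _ (\int[tvar (csub s1 s2)]_(x in I) 1)%E).
  by apply: ge0_le_integral => // x xI; rewrite lee_fin weight_le1.
by rewrite integral_cst// mul1e fineK// tvar_fin.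
Qed.

(** Dominated convergence along integer [beta]: the weight [exp(-n x)] tends to 0 at each [x > 0] in
    [[0, tau]] and to 1 only at the uncharged point 0. *)
Lemma kappa_small s e : M0tau tau s -> 0 < e -> exists2 beta, 0 <= beta & kappa tau s beta <= e.
Proof.
move=> [_ s0] e0.
have := @Rintegral_dominated_cvg _ _ R (tvar s) I (fun n x => expR (- n%:R * x))
  (fun=> 0) (fun=> 1) mI.
rewrite Rintegral_cst// mul0r => h.
have : \int[tvar s]_(x in I) expR (- n%:R * x) @[n --> \oo] --> 0.
  apply: h.
  - by move=> n; apply: measurable_funTS; exact: measurable_expRM.
  - exact: measurable_cst.
  - have ax : \forall x \ae tvar s, x != 0 :> R.
      exists [set 0 : measurableTypeR R]; split => //.
      by move=> x /= /negP; rewrite negbK => /eqP.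
    apply: ae_mono ax => x x0; rewrite /= in_itv/= => /andP[x0' _].
    have xp : 0 < x by rewrite lt_def x0.
    have -> : (fun n => expR (- n%:R * x)) = (fun n => expR (- x) ^+ n).
      by apply/funext => n; rewrite -expRM_natl mulNr mulrN.
    by apply: cvg_expr; rewrite ger0_norm ?expR_ge0// -expR0 ltr_expR oppr_lt0.
  - apply: (integrable_bounded (M := 1)) => //.
    + exact: (measure_le_lty (tvar_ltyT s)).
    + by move=> x _; rewrite ger0_norm.
  - by move=> n x xI; rewrite ger0_norm ?expR_ge0// weight_le1.
move=> /(cvgr_le 0)/(_ e e0)[n _ hn]; exists n%:R => //.
by apply: hn => /=.
Qed.

End kappa.

(** On []0, T[] the weight [exp(-2 beta t)] is at least [exp(-2 beta T)]. *)
Lemma normL2_le_weighted (R : realType) (E : normedModType R) (T beta : R) (h : R -> E) :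
  0 <= beta -> mem_L2 0 T h -> normL2 0 T h <= expR (beta * T) * normL2w beta 0 T h.
Proof.
move=> b0 /mem_L2_rep[w sw ew]; rewrite (eq_normL2 ew) (eq_normL2w beta ew).
rewrite /normL2 /normL2w.
have -> : expR (beta * T) = Num.sqrt (expR (2 * beta * T)).
  by rewrite -mulrA expRM_natl sqrtr_sqr ger0_norm ?expR_ge0.
rewrite -sqrtrM ?expR_ge0// ler_wsqrtr//.
have [mw iw] := sw.
have ie : (@lebesgue_measure R).-integrable `]0, T[
    (EFin \o (fun t => expR (- 2 * beta * t) * `|w t| ^+ 2)).
  apply: (integrable_le measurable_oo _ _ iw).
    apply: measurable_funTS; apply: measurable_funM.
      exact: measurable_expRM.
    by apply: measurable_funX; exact: measurable_fun_strong_norm.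
  move=> t; rewrite /= in_itv/= => /andP[t0 _].
  rewrite ger0_norm ?mulr_ge0 ?expR_ge0 ?sqr_ge0// ler_piMl ?sqr_ge0//.
  by rewrite -[leRHS]expR0 ler_expR -mulrA mulNr oppr_le0 !mulr_ge0// ltW.
rewrite -(RintegralZl _ measurable_oo ie).
apply: (le_Rintegral measurable_oo iw (integrable_realZl _ measurable_oo ie)).
move=> t; rewrite /= in_itv/= => /andP[_ tT].
rewrite mulrA -expRD ler_peMl ?sqr_ge0// -[leLHS]expR0 ler_expR.
rewrite [leRHS](_ : _ = 2 * beta * (T - t)); last by ring.
by rewrite !mulr_ge0// subr_ge0 ltW.
Qed.

(** * Stability estimates for pairs of solutions *)

Section stability.
Context {R : realType} {V H : hilbertType R} (iota : {linear V -> H}) (T tau : R).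
Context (a0 a1 : {biscalar V}) (L0 L1 alpha : R).
Context (u0 : H) (f : R -> dual V) (psi : R -> V).
Hypothesis T_gt0 : 0 < T.
Hypothesis tau_gt0 : 0 < tau.
Hypothesis V_separable : separable V.
Hypothesis iota_continuous : continuous iota.
Hypothesis L0_ge0 : 0 <= L0.
Hypothesis L1_gt0 : 0 < L1.
Hypothesis alpha_gt0 : 0 < alpha.
Hypothesis a0L : forall w v, `|a0 w v| <= L0 * `|w| * `|v|.
Hypothesis a1L : forall w v, `|a1 w v| <= L1 * `|w| * `|v|.
Hypothesis a0_coercive : forall v, alpha * `|v| ^+ 2 <= a0 v v.
Hypothesis psi_L2 : mem_L2 (- tau) 0 psi.
Implicit Types (s : {charge set (measurableTypeR R) -> \bar R}) (u v : R -> V).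
Local Notation solves s u := (weak_solution iota a0 a1 T tau s u0 f psi u).

Let L1_ge0 : 0 <= L1. Proof. exact: ltW. Qed.

Lemma weak_solution_rep s u : solves s u -> exists c, continuous_rep iota T u c.
Proof. by move=> [_ [c rc _] _]; exists c. Qed.

Lemma solution_weighted_stability s1 s2 beta u v : solves s1 u -> solves s2 v ->
  0 <= beta -> 0 < alpha - L1 * kappa tau s1 beta ->
  normL2w beta 0 T (u - v) <=
    L1 * normM tau (csub s1 s2) / (alpha - L1 * kappa tau s1 beta) *
    normL2 (- tau) T (joined psi v).
Proof.
move=> su sv b0 ka; have [cu ru] := weak_solution_rep su; have [cv rv] := weak_solution_rep sv.
have [w [dw [g1 [g2 [[sw ew sdw edw] [cc cw c0 cdw] [sg1 sg2 eg2 g12] eqn]]]]] :=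
  weak_solution_difference T_gt0 tau_gt0 V_separable iota_continuous a0L psi_L2 su sv ru rv.
rewrite (eq_normL2w beta ew) (eq_normL2 eg2).
exact: (weighted_stability L1_ge0 (ltW tau_gt0) a0L a1L a0_coercive sw sdw cc cw c0 cdw
  sg1 sg2 g12 eqn b0 ka).
Qed.

Lemma solution_derivative_stability s1 s2 u v : solves s1 u -> solves s2 v ->
  normL2 0 T (weak_derivative iota T (u - v)) <=
    (L0 + L1 * normM tau s1) * normL2 0 T (u - v) +
    L1 * normM tau (csub s1 s2) * normL2 (- tau) T (joined psi v).
Proof.
move=> su sv; have [cu ru] := weak_solution_rep su; have [cv rv] := weak_solution_rep sv.
have [w [dw [g1 [g2 [[sw ew sdw edw] [cc cw c0 cdw] [sg1 sg2 eg2 g12] eqn]]]]] :=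
  weak_solution_difference T_gt0 tau_gt0 V_separable iota_continuous a0L psi_L2 su sv ru rv.
rewrite (eq_normL2 ew) (eq_normL2 edw) (eq_normL2 eg2).
exact: (derivative_stability L0_ge0 L1_ge0 (ltW tau_gt0) a0L a1L sw sdw sg1 sg2 g12 eqn).
Qed.

Lemma solution_sup_stability s1 s2 u v cu cv t : solves s1 u -> solves s2 v ->
  continuous_rep iota T u cu -> continuous_rep iota T v cv -> 0 <= t <= T ->
  `|(cu - cv) t| <=
    2 * (normL2 0 T (weak_derivative iota T (u - v)) + normL2 0 T (u - v)).
Proof.
move=> su sv ru rv tT.
have [w [dw [g1 [g2 [[sw ew sdw edw] [cc cw c0 cdw] [sg1 sg2 eg2 g12] eqn]]]]] :=
  weak_solution_difference T_gt0 tau_gt0 V_separable iota_continuous a0L psi_L2 su sv ru rv.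
have h := sup_energy_le sw sdw cc cw c0 cdw tT.
rewrite (eq_normL2 ew) (eq_normL2 edw).
have yE : normL2 0 T dw ^+ 2 = sqnorm T dw by rewrite sqr_sqrtr// sqnorm_ge0.
have xE : normL2 0 T w ^+ 2 = sqnorm T w by rewrite sqr_sqrtr// sqnorm_ge0.
rewrite -yE -xE in h.
have y0 : 0 <= normL2 0 T dw by exact: sqrtr_ge0.
have x0 : 0 <= normL2 0 T w by exact: sqrtr_ge0.
rewrite -(@ler_pXn2r _ 2) ?nnegrE ?mulr_ge0 ?addr_ge0// (le_trans h)//.
have := sqr_ge0 (normL2 0 T dw - normL2 0 T w); have := mulr_ge0 x0 y0.
have := sqr_ge0 (normL2 0 T w); have := sqr_ge0 (normL2 0 T dw).
rewrite exprMn !sqrrD sqrrN; lra.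
Qed.

Lemma weak_solution_difference_L2 s1 s2 u v : solves s1 u -> solves s2 v ->
  mem_L2 0 T (u - v).
Proof. by move=> [[uL _] _ _] [[vL _] _ _]; exact: mem_L2B. Qed.

(* A Lipschitz bound in the kernel, valid near [s2]: the weight [beta] is chosen so that
   half of the coercivity of [a0] survives for every kernel close to [s2]. *)
Lemma local_lipschitz s2 v : M0tau tau s2 -> solves s2 v ->
  exists2 K, 0 <= K & exists2 d, 0 < d & forall s1 u, solves s1 u ->
    normM tau (csub s1 s2) <= d ->
    normL2 0 T (u - v) <= K * normM tau (csub s1 s2) /\
    normL2 0 T (weak_derivative iota T (u - v)) <= K * normM tau (csub s1 s2).
Proof.
(* Both [kappa] of [s2] and the distance of the kernels will be at most [e]. Then [kappa] of [s1] is
   at most [2 e], which costs [alpha / 2] of the coercivity. *)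
move=> Ms sv; pose e := alpha / (4 * L1).
have e0 : 0 < e by rewrite divr_gt0// mulr_gt0.
have [beta b0 kb] := kappa_small Ms e0.
pose G := normL2 (- tau) T (joined psi v).
have G0 : 0 <= G by exact: sqrtr_ge0.
(* The constant of the weighted estimate with remaining coercivity [alpha / 2], times the price of
   removing the weight. *)
pose C := expR (beta * T) * (L1 / (alpha / 2) * G).
have C0 : 0 <= C by rewrite !mulr_ge0 ?expR_ge0 ?invr_ge0// divr_ge0// ltW.
pose M := normM tau s2; have M0 : 0 <= M by exact: normM_ge0.
pose K' := (L0 + L1 * (M + 1)) * C + L1 * G.
have K'0 : 0 <= K'.
  by apply: addr_ge0; apply: mulr_ge0 => //; rewrite addr_ge0// mulr_ge0// addr_ge0.
exists (C + K'); first by rewrite addr_ge0.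
(* The bound [e] protects the coercivity; the bound 1 keeps the total mass of [s1] below the [M + 1]
   in [K']. *)
exists (Num.min e 1); first by rewrite lt_min e0 ltr01.
move=> s1 u su; rewrite le_min => /andP[de d1]; set d := normM _ _ in de d1 *.
have d0 : 0 <= d by exact: normM_ge0.
have kd : alpha / 2 <= alpha - L1 * kappa tau s1 beta.
  have k1 : kappa tau s1 beta <= e + e.
    by rewrite (le_trans (kappa_le_csub tau s1 s2 b0))// lerD.
  have : L1 * kappa tau s1 beta <= L1 * (e + e) by rewrite ler_wpM2l.
  have -> : L1 * (e + e) = alpha / 2.
    by rewrite /e; field; rewrite gt_eqF.
  lra.
have a2 : 0 < alpha / 2 by rewrite divr_gt0.
have ka : 0 < alpha - L1 * kappa tau s1 beta by exact: lt_le_trans kd.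
have hw := solution_weighted_stability su sv b0 ka.
have hw' : normL2w beta 0 T (u - v) <= L1 / (alpha / 2) * G * d.
  apply: le_trans hw _; rewrite -/d -/G.
  have -> (x : R) : L1 * d / x * G = L1 * d * G * x^-1 by rewrite mulrAC.
  have -> (x : R) : L1 / x * G * d = L1 * d * G * x^-1 by move: x^-1 => y; ring.
  by rewrite ler_wpM2l ?lef_pV2// !mulr_ge0.
have hx : normL2 0 T (u - v) <= C * d.
  rewrite (le_trans (normL2_le_weighted b0 (weak_solution_difference_L2 su sv)))//.
  by rewrite /C -mulrA ler_wpM2l ?expR_ge0.
have hy : normL2 0 T (weak_derivative iota T (u - v)) <= K' * d.
  rewrite (le_trans (solution_derivative_stability su sv))// -/d -/G.
  have hM : normM tau s1 <= M + 1.
    by rewrite (le_trans (normM_le_csub tau s1 s2))// lerD2l.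
  rewrite /K' [leRHS]mulrDl lerD//; last by rewrite mulrAC.
  rewrite -mulrA ler_pM ?sqrtr_ge0// ?addr_ge0 ?mulr_ge0 ?normM_ge0//.
  by rewrite lerD2l ler_wpM2l.
by split; [rewrite (le_trans hx)//|rewrite (le_trans hy)//]; rewrite ler_wpM2r// ?lerDl ?lerDr.
Qed.

End stability.

Theorem corollary5p2 (R : realType) (T tau : R) (T_gt0 : 0 < T)
    (tau_gt0 : 0 < tau) (V H : hilbertType R)
    (V_separable : separable V) (H_separable : separable H)
    (iota : {linear V -> H}) (iota_injective : injective iota)
    (iota_continuous : continuous iota) (iota_dense : dense (range iota))
    (a0 a1 : {biscalar V}) (Lambda0 Lambda1 alpha0 : R)
    (Lambda0_gt0 : 0 < Lambda0) (Lambda1_gt0 : 0 < Lambda1)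
    (alpha0_gt0 : 0 < alpha0)
    (a0_bounded : forall w v, `|a0 w v| <= Lambda0 * `|w| * `|v|)
    (a1_bounded : forall w v, `|a1 w v| <= Lambda1 * `|w| * `|v|)
    (a0_coercive : forall v, alpha0 * `|v| ^+ 2 <= a0 v v)
    (u0 : H) (f : R -> dual V) (psi : R -> V)
    (f_L2 : mem_L2 0 T f) (psi_L2 : mem_L2 (- tau) 0 psi) :
  (forall (mu nu : {charge set (measurableTypeR R) -> \bar R}) (beta : R)
      (u_mu u_nu : R -> V),
    M0tau tau mu -> M0tau tau nu -> 0 <= beta ->
    0 < alpha0 - Lambda1 * kappa tau mu beta ->
    weak_solution iota a0 a1 T tau mu u0 f psi u_mu ->
    weak_solution iota a0 a1 T tau nu u0 f psi u_nu ->
    normL2w beta 0 T (u_mu - u_nu) <=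
      Lambda1 * normM tau (csub mu nu) / (alpha0 - Lambda1 * kappa tau mu beta)
      * normL2 (- tau) T (joined psi u_nu)) /\
  (forall (mu_ : nat -> {charge set (measurableTypeR R) -> \bar R})
      (mu : {charge set (measurableTypeR R) -> \bar R})
      (u_ : nat -> R -> V) (u : R -> V),
    (forall n, M0tau tau (mu_ n)) -> M0tau tau mu ->
    normM tau (csub (mu_ n) mu) @[n --> \oo] --> (0 : R) ->
    (forall n, weak_solution iota a0 a1 T tau (mu_ n) u0 f psi (u_ n)) ->
    weak_solution iota a0 a1 T tau mu u0 f psi u ->
    normW iota T (u_ n - u) @[n --> \oo] --> (0 : R) /\
    forall (c_ : nat -> R -> H) (c : R -> H),
      (forall n, continuous_rep iota T (u_ n) (c_ n)) ->
      continuous_rep iota T u c ->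
      normC T (c_ n - c) @[n --> \oo] --> (0 : R)).
Proof.
have L0_ge0 : 0 <= Lambda0 by exact: ltW.
split=> [mu nu beta u_mu u_nu _ _ b0 ka su sv|mu_ mu u_ u _ Mmu mu_cvg su_ su].
  exact: (solution_weighted_stability T_gt0 tau_gt0 V_separable iota_continuous Lambda1_gt0
    a0_bounded a1_bounded a0_coercive psi_L2 su sv b0 ka).
have [K K0 [d d0 lip]] := local_lipschitz T_gt0 tau_gt0 V_separable iota_continuous
  L0_ge0 Lambda1_gt0 alpha0_gt0 a0_bounded a1_bounded a0_coercive psi_L2 Mmu su.
have lip_near : \forall n \near \oo,
    normL2 0 T (u_ n - u) <= K * normM tau (csub (mu_ n) mu) /\
    normL2 0 T (weak_derivative iota T (u_ n - u)) <= K * normM tau (csub (mu_ n) mu).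
  have : \forall n \near \oo, normM tau (csub (mu_ n) mu) <= d by apply: (cvgr_le 0 mu_cvg).
  by apply: filterS => n dn; exact: (lip _ _ (su_ n) dn).
have K_cvg (k : R) : k * normM tau (csub (mu_ n) mu) @[n --> \oo] --> (0 : R).
  by rewrite -(mulr0 k); exact: cvgMr.
have squeeze (h : nat -> R) (k : R) : (forall n, 0 <= h n) ->
    (\forall n \near \oo, h n <= k * normM tau (csub (mu_ n) mu)) ->
    h n @[n --> \oo] --> (0 : R).
  move=> h0 hk; apply: (squeeze_cvgr _ (cvg_cst 0) (K_cvg k)).
  by apply: filterS hk => n hn; rewrite h0.
split.
  (* The two norms in [normW] are each at most [K] times the kernel distance, and
     [sqrt (x^2 + y^2) <= x + y]. *)
  apply: (squeeze _ (K + K)) => [n|]; first exact: sqrtr_ge0.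
  apply: filterS lip_near => n [x y].
  have x0 : 0 <= normL2 0 T (u_ n - u) by exact: sqrtr_ge0.
  have y0 : 0 <= normL2 0 T (weak_derivative iota T (u_ n - u)) by exact: sqrtr_ge0.
  rewrite mulrDl (le_trans _ (lerD x y))// /normW.
  rewrite -[leRHS]ger0_norm ?addr_ge0// -sqrtr_sqr ler_wsqrtr// sqrrD.
  by rewrite lerD2r lerDl mulrn_wge0// mulr_ge0.
move=> c_ c rc_ rc.
have sup_le n t : 0 <= t <= T -> `|(c_ n - c) t| <=
    2 * (normL2 0 T (weak_derivative iota T (u_ n - u)) + normL2 0 T (u_ n - u)).
  exact: (solution_sup_stability T_gt0 tau_gt0 V_separable iota_continuous
    a0_bounded psi_L2 (su_ n) su (rc_ n) rc).
have zT : `[0, T]%classic 0 by rewrite /= in_itv/= lexx ltW.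
(* The uniform bound in [H] is twice a sum of two norms, each at most [K] times the kernel
   distance. *)
apply: (squeeze _ (4 * K)) => [n|].
  apply: (@le_trans _ _ `|(c_ n - c) 0|) => //; apply: ub_le_sup; last by exists 0.
  exists (2 * (normL2 0 T (weak_derivative iota T (u_ n - u)) + normL2 0 T (u_ n - u))).
  by move=> _ [t tI <-]; apply: sup_le; move: tI; rewrite /= in_itv.
apply: filterS lip_near => n [x y]; apply: ge_sup; first by exists `|(c_ n - c) 0|; exists 0.
move=> _ [t tI <-]; apply: le_trans (sup_le n t _) _; first by move: tI; rewrite /= in_itv.
lra.
Qed.
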